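(* Let $A\ne0$ be a normal operator in a complex infinite-dimensional Hilbert space. Then $A$ generates an immediately compact $C_0$-semigroup (of normal operators) if and only if $\sigma(A)$ is a countably infinite set of eigenvalues of $A$ with finite geometric multiplicities, which has no finite limit points and is such that, for an arbitrary arrangement $\{\lambda_n\}_{n=1}^\infty$ of $\sigma(A)$, $$\operatorname{Re}\lambda_n\to-\infty,\quad n\to\infty.$$
   Context: Normal operators are allowed to be unbounded (densely defined, closed, $A^*A=AA^*$); $\sigma(A)$ is the spectrum. A $C_0$-semigroup $\{T(t)\}_{t\ge0}$ is immediately compact if $T(t)$ is a compact operator for every $t>0$. The geometric multiplicity of an eigenvalue $\lambda$ of $A$ is $\dim\ker(A-\lambda I)$. An arrangement of a countably infinite set $S$ is a bijection $\mathbb{N}\ni n\mapsto\lambda_n\in S$, with $\mathbb{N}=\{1,2,\dots\}$. *)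

(* Defs.v *)
From HB Require Import structures.
From mathcomp Require Import all_boot all_order all_algebra.
From mathcomp Require Import complex.
From mathcomp Require Import all_classical all_reals all_analysis.

Set Implicit Arguments.
Unset Strict Implicit.
Unset Printing Implicit Defensive.

Import Order.TTheory GRing.Theory Num.Theory.
Import numFieldNormedType.Exports.

Local Open Scope classical_set_scope.
Local Open Scope complex_scope.
Local Open Scope ring_scope.

(* A partially defined operator in V: the values of the underlying total
   function off [op_dom] carry no information, so operators are compared
   with [op_eq], never with Leibniz equality. *)
Record partial_op (V : Type) := PartialOp {
  op_dom : set V;
  op_fun :> V -> V }.

Definition total_op (V : Type) (f : V -> V) : partial_op V := PartialOp setT f.

Definition op_eq (V : Type) (A B : partial_op V) : Prop :=
  op_dom A = op_dom B /\ forall x, op_dom A x -> A x = B x.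

Definition op_comp (V : Type) (A B : partial_op V) : partial_op V :=
  PartialOp [set x | op_dom B x /\ op_dom A (B x)] (fun x => A (B x)).

Definition op_graph (V : Type) (A : partial_op V) : set (V * V) :=
  [set p | op_dom A p.1 /\ p.2 = A p.1].

Section LinearAlgebra.
Variables (K : numFieldType) (V : lmodType K).

Definition linear_op (A : partial_op V) : Prop :=
  op_dom A 0 /\
  forall (a : K) (x y : V), op_dom A x -> op_dom A y ->
    op_dom A (a *: x + y) /\ A (a *: x + y) = a *: A x + A y.

(* Dimension is meant for subspaces; a set [S] that is not one never
   satisfies this. *)
Definition finite_dimensional (S : set V) : Prop :=
  exists (n : nat) (v : 'I_n -> V),
    S = [set x | exists c : 'I_n -> K, x = \sum_(i < n) c i *: v i].

Definition op_eigenspace (A : partial_op V) (l : K) : set V :=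
  [set x | op_dom A x /\ A x - l *: x = 0].

Definition op_eigenvalue (A : partial_op V) (l : K) : Prop :=
  exists x : V, [/\ op_dom A x, x != 0 & A x = l *: x].

End LinearAlgebra.

Section Hilbert.
Variables (R : realType) (H : completeNormedModType R[i]).

(* [l] belongs to the resolvent set when A - l I, with the domain of A, has an
   everywhere defined bounded inverse [S]. *)
Definition resolvent_set (A : partial_op H) : set R[i] :=
  [set l | exists S : {linear H -> H},
    [/\ continuous S,
        (forall y, op_dom A (S y) /\ A (S y) - l *: S y = y) &
        (forall x, op_dom A x -> S (A x - l *: x) = x)]].

Definition spectrum (A : partial_op H) : set R[i] := ~` resolvent_set A.

Definition compact_op (f : H -> H) : Prop :=
  linear f /\ forall B : set H, bounded_set B -> precompact (f @` B).

(* A semigroup is given as a function on the whole of R, whose values at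
   negative times carry no information. *)
Definition C0_semigroup (T : R -> H -> H) : Prop :=
  [/\ (forall t, 0 <= t -> linear (T t) /\ continuous (T t)),
      (forall x, T 0 x = x),
      (forall s t x, 0 <= s -> 0 <= t -> T (s + t) x = T s (T t x)) &
      (forall x, {within `[0, +oo[, continuous (fun t => T t x)})].

Definition immediately_compact (T : R -> H -> H) : Prop :=
  forall t, 0 < t -> compact_op (T t).

Definition generator (T : R -> H -> H) : partial_op H :=
  let quotient x h := (h^-1)%:C *: (T h x - x) in
  PartialOp [set x | cvg (quotient x h @[h --> 0^'+])]
            (fun x => lim (quotient x h @[h --> 0^'+])).

(* The inner product is linear in its first argument. *)
Variable dot : {dot H for Num.conj}.

(* The adjoint is meaningful for densely defined A only: [z] is then unique. *)
Definition adjoint_op (A : partial_op H) : partial_op H :=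
  let adj y := [set z | forall x, op_dom A x -> dot (A x) y = dot x z] in
  PartialOp [set y | adj y !=set0] (fun y => xget 0 (adj y)).

Definition normal_op (A : partial_op H) : Prop :=
  [/\ linear_op A, dense (op_dom A), closed (op_graph A) &
      op_eq (op_comp (adjoint_op A) A) (op_comp A (adjoint_op A))].

End Hilbert.

(* Main.v *)
Require Import Defs.
From HB Require Import structures.
From mathcomp Require Import all_boot all_order all_algebra.
From mathcomp Require Import complex.
From mathcomp Require Import all_classical all_reals all_analysis.
From mathcomp Require Import ring lra.

Set Implicit Arguments.
Unset Strict Implicit.
Unset Printing Implicit Defensive.

Import Order.TTheory GRing.Theory Num.Theory.
Import numFieldNormedType.Exports.

Local Open Scope classical_set_scope.
Local Open Scope complex_scope.
Local Open Scope ring_scope.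

(* A nonzero bounded normal operator C has a nonzero approximate eigenvalue. The norm of
   C^* C is an approximate eigenvalue of C^* C; scale it to 1. If |C y - u y| >= eta |y|
   for all |u| = 1 and all approximate fixed points y of C^* C, then factoring C^2 - u^2
   improves eta to 6/5 eta for C^2, and iterating contradicts |C^(2^k) y - y| <= 3 |y|.
   An isolated approximate eigenvalue is an eigenvalue, because of the gap it leaves in
   the spectrum of the corresponding B^* B. Applied to a resolvent of A on the orthogonal
   complement of all eigenvectors of A, this shows that the eigenvectors are total as
   soon as approximate eigenvalues of A yield eigenvectors.

   If A generates an immediately compact semigroup T, approximate eigenvectors of A are
   approximate eigenvectors of T(1) and hence have convergent subsequences. On
   orthonormal eigenvectors with Re l >= k, |T(1) e| = exp(Re l) is bounded below, so
   every right half plane contains finitely many eigenvalues, with multiplicity. The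
   operators T(t) and T(t)^* are simultaneously diagonal, hence T(t) is normal.

   Conversely, without finite limit points the eigenvectors are total, and
   T(t) x = sum_k exp(t l_k) P_k x, where P_k projects onto the k-th eigenspace, is the
   semigroup: T(t) is a norm limit of finite rank operators as Re l_k -> -oo. *)

(** Approximate eigenvectors take the place of spectral measures. A normal operator has no residual
    spectrum: [A] and its adjoint have the same domain and [|As x - l^* x| = |A x - l x|] there, so
    a vector orthogonal to the range of [A - l] lies in the kernel of [A - l], and a point of the
    spectrum is always an approximate eigenvalue. For unbounded [A] the equality of domains is
    itself a theorem; it rests on the domain of [As A] being a core of both operators.

    Totality of the eigenvectors needs some point outside the spectrum, because the bounded theory
    reaches [A] only through a resolvent. With a compact semigroup such a point exists because a
    half plane holds finitely many eigenvalues; with a discrete spectrum it is found next to 0.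

    The bounded theory speaks of operators on all of [H] together with a reducing subspace [N], so
    that the orthogonal complement of the eigenvectors need not be made a Hilbert space of its
    own. *)

Section HilbertSpace.
Variables (R : realType) (H : completeNormedModType R[i]).

(** * Real-valued norm *)

(* The norm of H takes its values in R[i]. *)
Definition nr (V : normedZmodType R[i]) (x : V) : R := complex.Re `|x|.

Lemma nrE (V : normedZmodType R[i]) (x : V) : `|x| = (nr x)%:C.
Proof. by rewrite /nr RRe_real // ger0_real. Qed.

Lemma nr_ge0 (V : normedZmodType R[i]) (x : V) : 0 <= nr x.
Proof. by rewrite -ler0c -nrE. Qed.

Lemma nr0 (V : normedZmodType R[i]) : nr (0 : V) = 0.
Proof. by rewrite /nr normr0. Qed.

Lemma nr_eq0 (V : normedZmodType R[i]) (x : V) : (nr x == 0) = (x == 0).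
Proof. by rewrite -(normr_eq0 x) nrE eq_complex /= eqxx andbT. Qed.

Lemma nr_gt0 (V : normedZmodType R[i]) (x : V) : (0 < nr x) = (x != 0).
Proof. by rewrite lt0r nr_ge0 andbT nr_eq0. Qed.

Lemma nrD (V : normedZmodType R[i]) (x y : V) : nr (x + y) <= nr x + nr y.
Proof. by rewrite -lecR rmorphD /= -!nrE ler_normD. Qed.

Lemma nrN (V : normedZmodType R[i]) (x : V) : nr (- x) = nr x.
Proof. by rewrite /nr normrN. Qed.

Lemma nrBC (V : normedZmodType R[i]) (x y : V) : nr (x - y) = nr (y - x).
Proof. by rewrite -nrN opprB. Qed.

Lemma nrB (V : normedZmodType R[i]) (x y : V) : nr (x - y) <= nr x + nr y.
Proof. by rewrite (le_trans (nrD _ _)) // nrN. Qed.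

Lemma nr_dist (V : normedZmodType R[i]) (z x y : V) :
  nr (x - y) <= nr (x - z) + nr (z - y).
Proof. by rewrite (le_trans _ (nrD _ _)) // subrKA. Qed.

Lemma nr_subr (V : normedZmodType R[i]) (x y : V) : nr x - nr y <= nr (x - y).
Proof. by rewrite lerBlDr (le_trans _ (nrD _ _)) // subrK. Qed.

Lemma nrZ (V : normedModType R[i]) (a : R[i]) (x : V) : nr (a *: x) = nr a * nr x.
Proof. by apply: complexI; rewrite rmorphM /= -!nrE normrZ. Qed.

Lemma nrM (a b : R[i]) : nr (a * b) = nr a * nr b.
Proof. by apply: complexI; rewrite rmorphM /= -!nrE normrM. Qed.

Lemma nr1 : nr (1 : R[i]) = 1.
Proof. by rewrite /nr normr1. Qed.

Lemma nrV (a : R[i]) : nr a^-1 = (nr a)^-1.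
Proof. by apply: complexI; rewrite fmorphV /= -!nrE normfV. Qed.

Lemma nr_real (a : R) : nr a%:C = `|a|.
Proof. by rewrite /nr normc_def /= expr0n /= addr0 sqrtr_sqr. Qed.

(** The order of [R[i]] compares only numbers with equal imaginary parts, so every positive
    tolerance of the norm topology is real. *)
Lemma gt0_real (e : R[i]) : 0 < e -> exists2 r : R, e = r%:C & 0 < r.
Proof. by move=> e0; exists (nr e); rewrite ?nr_gt0 ?gt_eqF // -nrE gtr0_norm. Qed.

Lemma nbhs_nrP (V : normedModType R[i]) (x : V) (S : set V) :
  nbhs x S <-> exists2 e : R, 0 < e & forall y, nr (y - x) < e -> S y.
Proof.
split=> [/nbhs_normP[e /= e0 eS]|[e e0 eS]]; last apply/nbhs_normP.
  have [r er r0] := gt0_real e0; exists r => // y yx; apply: eS => /=.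
  by rewrite distrC nrE er ltcR.
exists e%:C; first by rewrite /= ltcR.
by move=> y /=; rewrite distrC nrE ltcR => /eS.
Qed.

Lemma cvg_nrP (V : normedModType R[i]) (T : Type) (F : set_system T)
    (FF : Filter F) (f : T -> V) (l : V) :
  f x @[x --> F] --> l <-> forall e : R, 0 < e -> \near F, nr (f F - l) < e.
Proof.
split=> [/cvgrPdist_lt fl e e0|fl].
  near=> x; rewrite -ltcR -nrE distrC; near: x; apply: fl.
  by rewrite ltcR.
apply/cvgrPdist_lt => e /gt0_real[{}e -> e0]; near=> x.
by rewrite distrC nrE ltcR; near: x; exact: fl.
Unshelve. all: by end_near. Qed.

Lemma complete_nr (u : nat -> H) :
  (forall e : R, 0 < e -> exists n0, forall n m, (n0 <= n)%N -> (n0 <= m)%N ->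
     nr (u n - u m) < e) ->
  exists l, forall e : R, 0 < e -> exists n0, forall n, (n0 <= n)%N -> nr (u n - l) < e.
Proof.
move=> cu.
have /cauchy_cvgP/cvg_ex[l /cvg_nrP ul] : cauchy (u @ \oo).
  apply: cauchy_exP => e /gt0_real[{}e -> e0].
  have [n0 hn0] := cu _ e0; exists (u n0), n0 => // n /= n0n.
  by rewrite -ball_normE /= nrE ltcR hn0.
by exists l => e /ul[n0 _ hn0]; exists n0 => n /hn0.
Qed.

Lemma closed_graph_nrP (A : partial_op H) :
  closed (op_graph A) <-> forall x y,
    (forall e : R, 0 < e -> exists z, [/\ op_dom A z, nr (z - x) < e & nr (A z - y) < e]) ->
    op_dom A x /\ A x = y.
Proof.
split=> [cA x y xy|cA [x y] xy].
  suff [] : op_graph A (x, y) by [].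
  apply: cA => U -[[U1 U2] [/= /nbhs_nrP[e1 e10 eU1] /nbhs_nrP[e2 e20 eU2]] UU].
  have [|z [Az zx zy]] := xy (Num.min e1 e2); first by rewrite lt_min e10.
  exists (z, A z); split=> //; apply: UU; split=> /=.
    by apply: eU1; rewrite (lt_le_trans zx) // ge_min lexx.
  by apply: eU2; rewrite (lt_le_trans zy) // ge_min lexx orbT.
suff [xA AxE] : op_dom A x /\ A x = y by split.
apply: cA => e e0.
have [|[z w] [[/= Az wE] [/= zx zy]]] :=
    xy ([set z | nr (z - x) < e] `*` [set z | nr (z - y) < e]).
  exists ([set z | nr (z - x) < e], [set z | nr (z - y) < e]) => //=.
  by split; apply/nbhs_nrP; exists e.
by exists z; rewrite -wE.
Qed.

Lemma dense_nr (S : set H) : dense S ->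
  forall x (e : R), 0 < e -> exists2 y, S y & nr (y - x) < e.
Proof.
move=> dS x e e0.
have xo : nbhs x [set y | nr (y - x) < e] by apply/nbhs_nrP; exists e.
move: (xo); rewrite nbhsE => -[U [oU Ux] US].
have [|y [Uy Sy]] := dS U _ oU; first by exists x.
by exists y => //; exact: US.
Qed.

Lemma dense_setT : dense [set: H].
Proof. by move=> U [x Ux] oU; exists x. Qed.

Lemma lin_facts (V W : lmodType R[i]) (f : V -> W) : linear f ->
  [/\ f 0 = 0, forall a x, f (a *: x) = a *: f x,
      forall x y, f (x + y) = f x + f y & forall x y, f (x - y) = f x - f y].
Proof.
move=> lf; have f0 : f 0 = 0 by have := lf (-1) 0 0; rewrite !scaleN1r oppr0 addr0 addNr.
split=> // [a x|x y|x y]; first by have := lf a x 0; rewrite f0 !addr0.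
  by have := lf 1 x y; rewrite !scale1r.
by rewrite addrC -scaleN1r lf scaleN1r addrC.
Qed.

Lemma lin_nrP (f : H -> H) : linear f ->
  continuous f <-> exists2 M : R, 0 < M & forall x, nr (f x) <= M * nr x.
Proof.
move=> lf; have [f0 fZ _ fB] := lin_facts lf.
split=> [cf|[M M0 fM] x]; last first.
  apply/cvg_nrP => e e0; have : nbhs x [set y | nr (y - x) < e / M].
    by apply/nbhs_nrP; exists (e / M) => //; rewrite divr_gt0.
  apply: filterS => y /= yx; rewrite -fB (le_lt_trans (fM _)) //.
  by rewrite mulrC -ltr_pdivlMr.
have /nbhs_nrP[e e0 ef] : nbhs 0 [set y | nr (f y - f 0) < 1].
  by move: (cf 0) => /cvg_nrP/(_ 1); apply.
exists (2 / e); first by rewrite divr_gt0.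
move=> x; have [->|x0] := eqVneq x 0; first by rewrite f0 nr0 mulr0.
have nx0 : 0 < nr x by rewrite nr_gt0.
(* Rescaling [x] to norm [e / 2] brings it into the ball where [f] stays below 1. *)
have c0 : 0 < e / (2 * nr x) by rewrite divr_gt0 // mulr_gt0.
have /ef /= : nr ((e / (2 * nr x))%:C *: x - 0) < e.
  rewrite subr0 nrZ nr_real gtr0_norm // invfM mulrA -mulrA mulVf ?gt_eqF //.
  by rewrite mulr1 ltr_pdivrMr // ltr_pMr // ltr1n.
rewrite f0 subr0 fZ nrZ nr_real gtr0_norm // => h.
have := ltW h; rewrite mulrC -ler_pdivlMr // mul1r => /le_trans -> //.
by rewrite invf_div mulrAC.
Qed.

(** * Inner product, projections and adjoints *)

Variable dot : {dot H for Num.conj}.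
Hypothesis dot_norm : forall x : H, dot x x = `|x| ^+ 2.

(* On complex subspaces, orthogonality for [ip] is orthogonality for [dot]. *)
Definition ip (x y : H) : R := complex.Re (dot x y).

Lemma dotC x y : dot y x = (dot x y)^*.
Proof. by rewrite hermC expr0 mul1r. Qed.

Lemma ReD (a b : R[i]) : complex.Re (a + b) = complex.Re a + complex.Re b.
Proof. by case: a b => ? ? [? ?]. Qed.

Lemma ReN (a : R[i]) : complex.Re (- a) = - complex.Re a.
Proof. by case: a. Qed.

Lemma ipC x y : ip x y = ip y x.
Proof. by rewrite /ip (dotC y x); case: (dot y x). Qed.

Lemma ipDl x y z : ip (x + y) z = ip x z + ip y z.
Proof. by rewrite /ip linearDl ReD. Qed.

Lemma ipNl x z : ip (- x) z = - ip x z.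
Proof. by rewrite /ip linearNl ReN. Qed.

Lemma ipDr x y z : ip z (x + y) = ip z x + ip z y.
Proof. by rewrite !(ipC z) ipDl. Qed.

Lemma ipNr x z : ip z (- x) = - ip z x.
Proof. by rewrite !(ipC z) ipNl. Qed.

Lemma ip0l x : ip 0 x = 0.
Proof. by rewrite /ip linear0l. Qed.

Lemma ip0r x : ip x 0 = 0.
Proof. by rewrite ipC ip0l. Qed.

Lemma ipZ (a : R[i]) x y : ip (a *: x) y = ip x (a^* *: y).
Proof. by rewrite /ip linearZl_LR linearZr_LR /= conjCK. Qed.

Lemma ipZr (a : R) x y : ip (a%:C *: x) y = a * ip x y.
Proof. by rewrite /ip linearZl_LR /=; case: (dot x y) => ? ? /=; rewrite mul0r subr0. Qed.

Lemma ipZZ (a : R) x y : ip x (a%:C *: y) = a * ip x y.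
Proof. by rewrite ipC ipZr ipC. Qed.

Lemma ipxx x : ip x x = nr x ^+ 2.
Proof. by rewrite /ip dot_norm nrE -rmorphXn. Qed.

Lemma nrD2 x y : nr (x + y) ^+ 2 = nr x ^+ 2 + nr y ^+ 2 + 2 * ip x y.
Proof. by rewrite -!ipxx ipDl !ipDr (ipC y x); lra. Qed.

Lemma nrB2 x y : nr (x - y) ^+ 2 = nr x ^+ 2 + nr y ^+ 2 - 2 * ip x y.
Proof. by rewrite nrD2 nrN ipNr; lra. Qed.

Lemma parallelogram (x y : H) :
  nr (x + y) ^+ 2 + nr (x - y) ^+ 2 = 2 * (nr x ^+ 2 + nr y ^+ 2).
Proof. by rewrite nrD2 nrB2; lra. Qed.

Lemma quadratic_ge0_lin0 (a b : R) :
  0 <= a -> (forall t, 0 <= a * t ^+ 2 - 2 * b * t) -> b = 0.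
Proof.
move=> a0 h; apply/eqP/negP => /negP b0.
have a1 : 0 < a + 1 by lra.
have b2 : 0 < b ^+ 2 by rewrite exprn_even_gt0.
(* The minimizer would be [b / a]; since [a] may be 0, [a + 1] replaces it. *)
have := h (b / (a + 1)).
have -> : a * (b / (a + 1)) ^+ 2 - 2 * b * (b / (a + 1)) =
   - (b ^+ 2 * (a + 2)) / (a + 1) ^+ 2.
  by field; apply/negP => /eqP; lra.
rewrite leNgt mulNr oppr_lt0 divr_gt0 ?exprn_gt0 // mulr_gt0 //; lra.
Qed.

Lemma ip_le x y : ip x y <= nr x * nr y.
Proof.
have [->|y0] := eqVneq y 0; first by rewrite ip0r nr0 mulr0.
have ny : 0 < nr y by rewrite nr_gt0.
have [->|x0] := eqVneq x 0; first by rewrite ip0l nr0 mul0r.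
have nx : 0 < nr x by rewrite nr_gt0.
have : 0 <= nr ((nr y)%:C *: x - (nr x)%:C *: y) ^+ 2 by rewrite sqr_ge0.
rewrite nrB2 !nrZ !nr_real !gtr0_norm // ipZr ipZZ => h.
have : 0 <= (2 * (nr x * nr y)) * (nr x * nr y - ip x y) by lra.
by rewrite pmulr_rge0 ?subr_ge0 // !mulr_gt0.
Qed.

Lemma ip_norm x y : `|ip x y| <= nr x * nr y.
Proof. by rewrite ler_norml ip_le andbT lerNl -ipNl (le_trans (ip_le _ _)) // nrN. Qed.

Lemma ip_all0 x : (forall y, ip x y = 0) -> x = 0.
Proof. by move=> /(_ x); rewrite ipxx => /eqP; rewrite sqrf_eq0 nr_eq0 => /eqP. Qed.

Lemma dot_ip x y : dot x y = 0 <-> ip x y = 0 /\ ip ('i%C *: x) y = 0.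
Proof.
rewrite /ip linearZl_LR /=; case: (dot x y) => a b /=; rewrite !mul0r mul1r.
split=> [[-> ->]|[-> /eqP]]; first by rewrite subrr.
by rewrite sub0r oppr_eq0 => /eqP ->.
Qed.

Definition nr_closed2 (G : H -> H -> Prop) := forall x y,
  (forall e : R, 0 < e -> exists x' y', [/\ G x' y', nr (x' - x) < e & nr (y' - y) < e]) ->
  G x y.

(** The projection theorem in the Hilbert sum of two copies of [H], for the point [(u, v)] and a
    closed subspace given as a relation. It is applied to graphs of operators and, with second
    components 0, to closed subspaces of [H]. *)
Lemma projection_graph (G : H -> H -> Prop) u v :
  G 0 0 -> (forall a x y x' y', G x y -> G x' y' -> G (a *: x + x') (a *: y + y')) ->
  nr_closed2 G ->
  exists x y, G x y /\ forall x' y', G x' y' -> ip (u - x) x' + ip (v - y) y' = 0.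
Proof.
move=> G0 GL Gc.
pose d x y : R := nr (u - x) ^+ 2 + nr (v - y) ^+ 2.
pose D := [set r | exists x y, G x y /\ r = d x y].
have d_ge0 x y : 0 <= d x y by rewrite addr_ge0 // sqr_ge0.
have D0 : D (d 0 0) by exists 0, 0.
have Dlb : has_lbound D by exists 0 => _ [x [y [_ ->]]].
have Dinf : has_inf D by split; first by exists (d 0 0).
pose I := inf D.
have I_le x y : G x y -> I <= d x y by move=> Gxy; apply: ge_inf => //; exists x, y.
have ex n : exists p : H * H, G p.1 p.2 /\ d p.1 p.2 < I + n.+1%:R^-1.
  have i0 : 0 < n.+1%:R^-1 :> R by rewrite invr_gt0 ltr0n.
  have [_ [x [y [Gxy ->]]] lt] := inf_adherent i0 Dinf.
  by exists (x, y).
have [p hp] := choice ex.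
(* The parallelogram law, with [d >= I] at the midpoint: this makes minimizing sequences Cauchy. *)
have mid x y x' y' : G x y -> G x' y' ->
    nr (x - x') ^+ 2 + nr (y - y') ^+ 2 <= 2 * (d x y + d x' y' - 2 * I).
  move=> Gxy Gxy'.
  have Gm : G ((1 / 2)%:C *: (x + x')) ((1 / 2)%:C *: (y + y')).
    have G2 : G (x + x') (y + y') by have := GL 1 _ _ _ _ Gxy Gxy'; rewrite !scale1r.
    by have := GL (1 / 2)%:C _ _ _ _ G2 G0; rewrite !addr0.
  have half (w z z' : H) : nr (w - z + (w - z')) ^+ 2 =
      4 * nr (w - (1 / 2)%:C *: (z + z')) ^+ 2.
    have -> : w - z + (w - z') = 2%:C *: (w - (1 / 2)%:C *: (z + z')).
      rewrite scalerBr scalerA -rmorphM /= mulrA mulr1 divff ?pnatr_eq0 // scale1r.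
      by rewrite -(natr1 1) rmorphD /= scalerDl !scale1r opprD addrACA.
    by rewrite nrZ nr_real ger0_norm // exprMn -natrX.
  have := I_le _ _ Gm; rewrite /d.
  have := parallelogram (u - x) (u - x'); have := parallelogram (v - y) (v - y').
  have sw (w z z' : H) : w - z - (w - z') = z' - z.
    by rewrite opprB addrC addrA subrK.
  rewrite !half !sw (nrBC y') (nrBC x') => h1 h2 h3; lra.
have inv_small (e : R) : 0 < e -> exists n0, forall n, (n0 <= n)%N -> n.+1%:R^-1 < e.
  move=> e0; exists (Num.truncn e^-1) => n n0n.
  rewrite -[e]invrK ltf_pV2 ?posrE ?invr_gt0 ?ltr0n //.
  by rewrite (lt_le_trans (truncnS_gt _)) // ler_nat ltnS.
have cau (e : R) : 0 < e -> exists n0, forall n m, (n0 <= n)%N -> (n0 <= m)%N ->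
    nr ((p n).1 - (p m).1) < e /\ nr ((p n).2 - (p m).2) < e.
  (* An excess below [e^2 / 4] at both indices bounds the squared distances in [mid] by
     [2 * (e^2 / 4 + e^2 / 4) = e^2]. *)
  move=> e0; have [n0 hn0] := inv_small (e ^+ 2 / 4) ltac:(by rewrite divr_gt0 ?exprn_gt0).
  exists n0 => n m n0n n0m.
  have [Gn dn] := hp n; have [Gm dm] := hp m.
  have {}dn : d (p n).1 (p n).2 < I + e ^+ 2 / 4 by rewrite (lt_trans dn) // ltrD2l hn0.
  have {}dm : d (p m).1 (p m).2 < I + e ^+ 2 / 4 by rewrite (lt_trans dm) // ltrD2l hn0.
  have := mid _ _ _ _ Gn Gm.
  have := sqr_ge0 (nr ((p n).1 - (p m).1)); have := sqr_ge0 (nr ((p n).2 - (p m).2)).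
  move=> h1 h2 h3.
  by split; rewrite -(ltr_pXn2r (n := 2)) ?nnegrE ?nr_ge0 ?(ltW e0) //; lra.
have [x hx] := @complete_nr (fun n => (p n).1) ltac:(move=> e /cau[n0 h]; exists n0 => n m ? ?; by case: (h n m)).
have [y hy] := @complete_nr (fun n => (p n).2) ltac:(move=> e /cau[n0 h]; exists n0 => n m ? ?; by case: (h n m)).
have Gxy : G x y.
  apply: Gc => e e0; have [n1 h1] := hx _ e0; have [n2 h2] := hy _ e0.
  exists (p (maxn n1 n2)).1, (p (maxn n1 n2)).2; split; first by case: (hp (maxn n1 n2)).
    by apply: h1; exact: leq_maxl.
  by apply: h2; exact: leq_maxr.
exists x, y; split=> // x' y' Gxy'.
apply: (@quadratic_ge0_lin0 (nr x' ^+ 2 + nr y' ^+ 2)); first by rewrite addr_ge0 ?sqr_ge0.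
move=> t; set a := _ + nr y' ^+ 2; set b := ip _ _ + _.
rewrite leNgt; apply/negP => neg.
pose K := nr x' + nr y'.
have K0 : 0 <= K by rewrite addr_ge0 ?nr_ge0.
have tK : 0 <= 2 * `|t| * K by rewrite !mulr_ge0.
(* Minimality is tested at [p n + t (x', y')], near the limit [(x, y)]. The error is [e] for near
   minimality of [p n] plus [2 |t| K e] in the inner products; [e] is chosen so small that a
   negative value of the quadratic survives it. *)
pose e := - (a * t ^+ 2 - 2 * b * t) / (2 * (1 + 2 * `|t| * K)).
have e0 : 0 < e by rewrite divr_gt0 //; lra.
have eE : e + 2 * `|t| * K * e < - (a * t ^+ 2 - 2 * b * t).
  have -> : e + 2 * `|t| * K * e = - (a * t ^+ 2 - 2 * b * t) / 2.
    by rewrite /e; field; rewrite gt_eqF //; lra.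
  by lra.
have [n1 h1] := hx _ e0; have [n2 h2] := hy _ e0; have [n3 h3] := inv_small _ e0.
pose n := (n1 + n2 + n3)%N.
have {}h1 := h1 n ltac:(by rewrite /n -addnA leq_addr).
have {}h2 := h2 n ltac:(by rewrite /n addnAC leq_addl).
have {}h3 := h3 n ltac:(by rewrite /n leq_addl).
have [Gn dn] := hp n; have {h3}dn := lt_trans dn (etrans (ltrD2l I _ _) h3); move: (p n).1 (p n).2 h1 h2 Gn dn => p1 p2 h1 h2 Gn dn {hx hy hp cau}.
have := I_le _ _ (GL t%:C _ _ _ _ Gxy' Gn); rewrite /d.
have E1 (w z z' : H) : nr (w - (t%:C *: z + z')) ^+ 2 =
    nr (w - z') ^+ 2 + t ^+ 2 * nr z ^+ 2 - 2 * t * ip (w - z') z.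
  rewrite opprD addrA addrAC nrB2.
  by rewrite nrZ nr_real exprMn real_normK ?num_real // ipZZ; lra.
rewrite !E1 => hI.
have c1 := ip_norm (x - p1) x'; have c2 := ip_norm (y - p2) y'.
rewrite nrBC in c1; rewrite nrBC in c2.
have b1 : ip (u - p1) x' = ip (u - x) x' + ip (x - p1) x' by rewrite -ipDl subrKA.
have b2 : ip (v - p2) y' = ip (v - y) y' + ip (y - p2) y' by rewrite -ipDl subrKA.
have c3 : `|t * (ip (x - p1) x' + ip (y - p2) y')| <= `|t| * (K * e).
  rewrite normrM ler_wpM2l // (le_trans (ler_normD _ _)) // /K mulrDl lerD //.
    by rewrite (le_trans c1) // mulrC ler_wpM2l ?nr_ge0 // ltW.
  by rewrite (le_trans c2) // mulrC ler_wpM2l ?nr_ge0 // ltW.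
move: c3; rewrite ler_norml => /andP[c3 _].
move: hI eE; rewrite b1 b2 /a /b; move: dn; rewrite /d; lra.
Qed.

Definition closed_subspace (N : H -> Prop) := [/\ N 0,
  forall a x y, N x -> N y -> N (a *: x + y) &
  forall x, (forall e : R, 0 < e -> exists2 y, N y & nr (y - x) < e) -> N x].

Lemma projection_ex (N : H -> Prop) : closed_subspace N ->
  forall u, exists p, N p /\ forall y, N y -> ip (u - p) y = 0.
Proof.
move=> [N0 NL Nc] u.
have [|a x y x' y' [Nx ->] [Nx' ->]|x y xy|p [q [[Np _] pq]]] :=
    @projection_graph (fun x y => N x /\ y = 0) u 0.
- by [].
- by rewrite scaler0 addr0; split=> //; exact: NL.
- split; first by apply: Nc => e /xy[x' [y' [[Nx' _] ? _]]]; exists x'.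
  apply/eqP; rewrite -nr_eq0 eq_le nr_ge0 andbT; apply/ler_addgt0Pl => e /xy[x' [y' [[_ ->] _]]].
  by rewrite sub0r nrN addr0 => /ltW.
exists p; split=> // y Ny; have := pq y 0; rewrite ip0r addr0; exact.
Qed.

(** Serves as an induction principle: a property that cuts out a closed subspace holds everywhere
    once no nonzero vector is orthogonal to that subspace. *)
Lemma closed_subspace_full (N : H -> Prop) : closed_subspace N ->
  (forall x, (forall y, N y -> ip x y = 0) -> x = 0) -> forall x, N x.
Proof.
move=> Nc h x; have [p [Np xp]] := projection_ex Nc x.
by move/eqP: (h _ xp); rewrite subr_eq0 => /eqP ->.
Qed.

Lemma ip_ext x y : (forall z, ip x z = ip y z) -> x = y.
Proof.
by move=> h; apply/eqP; rewrite -subr_eq0; apply/eqP/ip_all0 => z; rewrite ipDl ipNl h subrr.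
Qed.

Lemma ip_dense_eq0 (S : set H) x : dense S -> (forall y, S y -> ip x y = 0) -> x = 0.
Proof.
move=> /dense_nr dS h; apply: ip_all0 => y; apply/eqP; rewrite -normr_le0.
apply/ler_addgt0Pl => e e0.
have [z Sz zy] := dS y (e / (nr x + 1)) ltac:(by rewrite divr_gt0 // ltr_wpDl ?nr_ge0).
have -> : ip x y = - ip x (z - y) by rewrite ipDr ipNr (h z Sz) sub0r opprK.
rewrite normrN addr0 (le_trans (ip_norm _ _)) //.
rewrite (le_trans (ler_wpM2l (nr_ge0 _) (ltW zy))) // mulrA ler_pdivrMr ?ltr_wpDl ?nr_ge0 //.
by rewrite mulrC ler_wpM2l ?(ltW e0) // lerDl.
Qed.

Lemma linear_opP (A : partial_op H) : linear_op A ->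
  [/\ forall a x, op_dom A x -> op_dom A (a *: x) /\ A (a *: x) = a *: A x,
      forall x y, op_dom A x -> op_dom A y -> op_dom A (x + y) /\ A (x + y) = A x + A y,
      forall x y, op_dom A x -> op_dom A y -> op_dom A (x - y) /\ A (x - y) = A x - A y &
      A 0 = 0].
Proof.
move=> [A0 AL].
have A00 : A 0 = 0.
  by have [_] := AL (-1) 0 0 A0 A0; rewrite !scaleN1r oppr0 addr0 addNr.
split=> // [a x Ax|x y Ax Ay|x y Ax Ay].
- by have := AL a x 0 Ax A0; rewrite A00 !addr0.
- by have := AL 1 x y Ax Ay; rewrite !scale1r.
- by have := AL (-1) y x Ay Ax; rewrite !scaleN1r ![- _ + _]addrC.
Qed.

(** Real parts suffice: the domain is stable under multiplication by ['i], which recovers the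
    imaginary parts. Density of the domain makes the value chosen by [xget] unique. *)
Lemma adjointP (A : partial_op H) : linear_op A -> dense (op_dom A) -> forall y z,
  (op_dom (adjoint_op dot A) y /\ adjoint_op dot A y = z) <->
  (forall x, op_dom A x -> ip (A x) y = ip x z).
Proof.
move=> lA dA y z; pose adj := [set z | forall x, op_dom A x -> dot (A x) y = dot x z].
have [AZ _ _ _] := linear_opP lA.
have adjE w : adj w <-> forall x, op_dom A x -> ip (A x) y = ip x w.
  split=> [h x /h|h x Ax]; first by rewrite /ip => ->.
  apply/eqP; rewrite -subr_eq0; apply/eqP.
  have e1 := h _ Ax; have [AiX AiE] := AZ 'i%C x Ax.
  have := h _ AiX; rewrite AiE; move: e1; rewrite /ip !linearZl_LR /=.
  case: (dot _ y) (dot x w) => [a b] [c d] /= -> /eqP.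
  rewrite !mul0r !mul1r !sub0r eqr_opp => /eqP ->.
  by rewrite subrr.
have adj_uniq w w' : adj w -> adj w' -> w = w'.
  move=> /adjE aw /adjE aw'; apply/eqP; rewrite -subr_eq0; apply/eqP.
  apply: (ip_dense_eq0 dA) => x Ax; rewrite ipC ipDr ipNr -aw // -aw' //.
  by rewrite subrr.
have -> : op_dom (adjoint_op dot A) y = (adj !=set0) by [].
have -> : adjoint_op dot A y = xget 0 adj by [].
rewrite -adjE; split=> [[[w aw] <-]|az]; first exact: (xgetPex 0 (ex_intro _ w aw)).
by split; [exists z | apply: xget_unique => // w /adj_uniq; exact].
Qed.

Lemma invS_small (e : R) : 0 < e -> exists n0, forall n, (n0 <= n)%N -> n.+1%:R^-1 < e.
Proof.
move=> e0; exists (Num.truncn e^-1) => n n0n.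
rewrite -[e]invrK ltf_pV2 ?posrE ?invr_gt0 ?ltr0n //.
by rewrite (lt_le_trans (truncnS_gt _)) // ler_nat ltnS.
Qed.

Lemma eq0_small (a K : R) : (forall e, 0 < e -> `|a| <= e * K) -> a = 0.
Proof.
move=> h; apply/eqP; rewrite -normr_eq0 eq_le normr_ge0 andbT leNgt; apply/negP => a0.
have K1 : 0 < `|K| + 1 by rewrite ltr_wpDl.
have := h (`|a| / (2 * (`|K| + 1))) ltac:(by rewrite divr_gt0 // mulr_gt0).
have : `|a| / (2 * (`|K| + 1)) * K <= `|a| / 2.
  rewrite invfM mulrA -mulrA ler_piMr ?divr_ge0 // mulrC ler_pdivrMr // mul1r.
  by rewrite (le_trans (ler_norm _)) // lerDl.
by move=> h1 h2; have := le_trans h2 h1; rewrite leNgt ltr_pdivrMr // ltr_pMr // ltr1n.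
Qed.

(** * Closures of graphs, and cores *)

Definition graph_core (D : H -> Prop) (B : H -> H) (x y : H) := forall e : R, 0 < e ->
  exists x', [/\ D x', nr (x' - x) < e & nr (B x' - y) < e].

(** Where [B] and [B'] have equal norms, also on differences, [B'] converges along every sequence
    along which [B] does. This is how domains pass between [A] and its adjoint. *)
Lemma graph_core_limit (D : H -> Prop) (B B' : H -> H) x y :
  (forall z w, D z -> D w -> nr (B' z - B' w) = nr (B z - B w)) ->
  (forall z, D z -> nr (B' z) = nr (B z)) ->
  graph_core D B x y -> exists2 w, nr w = nr y & graph_core D B' x w.
Proof.
move=> BB nB xy.
have ex n : exists x', [/\ D x', nr (x' - x) < n.+1%:R^-1 & nr (B x' - y) < n.+1%:R^-1].
  by apply: xy; rewrite invr_gt0 ltr0n.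
have [u hu] := choice ex.
have [e e0|w hw] := @complete_nr (fun n => B' (u n)).
  have [n0 hn0] := invS_small (divr_gt0 e0 (ltr0n R 2)).
  exists n0 => n m /hn0 n0n /hn0 n0m.
  have [Dn _ un] := hu n; have [Dm _ um] := hu m.
  rewrite BB // (le_lt_trans (nr_dist y _ _)) // (nrBC y) [e]splitr.
  by rewrite ltrD ?(lt_trans un) ?(lt_trans um).
have wP (e : R) : 0 < e -> exists x', [/\ D x', nr (x' - x) < e, nr (B x' - y) < e &
    nr (B' x' - w) < e].
  move=> e0; have [n0 hn0] := invS_small e0; have [n1 hn1] := hw _ e0.
  have [Dn xn yn] := hu (maxn n0 n1).
  have lt := hn0 _ (leq_maxl n0 n1).
  exists (u (maxn n0 n1)); split=> //; rewrite ?(lt_trans xn) ?(lt_trans yn) //.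
  by apply: hn1; exact: leq_maxr.
exists w; last by move=> e /wP[x' [? ? _ ?]]; exists x'.
apply/eqP; rewrite -subr_eq0; apply/eqP/(@eq0_small _ 2) => e /wP[x' [Dx' _ ye we]].
have := nr_subr w (B' x'); have := nr_subr (B' x') w.
have := nr_subr y (B x'); have := nr_subr (B x') y.
move: ye we; rewrite (nrBC w) (nrBC y) nB // => ? ? ? ? ? ?.
by rewrite ler_norml; apply/andP; split; lra.
Qed.

(** Projecting [(u, v)] onto the closure of the graph over [D] leaves a remainder that lies in [G]
    and is orthogonal to that graph, hence is 0. *)
Lemma graph_core_full (D : H -> Prop) (B : H -> H) (G : H -> H -> Prop) :
  D 0 -> B 0 = 0 ->
  (forall a x y, D x -> D y -> D (a *: x + y) /\ B (a *: x + y) = a *: B x + B y) ->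
  (forall x y, graph_core D B x y -> G x y) ->
  (forall x y x' y', G x y -> G x' y' -> G (x - x') (y - y')) ->
  (forall x y, G x y -> (forall x', D x' -> ip x x' + ip y (B x') = 0) -> x = 0 /\ y = 0) ->
  forall x y, G x y -> graph_core D B x y.
Proof.
move=> D0 B0 DL DG GB orth u v Guv.
have gL a x y x' y' : graph_core D B x y -> graph_core D B x' y' ->
    graph_core D B (a *: x + x') (a *: y + y').
  move=> xy xy' e e0; have K1 : 0 < nr a + 1 by rewrite ltr_wpDl ?nr_ge0.
  have d0 : 0 < e / (nr a + 1) by rewrite divr_gt0.
  have [z [Dz zx zy]] := xy _ d0; have [z' [Dz' zx' zy']] := xy' _ d0.
  have [Dzz Bzz] := DL a _ _ Dz Dz'.
  have tri (p q p' q' : H) : nr (p - q) < e / (nr a + 1) -> nr (p' - q') < e / (nr a + 1) ->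
      nr (a *: p + p' - (a *: q + q')) < e.
    move=> pq pq'; rewrite opprD addrACA -scalerBr (le_lt_trans (nrD _ _)) // nrZ.
    have -> : e = nr a * (e / (nr a + 1)) + e / (nr a + 1) by field; rewrite gt_eqF.
    by rewrite ler_ltD // ler_wpM2l ?nr_ge0 // ltW.
  by exists (a *: z + z'); split=> //; rewrite ?Bzz; exact: tri.
have gc : nr_closed2 (graph_core D B).
  move=> x y xy e e0; have e2 : 0 < e / 2 by rewrite divr_gt0.
  have [x' [y' [xy' xx yy]]] := xy _ e2; have [z [Dz zx zy]] := xy' _ e2.
  exists z; rewrite [e]splitr; split=> //.
    by rewrite (le_lt_trans (nr_dist x' _ _)) // ltrD.
  by rewrite (le_lt_trans (nr_dist y' _ _)) // ltrD.
have DgB z : D z -> graph_core D B z (B z) by move=> Dz e e0; exists z; rewrite !subrr !nr0.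
have g0 : graph_core D B 0 0 by rewrite -{2}B0; exact: DgB.
have [x [y [gxy xy]]] := projection_graph u v g0 gL gc.
have [|/eqP + /eqP] := orth _ _ (GB _ _ _ _ Guv (DG _ _ gxy)).
  by move=> x' Dx'; exact/xy/DgB.
by rewrite !subr_eq0 => /eqP -> /eqP ->.
Qed.

Lemma subrACA (V : zmodType) (x y z t : V) : x - y - (z - t) = x - z - (y - t).
Proof. by rewrite !opprD !opprK addrACA. Qed.

Lemma ipZC (a : R[i]) x y : ip x (a *: y) = ip (a^* *: x) y.
Proof. by rewrite ipZ conjCK. Qed.

(** * Adjoints of bounded operators *)

Definition adjoint_pair (f g : H -> H) := forall x y, ip (f x) y = ip x (g y).

Lemma adjoint_pair_sym f g : adjoint_pair f g -> adjoint_pair g f.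
Proof. by move=> fg x y; rewrite ipC -fg ipC. Qed.

Lemma adjoint_pair_linear f g : adjoint_pair f g -> linear f -> linear g.
Proof.
move=> fg lf a x y; apply: ip_ext => z; rewrite ![ip _ z]ipC -fg.
have [_ fZ _ _] := lin_facts lf.
by rewrite !ipDr !ipZC -fZ !fg.
Qed.

Lemma adjoint_pair_bound f g M : adjoint_pair f g ->
  (forall x, nr (f x) <= M * nr x) -> forall x, nr (g x) <= M * nr x.
Proof.
move=> fg fM x; have [->|gx] := eqVneq (g x) 0.
  by rewrite nr0 (le_trans (nr_ge0 _) (fM x)).
have n0 : 0 < nr (g x) by rewrite nr_gt0.
rewrite -(ler_pM2r n0) -expr2 -ipxx -fg (le_trans (ip_le _ _)) //.
by rewrite mulrAC ler_wpM2r ?nr_ge0.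
Qed.

(* Projecting [(0, y)] onto the graph of [f] gives [x] with [f^* (y - f x) = x];
   hence the set where the adjoint exists is the whole space. *)
Lemma adjoint_pair_ex (f : H -> H) (M : R) : linear f -> 0 < M ->
  (forall x, nr (f x) <= M * nr x) -> exists g, adjoint_pair f g.
Proof.
move=> lf M0 fM; have [f0 fZ fD fB] := lin_facts lf.
pose Y y := exists z, forall x, ip (f x) y = ip x z.
suff Yfull : forall y, Y y by have [g hg] := choice Yfull; exists g => x y; exact: hg.
have Yproj u : exists x, forall x', ip (f x') (u - f x) = ip x' x.
  have [|a x y x' y' -> ->|x y xy|x [_ [-> xy]]] := @projection_graph (fun x y => y = f x) 0 u.
  - by rewrite f0.
  - by rewrite fD fZ.
  - apply/eqP; rewrite -subr_eq0 -nr_eq0; apply/eqP/(@eq0_small _ (1 + M)) => e /xy[x' [_ [-> xe ye]]].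
    rewrite ger0_norm ?nr_ge0 // (le_trans (nr_dist (f x') _ _)) // mulrDr mulr1.
    rewrite (nrBC y) lerD // ?(ltW ye) // -fB (le_trans (fM _)) // mulrC ler_wpM2r // ltW //.
  exists x => x'; have := xy x' _ erefl.
  by rewrite sub0r ipNl [ip _ (f x')]ipC [ip x x']ipC addrC => /eqP; rewrite subr_eq0 => /eqP.
apply: closed_subspace_full.
  split.
  - by exists 0 => x; rewrite !ip0r.
  - move=> a z w [z' hz] [w' hw]; exists (a *: z' + w') => x.
    by rewrite !ipDr !ipZC -fZ hz hw.
  move=> y hy.
  have ex n : exists p : H * H, (forall x, ip (f x) p.1 = ip x p.2) /\ nr (p.1 - y) < n.+1%:R^-1.
    have [|w [z hz] wy] := hy n.+1%:R^-1; first by rewrite invr_gt0 ltr0n.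
    by exists (w, z).
  have [p hp] := choice ex.
  have pM n m : nr ((p n).2 - (p m).2) <= M * nr ((p n).1 - (p m).1).
    have [hn _] := hp n; have [hm _] := hp m; set z := _ - (p m).2.
    have [->|z0] := eqVneq z 0; first by rewrite nr0 mulr_ge0 ?nr_ge0 // ltW.
    have nz : 0 < nr z by rewrite nr_gt0.
    rewrite -(ler_pM2l nz) -expr2 -ipxx {2}/z ipDr ipNr -hn -hm -ipNr -ipDr.
    by rewrite (le_trans (ip_le _ _)) // mulrCA mulrA ler_wpM2r ?nr_ge0.
  have [e e0|z hz] := @complete_nr (fun n => (p n).2).
    have [n0 hn0] := invS_small (divr_gt0 e0 (mulr_gt0 M0 (ltr0n R 2))).
    exists n0 => n m /hn0 n0n /hn0 n0m; have [_ yn] := hp n; have [_ ym] := hp m.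
    rewrite (le_lt_trans (pM _ _)) // mulrC -ltr_pdivlMr //.
    rewrite (le_lt_trans (nr_dist y _ _)) // (nrBC y).
    have -> : e / M = e / (M * 2) + e / (M * 2) by field; rewrite gt_eqF.
    by rewrite ltrD ?(lt_trans yn) ?(lt_trans ym).
  exists z => x; apply/eqP; rewrite -subr_eq0; apply/eqP/(@eq0_small _ (nr (f x) + nr x)) => e e0.
  have [n0 hn0] := invS_small e0; have [n1 hn1] := hz _ e0.
  have [hn yn] := hp (maxn n0 n1).
  have := hn0 _ (leq_maxl n0 n1); have := hn1 _ (leq_maxr n0 n1) => h1 h2.
  have -> : ip (f x) y - ip x z = ip x ((p (maxn n0 n1)).2 - z) - ip (f x) ((p (maxn n0 n1)).1 - y).
    by rewrite !ipDr !ipNr hn; lra.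
  rewrite (le_trans (ler_normB _ _)) // addrC mulrDr lerD //.
    by rewrite (le_trans (ip_norm _ _)) // mulrC ler_wpM2r ?nr_ge0 // ltW // (lt_trans yn).
  by rewrite (le_trans (ip_norm _ _)) // mulrC ler_wpM2r ?nr_ge0 // ltW.
move=> y hy; have [x hx] := Yproj y.
(* Here [y] is orthogonal to [Y], and [y - f x] belongs to [Y]. Together the two facts say
   [|y - f x|^2 = - |x|^2], so [x = 0], and then [|y|^2 = 0]. *)
have h1 := hy _ (ex_intro _ x hx); have h2 := hx x.
have := nrB2 y (f x); move: h1 h2; rewrite !ipDr !ipNr !ipxx (ipC (f x) y) => h1 h2 h3.
have x0 : x = 0.
  apply/eqP; rewrite -nr_eq0 -sqrf_eq0 eq_le sqr_ge0 andbT.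
  by have := sqr_ge0 (nr (y - f x)); lra.
apply/eqP; rewrite -nr_eq0 -sqrf_eq0; apply/eqP.
by move: h1; rewrite x0 f0 ip0r subr0.
Qed.

(** * Approximate eigenvalues of bounded normal operators *)

Definition approx_eigenvalue (N : H -> Prop) (C : H -> H) (l : R[i]) :=
  forall e : R, 0 < e -> exists y, [/\ N y, y != 0 & nr (C y - l *: y) <= e * nr y].

(** [N] is a reducing subspace of an operator that stays defined on all of [H]; only
    [approx_eigenvalue] looks at [N] alone. *)
Definition normal_on (N : H -> Prop) (C Cs : H -> H) (M : R) := [/\
  linear C, adjoint_pair C Cs, 0 < M /\ (forall x, nr (C x) <= M * nr x),
  (forall x, C (Cs x) = Cs (C x)) & forall x, N x -> N (C x) /\ N (Cs x)].

Lemma normal_on_sqr N C Cs M : normal_on N C Cs M ->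
  normal_on N (C \o C) (Cs \o Cs) (M ^+ 2).
Proof.
move=> [lC adj [M0 CM] CC NC]; split=> [a x y|x y||x|x Nx] /=; rewrite ?lC ?adj //.
- split=> [|x]; first by rewrite exprn_gt0.
  by rewrite (le_trans (CM _)) // expr2 -mulrA ler_wpM2l // ltW.
- by rewrite !CC.
- have [N1 N2] := NC _ Nx; have [? _] := NC _ N1; have [_ ?] := NC _ N2; by [].
Qed.

Lemma adjoint_pair_gram C Cs x : adjoint_pair C Cs -> ip (Cs (C x)) x = nr (C x) ^+ 2.
Proof. by move=> adj; rewrite ipC -adj ipxx. Qed.

Lemma scaleC_nr1 (u : R[i]) (x : H) : nr u = 1 -> nr (u *: x) = nr x.
Proof. by rewrite nrZ => ->; rewrite mul1r. Qed.

(** The bound is asked only of vectors nearly fixed by [Cs C]: on these [C] is nearly isometric, and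
    the unit circle is where its spectrum is to be found. *)
Definition circle_bounded_below N (C Cs : H -> H) (eta e : R) :=
  forall y, N y -> nr (Cs (C y) - y) <= e * nr y ->
  forall u : R[i], nr u = 1 -> eta * nr y <= nr (C y - u *: y).

(* [C^2 - u^2 = (C - u) (C + u)], and by the parallelogram law the sign of [u] can
   be chosen so that [C + u] expands approximate fixed points of [C^* C]. *)
Lemma circle_bounded_below_sqr N C Cs M (eta e : R) :
  (forall a x y, N x -> N y -> N (a *: x + y)) ->
  normal_on N C Cs M -> 0 <= eta -> 0 < e -> e <= 1 / 2 ->
  circle_bounded_below N C Cs eta ((M + 1) * e) ->
  circle_bounded_below N (C \o C) (Cs \o Cs) (eta * (6 / 5)) e.
Proof.
move=> NL nC eta0 e0 e1 hC y Ny /= Ky u u1.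
have [lC adj [M0 CM] CC NC] := nC.
have lCs := adjoint_pair_linear adj lC.
have [C0 CZ CD CB] := lin_facts lC; have [_ CsZ CsD CsB] := lin_facts lCs.
(* With [K = Cs C], normality turns the hypothesis into a bound on [(K + 1) (K - 1) y], and [K + 1]
   does not shrink norms because [K >= 0]. *)
have nK : nr (Cs (C y) - y) <= e * nr y.
  apply: le_trans Ky; rewrite -(ler_pXn2r (n := 2)) ?nnegrE ?nr_ge0 //.
  set z := Cs (C y) - y.
  have -> : Cs (Cs (C (C y))) - y = Cs (C z) + z.
    by rewrite /z CB CsB CC -CC addrA subrK.
  rewrite [leRHS]nrD2 (adjoint_pair_gram z adj).
  by have := sqr_ge0 (nr (C z)); have := sqr_ge0 (nr (Cs (C z))); lra.
have nCy : (1 - e) * nr y ^+ 2 <= nr (C y) ^+ 2.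
  rewrite -(adjoint_pair_gram _ adj).
  have -> : ip (Cs (C y)) y = nr y ^+ 2 + ip (Cs (C y) - y) y by rewrite ipDl ipNl ipxx; lra.
  have := ip_norm (Cs (C y) - y) y; rewrite ler_norml => /andP[h _].
  have := ler_wpM2r (nr_ge0 y) nK; rewrite -mulrA -expr2; lra.
pose v := sqrtc u.
have v2 : v * v = u by rewrite -expr2 sqr_sqrtc.
have v1 : nr v = 1.
  have := nr_ge0 v; move: u1; rewrite -v2 nrM -expr2 => /eqP; rewrite sqrf_eq1.
  by case/orP => /eqP -> //; rewrite oppr_ge0 ler10.
(* [w] is either square root of [u]. As [|C y|^2 >= |y|^2 / 2], the squared norms for the two signs
   add up to at least [3 |y|^2], so one of them reaches [3 / 2 |y|^2]; and [6 / 5] is a rational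
   below the square root of [3 / 2]. *)
have key w : w * w = u -> nr w = 1 -> 3 / 2 * nr y ^+ 2 <= nr (C y + w *: y) ^+ 2 ->
    eta * (6 / 5) * nr y <= nr (C (C y) - u *: y).
  move=> w2 w1 hw; set z := C y + w *: y in hw *.
  have -> : C (C y) - u *: y = C z - w *: z.
    by rewrite /z CD CZ scalerDr scalerA w2 opprD addrA addrK.
  have nyz : 6 / 5 * nr y <= nr z.
    rewrite -(ler_pXn2r (n := 2)) ?nnegrE ?mulr_ge0 ?nr_ge0 ?divr_ge0 //.
    by rewrite exprMn; have := sqr_ge0 (nr y); lra.
  rewrite -mulrA (le_trans (ler_wpM2l eta0 nyz)) // hC //.
    by rewrite /z addrC; apply: NL => //; case: (NC _ Ny).
  (* [Cs C] commutes with [C + w], whose norm is at most [M + 1]: hence the tolerance [(M + 1) * e]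
     in the hypothesis. *)
  have -> : Cs (C z) - z = C (Cs (C y) - y) + w *: (Cs (C y) - y).
    rewrite /z CD CZ CsD CsZ CB CC scalerBr opprD addrACA.
    by rewrite -CC.
  rewrite (le_trans (nrD _ _)) // scaleC_nr1 //.
  have h1 := CM (Cs (C y) - y).
  have h2 : (M + 1) * nr (Cs (C y) - y) <= (M + 1) * (e * nr z).
    rewrite ler_wpM2l ?addr_ge0 ?(ltW M0) // (le_trans nK) // ler_wpM2l ?(ltW e0) //.
    by have := nr_ge0 y; lra.
  by rewrite -mulrA; lra.
have := parallelogram (C y) (v *: y); rewrite (scaleC_nr1 _ v1) => par.
have [hp|hm] := lerP (3 / 2 * nr y ^+ 2) (nr (C y + v *: y) ^+ 2).
  exact: (key v).
apply: (key (- v)); rewrite ?mulrNN ?nrN // scaleNr.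
by have := ler_wpM2r (sqr_ge0 (nr y)) e1; lra.
Qed.

Lemma expr_unbounded (a B : R) : 1 < a -> exists k, B < a ^+ k.
Proof.
move=> a1; have a0 : 0 < a - 1 by rewrite subr_gt0.
have bern k : 1 + k%:R * (a - 1) <= a ^+ k.
  elim: k => [|k IH]; first by rewrite mul0r addr0 expr0.
  rewrite exprS; have k0 : 0 <= k%:R * ((a - 1) * (a - 1)) by rewrite mulr_ge0 ?ler0n // mulr_ge0 ?(ltW a0).
  have := ler_wpM2l (ltW (lt_trans ltr01 a1)) IH; rewrite -natr1; lra.
exists (Num.truncn (B / (a - 1))).+1; apply: lt_le_trans (bern _).
have := truncnS_gt (B / (a - 1)); rewrite ltr_pdivrMr // => h.
by rewrite (lt_trans h) // ltrDr.
Qed.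

Lemma normal_on_iterate N C Cs M (eta e : R) :
  (forall a x y, N x -> N y -> N (a *: x + y)) ->
  normal_on N C Cs M -> 0 <= eta -> 0 < e -> circle_bounded_below N C Cs eta e ->
  approx_eigenvalue N (Cs \o C) 1 ->
  forall k, exists C' Cs' M' e', [/\ normal_on N C' Cs' M', 0 < e',
    circle_bounded_below N C' Cs' (eta * (6 / 5) ^+ k) e' &
    approx_eigenvalue N (Cs' \o C') 1].
Proof.
move=> NL nC eta0 e0 hC aC; elim=> [|k [{hC}C' [Cs' [M' [{}e [nC' {}e0 hC' aC']]]]]].
  by exists C, Cs, M, e; rewrite expr0 mulr1.
have [lC adj [M0 CM] CC NC] := nC'; have lCs := adjoint_pair_linear adj lC.
have M1 : 0 < M' + 1 by rewrite addr_gt0.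
(* Division by [M' + 1] pays for the tolerance lost in squaring, and [1 / 2] is the largest
   tolerance that squaring admits. *)
exists (C' \o C'), (Cs' \o Cs'), (M' ^+ 2), (Num.min (e / (M' + 1)) (1 / 2)).
have d0 : 0 < Num.min (e / (M' + 1)) (1 / 2) by rewrite lt_min !divr_gt0.
split=> //.
- exact: normal_on_sqr.
- have -> : eta * (6 / 5) ^+ k.+1 = eta * (6 / 5) ^+ k * (6 / 5) by rewrite exprSr [LHS]mulrA.
  apply: (circle_bounded_below_sqr NL nC') => //.
  + by rewrite mulr_ge0 // exprn_ge0 // divr_ge0.
  + by rewrite ge_min lexx orbT.
  move=> y Ny hy; apply: hC' => //; rewrite (le_trans hy) // ler_wpM2r ?nr_ge0 //.
  by rewrite mulrC -ler_pdivlMr // ge_min lexx.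
(* For [K = Cs' C'] again [K^2 - 1 = (K + 1) (K - 1)], and [M' ^+ 2 + 1] bounds the norm of
   [K + 1]. *)
move=> d {}d0; have K1 : 0 < M' ^+ 2 + 1 by rewrite addr_gt0 // exprn_gt0.
have [y [Ny y0 hy]] := aC' (d / (M' ^+ 2 + 1)) (divr_gt0 d0 K1); exists y; split=> //=.
move: hy; rewrite scale1r /= => hy.
have [_ _ _ CB] := lin_facts lC; have [_ _ _ CsB] := lin_facts lCs.
set z := Cs' (C' y) - y in hy.
have -> : Cs' (Cs' (C' (C' y))) - y = Cs' (C' z) + z.
  by rewrite /z CB CsB CC -CC addrA subrK.
rewrite (le_trans (nrD _ _)) //.
have h1 : nr (Cs' (C' z)) <= M' ^+ 2 * nr z.
  rewrite (le_trans (adjoint_pair_bound adj CM _)) // expr2 -mulrA ler_wpM2l //.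
  exact: ltW.
have h2 := ler_wpM2l (ltW K1) hy.
have h3 : (M' ^+ 2 + 1) * (d / (M' ^+ 2 + 1) * nr y) = d * nr y by field; rewrite gt_eqF.
by move: h1 h2; rewrite h3; lra.
Qed.

Lemma circle_not_bounded_below N C Cs M (eta : R) :
  (forall a x y, N x -> N y -> N (a *: x + y)) ->
  normal_on N C Cs M -> approx_eigenvalue N (Cs \o C) 1 -> 0 < eta ->
  exists (u : R[i]) y, [/\ nr u = 1, N y, y != 0 & nr (C y - u *: y) <= eta * nr y].
Proof.
move=> NL nC aC eta0; apply: contrapT => nex.
have hC : circle_bounded_below N C Cs eta 1.
  move=> y Ny _ u u1; have [->|y0] := eqVneq y 0; first by rewrite nr0 mulr0 nr_ge0.
  by rewrite leNgt; apply/negP => /ltW h; apply: nex; exists u, y.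
have [k hk] := @expr_unbounded (6 / 5) (3 / eta) ltac:(lra).
have [C' [Cs' [M' [e [nC' e0 hC' aC']]]]] := normal_on_iterate NL nC (ltW eta0) ltr01 hC aC k.
have [lC adj [M0 CM] CC NC] := nC'.
have [|y [Ny y0 hy]] := aC' (Num.min e 1); first by rewrite lt_min e0 ltr01.
have ny : 0 < nr y by rewrite nr_gt0.
rewrite scale1r /= in hy.
have := hC' y Ny _ 1 nr1.
have -> : nr (Cs' (C' y) - y) <= e * nr y = true.
  by rewrite (le_trans hy) // ler_pM2r // ge_min lexx.
move=> /(_ isT); rewrite scale1r leNgt => /negP; apply.
(* [|C' y|^2 = ip (Cs' (C' y)) y <= 2 |y|^2]; the cruder factor 2 already gives
   [|C' y - y| <= 3 |y|], which is less than [eta (6 / 5)^k |y|]. *)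
have h1 : nr (C' y) <= 2 * nr y.
  rewrite -(ler_pXn2r (n := 2)) ?nnegrE ?mulr_ge0 ?nr_ge0 // -(adjoint_pair_gram _ adj).
  have -> : ip (Cs' (C' y)) y = nr y ^+ 2 + ip (Cs' (C' y) - y) y by rewrite ipDl ipNl ipxx; lra.
  have h2 : nr (Cs' (C' y) - y) <= nr y.
    by rewrite (le_trans hy) // -[leRHS]mul1r ler_pM2r // ge_min lexx orbT.
  have := ip_le (Cs' (C' y) - y) y; have := ler_wpM2r (nr_ge0 y) h2.
  by rewrite exprMn -expr2; have := sqr_ge0 (nr y); lra.
rewrite (le_lt_trans (nrB _ _)) // (@le_lt_trans _ _ (3 * nr y)) //; first by lra.
by rewrite ltr_pM2r // mulrC -ltr_pdivrMr.
Qed.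

Lemma nr_complex_le (a b : R) : nr (a +i* b) <= `|a| + `|b|.
Proof.
rewrite /nr normc_def /= -(ler_pXn2r (n := 2)) ?nnegrE ?sqrtr_ge0 ?addr_ge0 //.
rewrite sqr_sqrtr ?addr_ge0 ?sqr_ge0 // sqrrD !real_normK ?num_real //.
by rewrite addrAC lerDl mulrn_wge0 ?mulr_ge0.
Qed.

Lemma Re_le_nr (a : R[i]) : `|complex.Re a| <= nr a.
Proof. by rewrite -lecR -nrE normc_ge_Re. Qed.

Lemma Im_le_nr (a : R[i]) : `|complex.Im a| <= nr a.
Proof.
case: a => a b /=; rewrite /nr normc_def /= -(ler_pXn2r (n := 2)) ?nnegrE ?sqrtr_ge0 //.
by rewrite sqr_sqrtr ?addr_ge0 ?sqr_ge0 // real_normK ?num_real // lerDr sqr_ge0.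
Qed.

(** Boxes of coordinates are compact as images of products of segments. For [e = 1] this yields
    cluster points in [R[i]], for a vector [e] the compactness of rank one maps. *)
Lemma compact_disc (V : normedModType R[i]) (e : V) (B : R) :
  compact ((fun p : R * R => (p.1 +i* p.2) *: e) @` (`[- B, B] `*` `[- B, B])).
Proof.
apply: continuous_compact; last by apply: compact_setX; exact: segment_compact.
apply: continuous_subspaceT => -[a b]; apply/cvg_nrP => d d0.
have e0 : 0 < d / (2 * (nr e + 1)) by rewrite divr_gt0 // mulr_gt0 // ltr_wpDl ?nr_ge0.
exists ([set x | `|a - x| < d / (2 * (nr e + 1))], [set x | `|b - x| < d / (2 * (nr e + 1))]).
  by split=> /=; [exact: (nbhsx_ballx a _ e0) | exact: (nbhsx_ballx b _ e0)].
move=> [x y] /= [ax yb]; rewrite -scalerBl nrZ.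
have -> : (x +i* y)%C - (a +i* b)%C = ((x - a) +i* (y - b))%C by [].
have h := nr_complex_le (x - a) (y - b).
rewrite (le_lt_trans (ler_wpM2r (nr_ge0 e) h)) //.
rewrite (distrC x) (distrC y).
have K0 : 0 < nr e + 1 by rewrite ltr_wpDl ?nr_ge0.
have h2 : (`|a - x| + `|b - y|) * (nr e + 1) < d.
  rewrite -ltr_pdivlMr //.
  have -> : d / (nr e + 1) = d / (2 * (nr e + 1)) + d / (2 * (nr e + 1)).
    by field; rewrite gt_eqF.
  by rewrite ltrD.
by rewrite (le_lt_trans _ h2) // ler_wpM2l ?addr_ge0 // lerDl.
Qed.

Lemma compact_cluster_seq (V : normedModType R[i]) (K : set V) (u : nat -> V) :
  compact K -> (forall n, K (u n)) ->
  exists2 l, K l & forall e : R, 0 < e -> forall n0, exists2 n, (n0 <= n)%N & nr (u n - l) < e.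
Proof.
move=> cK uK; have [l [Kl cl]] := cK (u @ \oo) _ (filterE _ uK).
exists l => // e e0 n0.
have h1 : (u @ \oo) (u @` [set n | (n0 <= n)%N]) by exists n0 => // n n0n; exists n.
have h2 : nbhs l [set y | nr (y - l) < e] by apply/nbhs_nrP; exists e.
by have [_ [[n n0n <-] h]] := cl _ _ h1 h2; exists n.
Qed.

Lemma complex_cluster (u : nat -> R[i]) (B : R) : (forall n, nr (u n) <= B) ->
  exists l, forall e : R, 0 < e -> forall n0, exists2 n, (n0 <= n)%N & nr (u n - l) < e.
Proof.
move=> uB; have [n|l _ hl] := @compact_cluster_seq R[i]^o _ u (@compact_disc R[i]^o 1 B).
  exists (complex.Re (u n), complex.Im (u n)); last first.
    by rewrite /= [LHS]mulr1; case: (u n).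
  by split=> /=; rewrite in_itv /= -ler_norml (le_trans _ (uB n)) ?Re_le_nr ?Im_le_nr.
by exists l.
Qed.

Lemma approx_eigenvalueN N C l : ~ approx_eigenvalue N C l ->
  exists2 e : R, 0 < e & forall y, N y -> e * nr y <= nr (C y - l *: y).
Proof.
move=> /existsNP[e /not_implyP[e0 h]]; exists e => // y Ny.
have [->|y0] := eqVneq y 0; first by rewrite nr0 mulr0 nr_ge0.
by rewrite leNgt; apply/negP => /ltW hy; apply: h; exists y.
Qed.

Lemma closed_subspaceZ N (a : R[i]) x : closed_subspace N -> N x -> N (a *: x).
Proof. by move=> [N0 NL _] Nx; rewrite -[_ *: _]addr0; exact: NL. Qed.

Lemma closed_subspaceB N x y : closed_subspace N -> N x -> N y -> N (x - y).
Proof. by move=> [N0 NL _] Nx Ny; rewrite addrC -scaleN1r; exact: NL. Qed.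

Lemma normal_on_scale N C Cs M (r : R) : closed_subspace N -> 0 < r ->
  normal_on N C Cs M ->
  normal_on N (fun x => r%:C *: C x) (fun x => r%:C *: Cs x) (r * M).
Proof.
move=> Nc r0 [lC adj [M0 CM] CC NC].
have [_ CsZ _ _] := lin_facts (adjoint_pair_linear adj lC); have [_ CZ _ _] := lin_facts lC.
split.
- by move=> a x y; rewrite lC scalerDr !scalerA mulrC.
- by move=> x y; rewrite ipZr adj ipZZ.
- by split=> [|x]; rewrite ?mulr_gt0 // nrZ nr_real gtr0_norm // -mulrA ler_pM2l.
- by move=> x; rewrite CZ CC CsZ.
- by move=> x /NC[? ?]; split; apply: closed_subspaceZ.
Qed.

(** Dividing [C] by [sqrt s] turns [s] into 1. The unit numbers found for [eta = 1 / (n + 1)]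
    accumulate at a unit number [l], and [sqrt s * l] is the approximate eigenvalue. *)
Lemma approx_eigenvalue_gram N C Cs M (s : R) : closed_subspace N ->
  normal_on N C Cs M -> 0 < s -> approx_eigenvalue N (Cs \o C) s%:C ->
  exists2 l : R[i], nr l ^+ 2 = s & approx_eigenvalue N C l.
Proof.
move=> Nc nC s0 aK; have [_ NL _] := Nc.
pose q := Num.sqrt s; have q0 : 0 < q by rewrite sqrtr_gt0.
have q2 : q ^+ 2 = s by rewrite sqr_sqrtr // ltW.
have r0 : 0 < q^-1 by rewrite invr_gt0.
have nC1 := normal_on_scale Nc r0 nC.
have [lC adj [M0 CM] CC NC] := nC.
have [_ CsZ _ _] := lin_facts (adjoint_pair_linear adj lC); have [_ CZ _ _] := lin_facts lC.
have qqC : q%:C * q^-1%:C = 1 by rewrite -rmorphM /= divff ?gt_eqF.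
have a1 : approx_eigenvalue N ((fun x => q^-1%:C *: Cs x) \o (fun x => q^-1%:C *: C x)) 1.
  move=> e e0; have [y [Ny y0 hy]] := aK (e * s) (mulr_gt0 e0 s0).
  exists y; split=> //=; rewrite CsZ scalerA.
  have -> : (q^-1%:C * q^-1%:C) *: Cs (C y) - 1 *: y = s^-1%:C *: (Cs (C y) - s%:C *: y).
    rewrite scalerBr scalerA -!rmorphM /= mulVf ?gt_eqF // rmorph1.
    by rewrite -invfM -expr2 q2.
  rewrite nrZ nr_real gtr0_norm ?invr_gt0 // mulrC ler_pdivrMr //.
  by rewrite mulrAC.
have ex n : exists u : R[i], nr u = 1 /\
    exists y, [/\ N y, y != 0 & nr (q^-1%:C *: C y - u *: y) <= n.+1%:R^-1 * nr y].
  have [|u [y [u1 Ny y0 hy]]] := circle_not_bounded_below NL nC1 a1 (eta := n.+1%:R^-1).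
    by rewrite invr_gt0 ltr0n.
  by exists u; split=> //; exists y.
have [u hu] := choice ex.
have [n|l hl] := @complex_cluster u 1; first by case: (hu n) => ->.
have l1 : nr l = 1.
  apply/eqP; rewrite -subr_eq0; apply/eqP/(@eq0_small _ 1) => e e0; rewrite mulr1.
  have [n _ hn] := hl _ e0 0%N; have [un _] := hu n; rewrite -un.
  have := nr_subr l (u n); have := nr_subr (u n) l; rewrite (nrBC l) => h1 h2.
  by rewrite ler_norml; apply/andP; split; lra.
exists (q%:C * l); first by rewrite nrM l1 mulr1 nr_real gtr0_norm.
move=> e e0; have e1 : 0 < e / (2 * q) by rewrite divr_gt0 ?mulr_gt0.
have [n0 hn0] := invS_small e1; have [n n0n hn] := hl _ e1 n0.
have [_ [y [Ny y0 hy]]] := hu n; exists y; split=> //.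
have -> : C y - (q%:C * l) *: y = q%:C *: ((q^-1%:C *: C y - u n *: y) + (u n - l) *: y).
  by rewrite scalerBl addrA subrK scalerBr !scalerA qqC scale1r.
rewrite nrZ nr_real gtr0_norm // (le_trans (ler_wpM2l (ltW q0) (nrD _ _))) // nrZ.
have h1 := hn0 _ n0n.
have h2 : nr (q^-1%:C *: C y - u n *: y) + nr (u n - l) * nr y <= e / q * nr y.
  have -> : e / q * nr y = e / (2 * q) * nr y + e / (2 * q) * nr y by field; rewrite gt_eqF.
  rewrite lerD // ?(le_trans hy) // ler_wpM2r ?nr_ge0 // ltW //.
rewrite (le_trans (ler_wpM2l (ltW q0) h2)) //.
by rewrite mulrA mulrCA divff ?gt_eqF // mulr1.
Qed.

(** * Nonnegative forms and spectral gaps *)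

Lemma positive_form_norm N L (b : R) : closed_subspace N -> linear L ->
  adjoint_pair L L -> (forall x, N x -> N (L x)) -> 0 < b ->
  (forall x, nr (L x) <= b * nr x) -> (forall x, N x -> 0 <= ip (L x) x) ->
  forall x, N x -> nr (L x) ^+ 2 <= b * ip (L x) x.
Proof.
move=> Nc lL adj NLx b0 bL pos x Nx; have [_ LZ _ LB] := lin_facts lL.
(* Positivity at [x - b^-1 L x] reads [0 <= ip (L x) x - 2 |L x|^2 / b + ip (L (L x)) (L x) / b^2],
   and the last term is at most [|L x|^2 / b]. *)
have := pos _ (closed_subspaceB Nc Nx (closed_subspaceZ b^-1%:C Nc (NLx _ Nx))).
rewrite LB LZ !ipDl !ipDr !ipNl !ipNr !ipZr !ipZZ.
have -> : ip (L (L x)) x = nr (L x) ^+ 2 by rewrite adj ipxx.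
rewrite ipxx => h.
have h2 : ip (L (L x)) (L x) <= b * nr (L x) ^+ 2.
  by rewrite (le_trans (ip_le _ _)) // expr2 mulrA ler_wpM2r ?nr_ge0.
have h3 := ler_wpM2l (ltW b0) h.
have b1 : b * b^-1 = 1 by rewrite divff ?gt_eqF.
have := ler_wpM2l (ltW (_ : 0 < b * (b^-1 * b^-1))) h2.
move=> /(_ ltac:(by rewrite !mulr_gt0 ?invr_gt0)).
have -> : b * (b^-1 / b) * ip (L (L x)) (L x) = b^-1 * ip (L (L x)) (L x).
  by rewrite mulrA b1 mul1r.
have -> : b * (b^-1 / b) * (b * nr (L x) ^+ 2) = nr (L x) ^+ 2 by field; rewrite gt_eqF.
move: h3; rewrite mulr0.
move: (ip (L x) x) (nr (L x) ^+ 2) (ip (L (L x)) (L x)) => q n2 p.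
have -> : b * (q - b^-1 * n2 + (- (b^-1 * n2) - - (b^-1 * (b^-1 * p)))) =
    b * q - 2 * n2 + b^-1 * p by field; rewrite gt_eqF.
by lra.
Qed.

Lemma form_approx_kernel N L (b : R) : closed_subspace N -> linear L ->
  adjoint_pair L L -> (forall x, N x -> N (L x)) -> 0 < b ->
  (forall x, nr (L x) <= b * nr x) -> (forall x, N x -> 0 <= ip (L x) x) ->
  (forall e, 0 < e -> exists y, [/\ N y, y != 0 & ip (L y) y <= e * nr y ^+ 2]) ->
  forall e, 0 < e -> exists y, [/\ N y, y != 0 & nr (L y) <= e * nr y].
Proof.
move=> Nc lL adj NLx b0 bL pos ex e e0.
have [y [Ny y0 hy]] := ex (e ^+ 2 / b) (divr_gt0 (exprn_gt0 2 e0) b0).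
exists y; split=> //.
rewrite -(ler_pXn2r (n := 2)) ?nnegrE ?mulr_ge0 ?nr_ge0 ?(ltW e0) //.
rewrite (le_trans (positive_form_norm Nc lL adj NLx b0 bL pos Ny)) //.
have -> : (e * nr y) ^+ 2 = b * (e ^+ 2 / b * nr y ^+ 2) by field; rewrite gt_eqF.
by rewrite ler_wpM2l // ltW.
Qed.

(** With [m] the norm of [C] on [N], the form of [m^2 - Cs C] is nonnegative and nearly vanishes at
    near maximizers of [|C x| / |x|]. So [m^2] is an approximate eigenvalue of [Cs C]. *)
Lemma approx_eigenvalue_ex N C Cs M : closed_subspace N -> normal_on N C Cs M ->
  (exists2 x, N x & C x != 0) -> exists2 l : R[i], l != 0 & approx_eigenvalue N C l.
Proof.
move=> Nc nC [x0 Nx0 Cx0]; have [lC adj [M0 CM] CC NC] := nC.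
have lCs := adjoint_pair_linear adj lC; have CsM := adjoint_pair_bound adj CM.
have [C0 CZ CD CB] := lin_facts lC; have [_ CsZ CsD CsB] := lin_facts lCs.
pose S := [set r | exists x, [/\ N x, x != 0 & r = nr (C x) / nr x]].
have x00 : x0 != 0 by apply: contra_neq Cx0 => ->.
have S0 : S (nr (C x0) / nr x0) by exists x0.
have Sub : ubound S M.
  by move=> _ [x [Nx xn ->]]; rewrite ler_pdivrMr ?nr_gt0.
have Ssup : has_sup S by split; [exists (nr (C x0) / nr x0) | exists M].
pose m := sup S.
have Sm r : S r -> r <= m by move=> Sr; apply: ub_le_sup => //; exists M.
have m0 : 0 < m.
  by apply: lt_le_trans (Sm _ S0); rewrite divr_gt0 // nr_gt0.
have Cm x : N x -> nr (C x) <= m * nr x.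
  move=> Nx; have [->|xn] := eqVneq x 0; first by rewrite C0 !nr0 mulr0.
  by rewrite -ler_pdivrMr ?nr_gt0 //; apply: Sm; exists x.
pose L x := (m ^+ 2)%:C *: x - Cs (C x).
have ipL x : ip (L x) x = m ^+ 2 * nr x ^+ 2 - nr (C x) ^+ 2.
  by rewrite /L ipDl ipNl ipZr ipxx (adjoint_pair_gram _ adj).
have kL : forall e, 0 < e -> exists y, [/\ N y, y != 0 & nr (L y) <= e * nr y].
  apply: (form_approx_kernel (b := m ^+ 2 + M ^+ 2)) => //.
  - move=> a x y; rewrite /L !lC lCs !scalerDr !scalerA opprD [_ * a]mulrC addrACA.
    by rewrite scalerN.
  - by move=> x y; rewrite /L ipDl ipNl ipZr ipDr ipNr ipZZ -adj (adjoint_pair_sym adj).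
  - move=> x Nx; apply: closed_subspaceB => //; first exact: closed_subspaceZ.
    by have [/NC[]] := NC _ Nx.
  - by rewrite addr_gt0 // exprn_gt0.
  - move=> x; rewrite (le_trans (nrB _ _)) // nrZ nr_real ger0_norm ?sqr_ge0 // mulrDl lerD2l.
    by rewrite (le_trans (CsM _)) // expr2 -mulrA ler_wpM2l // ltW.
  - move=> x Nx; rewrite ipL subr_ge0 -exprMn.
    by rewrite ler_pXn2r ?nnegrE ?mulr_ge0 ?nr_ge0 ?(ltW m0) // Cm.
  move=> e e0.
  (* For [d = e / (2 m)] one has [(m - d)^2 >= m^2 - e]. Squaring needs [m - d >= 0], which holds if
     [e <= m^2]; otherwise the claim is trivial. *)
  have d0 : 0 < e / (2 * m) by rewrite divr_gt0 // mulr_gt0.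
  have [_ [x [Nx xn ->]] hx] := sup_adherent d0 Ssup; exists x; split=> //.
  have nx : 0 < nr x by rewrite nr_gt0.
  rewrite ipL.
have h := ltW hx; rewrite -/m ler_pdivlMr // in h.
  have h1 : nr (C x) ^+ 2 >= (m ^+ 2 - e) * nr x ^+ 2; last by lra.
  have [neg|pos] := ltP (m ^+ 2 - e) 0.
    by rewrite (@le_trans _ _ 0) ?sqr_ge0 // mulr_le0_ge0 ?sqr_ge0 // ltW.
  have em : e / (2 * m) * m = e / 2 by field; rewrite gt_eqF.
  have dm : 0 <= m - e / (2 * m).
    by rewrite -(pmulr_rge0 _ m0) mulrBr -expr2 [m * (_ / _)]mulrC em; lra.
  have : (m - e / (2 * m)) ^+ 2 * nr x ^+ 2 <= nr (C x) ^+ 2.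
    by rewrite -exprMn ler_pXn2r ?nnegrE ?mulr_ge0 ?nr_ge0.
  apply: le_trans; rewrite ler_wpM2r ?sqr_ge0 //.
  by have := sqr_ge0 (e / (2 * m)); rewrite !expr2; lra.
have aK : approx_eigenvalue N (Cs \o C) (m ^+ 2)%:C.
  by move=> e /kL[y [Ny yn hy]]; exists y; split=> //=; rewrite nrBC.
have [l l2 al] := approx_eigenvalue_gram Nc nC (exprn_gt0 2 m0) aK.
exists l => //; apply/eqP => l0; move: (exprn_gt0 2 m0).
by rewrite -l2 l0 nr0 expr0n ltxx.
Qed.

Lemma linear_sub_scale (F : H -> H) (c : R[i]) : linear F -> linear (fun y => F y - c *: y).
Proof.
move=> lF a x y; rewrite lF scalerDr !scalerA opprD addrACA [c * a]mulrC.
by rewrite scalerBr scalerA.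
Qed.

(** Let [d] be the infimum of [|(L - t) y| / |y|] and suppose [d < t]. Then [(L - t)^2 - d^2] is
    nonnegative with approximate kernel vectors, yet it factors as [(L - (t + d)) (L - (t - d))],
    and both [t + d] and [t - d] lie in the gap, where the factors are bounded below. *)
Lemma sym_gap L N (b t : R) : closed_subspace N -> linear L ->
  adjoint_pair L L -> (forall x, N x -> N (L x)) -> 0 < b ->
  (forall x, nr (L x) <= b * nr x) -> 0 < t ->
  (forall s, 0 < s -> s < 2 * t -> ~ approx_eigenvalue N L s%:C) ->
  forall x, N x -> t * nr x <= nr (L x - t%:C *: x).
Proof.
move=> Nc lL adj NL b0 bL t0 gap x Nx.
have [L0 LZ LD LB] := lin_facts lL.
rewrite leNgt; apply/negP => hx.
have xn : x != 0 by apply: contraTneq hx => ->; rewrite L0 scaler0 subrr !nr0 mulr0 ltxx.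
pose S := [set r | exists y, [/\ N y, y != 0 & r = nr (L y - t%:C *: y) / nr y]].
have Sx : S (nr (L x - t%:C *: x) / nr x) by exists x.
have Slb : lbound S 0 by move=> _ [y [_ _ ->]]; rewrite divr_ge0 ?nr_ge0.
have Sinf : has_inf S by split; [exists (nr (L x - t%:C *: x) / nr x) | exists 0].
pose d := inf S.
have d_le r : S r -> d <= r by move=> Sr; apply: ge_inf => //; exists 0.
have d0 : 0 <= d by apply: lb_le_inf => //; exists (nr (L x - t%:C *: x) / nr x).
have dt : d < t by rewrite (le_lt_trans (d_le _ Sx)) // ltr_pdivrMr ?nr_gt0.
have d_low y : N y -> d * nr y <= nr (L y - t%:C *: y).
  move=> Ny; have [->|yn] := eqVneq y 0; first by rewrite nr0 mulr0 nr_ge0.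
  by rewrite -ler_pdivlMr ?nr_gt0 //; apply: d_le; exists y.
pose S1 y := L y - t%:C *: y.
have S1L : linear S1 by exact: linear_sub_scale.
have S1adj : adjoint_pair S1 S1 by move=> y z; rewrite /S1 ipDl ipNl ipDr ipNr adj ipZr ipZZ.
have NS1 y : N y -> N (S1 y).
  by move=> Ny; apply: closed_subspaceB => //; [exact: NL | exact: closed_subspaceZ].
have S1b y : nr (S1 y) <= (b + t) * nr y.
  by rewrite (le_trans (nrB _ _)) // nrZ nr_real gtr0_norm // mulrDl lerD2r.
pose Q y := S1 (S1 y) - (d ^+ 2)%:C *: y.
have ipQ y : ip (Q y) y = nr (S1 y) ^+ 2 - d ^+ 2 * nr y ^+ 2.
  by rewrite /Q ipDl ipNl ipZr S1adj !ipxx.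
have bt : 0 < b + t by rewrite addr_gt0.
have kQ : forall e, 0 < e -> exists y, [/\ N y, y != 0 & nr (Q y) <= e * nr y].
  apply: (form_approx_kernel (b := (b + t) ^+ 2 + d ^+ 2)) => //.
  - by apply: linear_sub_scale => a y z; rewrite !S1L.
  - by move=> y z; rewrite /Q ipDl ipNl ipDr ipNr !S1adj ipZr ipZZ.
  - move=> y Ny; apply: closed_subspaceB => //; last exact: closed_subspaceZ.
    exact/NS1/NS1.
  - by rewrite ltr_wpDr ?sqr_ge0 // exprn_gt0.
  - move=> y; rewrite (le_trans (nrB _ _)) // nrZ nr_real ger0_norm ?sqr_ge0 // mulrDl lerD2r.
    by rewrite (le_trans (S1b _)) // expr2 -mulrA ler_wpM2l // ltW.
  - move=> y Ny; rewrite ipQ subr_ge0 -exprMn.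
    by rewrite ler_pXn2r ?nnegrE ?mulr_ge0 ?nr_ge0 // d_low.
  move=> e e0.
  (* For [g] this minimum, [(d + g)^2 - d^2 = g (2 d + g) <= 2 t g <= e], since
     [2 d + g <= t + d]. *)
  have g0 : 0 < Num.min (t - d) (e / (2 * t)) by rewrite lt_min subr_gt0 dt divr_gt0 // mulr_gt0.
  have [_ [y [Ny yn ->]] hy] := inf_adherent g0 Sinf; exists y; split=> //.
  have ny : 0 < nr y by rewrite nr_gt0.
  move: hy; rewrite -/d ltr_pdivrMr // => /ltW hy.
  rewrite ipQ lerBlDr -mulrDl.
  rewrite (@le_trans _ _ (((d + Num.min (t - d) (e / (2 * t))) * nr y) ^+ 2)) //.
    by rewrite ler_pXn2r ?nnegrE ?nr_ge0 // mulr_ge0 ?nr_ge0 // addr_ge0 // ltW.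
  rewrite exprMn ler_wpM2r ?sqr_ge0 //.
  have [g1 g2] : Num.min (t - d) (e / (2 * t)) <= t - d /\ Num.min (t - d) (e / (2 * t)) <= e / (2 * t).
    by rewrite !ge_min !lexx orbT.
  move: (Num.min _ _) g0 g1 g2 => g g0 g1; rewrite ler_pdivlMr ?mulr_gt0 // => g2.
  have h1 : g * (2 * d + g) <= g * (2 * t) by rewrite ler_pM2l //; lra.
  by rewrite sqrrD; lra.
have [g1 g10 low1] := approx_eigenvalueN (gap (t + d) ltac:(by rewrite ltr_pwDl) ltac:(lra)).
have [g2 g20 low2] := approx_eigenvalueN (gap (t - d) ltac:(lra) ltac:(lra)).
have [y [Ny yn hy]] := kQ (g1 * g2 / 2) ltac:(by rewrite divr_gt0 ?mulr_gt0).
have ny : 0 < nr y by rewrite nr_gt0.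
pose z := L y - (t - d)%:C *: y.
have Nz : N z by apply: closed_subspaceB => //; [exact: NL | exact: closed_subspaceZ].
have Qz : Q y = L z - (t + d)%:C *: z.
  have E (p : H) (s r : R) : L p - (s + r)%:C *: p = (L p - s%:C *: p) - r%:C *: p.
    by rewrite rmorphD scalerDl opprD addrA.
  rewrite E -/(S1 z) /z E -/(S1 y).
  have [_ S1Z S1D _] := lin_facts S1L.
  have -> : (- d)%:C = - d%:C by rewrite rmorphN.
  rewrite scaleNr opprK S1D S1Z [d%:C *: (S1 y + _)]scalerDr opprD addrA addrK scalerA.
  by rewrite /Q expr2 rmorphM.
have h1 := ler_wpM2l (ltW g10) (low2 y Ny); rewrite -/z in h1.
have h2 := low1 z Nz; rewrite -Qz in h2.
have h3 := le_trans h1 (le_trans h2 hy).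
have : 0 < g1 * g2 * nr y by rewrite !mulr_gt0.
by rewrite mulrA in h3; lra.
Qed.

(** Suppose [B] is injective on [N]. The approximate eigenvalues of [L = Bs B] avoid the open
    interval from 0 to [r^2], and the gap estimate at its midpoint becomes [r |B x| <= |L x|]. By
    Cauchy-Schwarz [B] is then bounded below by [r] on the range of [L]. Injectivity makes this
    range dense in [N], so 0 is no approximate eigenvalue. *)
Lemma isolated_approx_eigenvalue N B Bs M (r : R) : closed_subspace N ->
  normal_on N B Bs M -> 0 < r -> approx_eigenvalue N B 0 ->
  (forall l, approx_eigenvalue N B l -> nr l < r -> l = 0) ->
  exists x, [/\ N x, x != 0 & B x = 0].
Proof.
move=> Nc nB r0 a0 iso; have [N0 NL Ncl] := Nc.
have [lB adj [M0 BM] CC NB] := nB.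
have lBs := adjoint_pair_linear adj lB; have BsM := adjoint_pair_bound adj BM.
have [B0 BZ BD BB] := lin_facts lB; have [_ BsZ BsD BsB] := lin_facts lBs.
apply: contrapT => nex.
have inj x : N x -> B x = 0 -> x = 0.
  by move=> Nx Bx; have [->//|xn] := eqVneq x 0; case: nex; exists x.
pose L x := Bs (B x).
have lL : linear L by move=> a x y; rewrite /L lB lBs.
have L00 : L 0 = 0 by rewrite /L B0; case: (lin_facts lBs).
have Ladj : adjoint_pair L L by move=> x y; rewrite /L (adjoint_pair_sym adj) adj.
have NLx x : N x -> N (L x) by case/NB => /NB[].
have r2 : 0 < r ^+ 2 / 2 by rewrite divr_gt0 ?exprn_gt0.
have gapL s : 0 < s -> s < 2 * (r ^+ 2 / 2) -> ~ approx_eigenvalue N L s%:C.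
  move=> s0 s1 aL; have [l l2 /iso lE] := approx_eigenvalue_gram Nc nB s0 aL.
  have l0 : l = 0.
    apply: lE; rewrite -(ltr_pXn2r (n := 2)) ?nnegrE ?nr_ge0 ?(ltW r0) // l2; lra.
  by move: s0; rewrite -l2 l0 nr0 expr0n ltxx.
have Lb x : nr (L x) <= M ^+ 2 * nr x.
  by rewrite (le_trans (BsM _)) // expr2 -mulrA ler_wpM2l // ltW.
have low1 := sym_gap Nc lL Ladj NLx (exprn_gt0 2 M0) Lb r2 gapL.
have r0' : 0 <= r by exact: ltW.
have low2 x : N x -> r * nr (B x) <= nr (L x).
  move=> Nx; have := low1 x Nx.
  rewrite -(ler_pXn2r (n := 2)) ?nnegrE ?mulr_ge0 ?nr_ge0 ?(ltW r2) //.
  rewrite nrB2 nrZ nr_real gtr0_norm // ipZZ // (adjoint_pair_gram x adj) => h.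
  rewrite -(ler_pXn2r (n := 2)) ?nnegrE ?mulr_ge0 ?nr_ge0 //.
  by rewrite exprMn; lra.
have low3 x : N x -> r * nr (L x) <= nr (B (L x)).
  move=> Nx; have [->|Lx] := eqVneq (L x) 0; first by rewrite nr0 mulr0 nr_ge0.
  have nL : 0 < nr (L x) by rewrite nr_gt0.
  rewrite -(ler_pM2r nL) -mulrA -expr2.
  have -> : nr (L x) ^+ 2 = ip (B x) (B (L x)) by rewrite -ipxx {1}/L (adjoint_pair_sym adj).
  have := ler_wpM2l (ltW r0) (ip_le (B x) (B (L x))).
  have := ler_wpM2r (nr_ge0 (B (L x))) (low2 _ Nx).
  by lra.
pose W w := forall e : R, 0 < e -> exists x, N x /\ nr (L x - w) < e.
have Wc : closed_subspace W.
  split.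
  - by move=> e e0; exists 0; rewrite L00 subrr nr0.
  - move=> a x y Wx Wy e e0.
    have K0 : 0 < nr a + 1 by rewrite ltr_wpDl ?nr_ge0.
    have [x' [Nx' hx']] := Wx _ (divr_gt0 e0 K0); have [y' [Ny' hy']] := Wy _ (divr_gt0 e0 K0).
    exists (a *: x' + y'); split; first exact: NL.
    rewrite lL opprD addrACA -scalerBr (le_lt_trans (nrD _ _)) // nrZ.
    have -> : e = nr a * (e / (nr a + 1)) + e / (nr a + 1) by field; rewrite gt_eqF.
    by rewrite ler_ltD // ler_wpM2l ?nr_ge0 // ltW.
  move=> x hx e e0; have e2 : 0 < e / 2 by rewrite divr_gt0.
  have [w Ww wx] := hx _ e2; have [y [Ny yw]] := Ww _ e2; exists y; split=> //.
  by rewrite (le_lt_trans (nr_dist w _ _)) // [e]splitr ltrD.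
have WN w : W w -> N w by move=> Ww; apply: Ncl => e /Ww[x [Nx xw]]; exists (L x); [exact: NLx|].
have NW u : N u -> W u.
  move=> Nu; have [p [Wp up]] := projection_ex Wc u.
  suff : u - p = 0 by move/eqP; rewrite subr_eq0 => /eqP ->.
  have Nq : N (u - p) by apply: closed_subspaceB => //; exact: WN.
  apply: inj => //; apply/eqP; rewrite -nr_eq0 -sqrf_eq0 -(adjoint_pair_gram _ adj).
  by rewrite ipC up // => e e0; exists (u - p); rewrite subrr nr0.
have lowN u : N u -> r * nr u <= nr (B u).
  move=> /NW Wu; apply/ler_addgt0Pr => e e0.
  have [x [Nx hx]] := Wu (e / (r + M)) ltac:(by rewrite divr_gt0 // addr_gt0).
  have h1 := low3 x Nx.
  have h2 := nr_subr u (L x); rewrite nrBC in h2.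
  have h3 : nr (B (L x)) <= nr (B u) + M * nr (L x - u).
    have := nr_subr (B (L x)) (B u); rewrite -BB => h.
    by have := BM (L x - u); lra.
  have h4 := ler_wpM2l (ltW r0) h2.
  have h5 : (r + M) * nr (L x - u) <= e.
    by rewrite mulrC -ler_pdivlMr ?addr_gt0 // ltW.
  by lra.
have [y [Ny yn hy]] := a0 (r / 2) ltac:(by rewrite divr_gt0).
have ny : 0 < nr y by rewrite nr_gt0.
have := lowN y Ny; move: hy; rewrite scale0r subr0 => h1 h2.
by have := mulr_gt0 r0 ny; lra.
Qed.

(** * Unbounded normal operators *)

Section NormalOperator.
Variable A : partial_op H.
Hypothesis A_normal : normal_op dot A.
Local Notation As := (adjoint_op dot A).

Let lA : linear_op A. Proof. by case: A_normal. Qed.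
Let dA : dense (op_dom A). Proof. by case: A_normal. Qed.
Let cA x y : (forall e : R, 0 < e ->
    exists z, [/\ op_dom A z, nr (z - x) < e & nr (A z - y) < e]) ->
  op_dom A x /\ A x = y.
Proof. by move: x y; apply/closed_graph_nrP; case: A_normal. Qed.

Lemma adjoint_ip x y : op_dom A x -> op_dom As y -> ip (A x) y = ip x (As y).
Proof. by move=> Ax Ay; apply: (adjointP lA dA y (As y)).1. Qed.

Lemma adjoint_closed x y : graph_core (op_dom As) As x y -> op_dom As x /\ As x = y.
Proof.
move=> xy; apply/(adjointP lA dA) => z Az.
apply/eqP; rewrite -subr_eq0; apply/eqP/(@eq0_small _ (nr z + nr (A z))) => e /xy[w [Aw wx wy]].
have -> : ip (A z) x - ip z y = ip z (As w - y) - ip (A z) (w - x).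
  by rewrite !ipDr !ipNr (adjoint_ip Az Aw); lra.
rewrite (le_trans (ler_normB _ _)) // mulrDr lerD //.
  by rewrite (le_trans (ip_norm _ _)) // mulrC ler_wpM2r ?nr_ge0 // ltW.
by rewrite (le_trans (ip_norm _ _)) // mulrC ler_wpM2r ?nr_ge0 // ltW.
Qed.

Lemma adjoint_linear : linear_op As.
Proof.
split; first by have [_ /(_ _)[|? _]] := adjointP lA dA 0 0; first by move=> x _; rewrite !ip0r.
move=> a x y Ax Ay; apply/(adjointP lA dA) => z Az; have [AZ _ _ _] := linear_opP lA.
rewrite !ipDr -adjoint_ip // ![ip _ (_ *: _)]ipC !ipZ ![ip _ (_ *: _)]ipC.
by have [dz <-] := AZ a^* z Az; rewrite adjoint_ip.
Qed.

(* By normality this is also the domain of A A*. *)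
Let D x := op_dom A x /\ op_dom As (A x).

Let D_swap x : D x -> [/\ op_dom As x, op_dom A (As x) & A (As x) = As (A x)].
Proof.
case: A_normal => _ _ _ [e1 e2] Dx.
have : op_dom (op_comp A As) x by rewrite -e1.
by case=> ? ?; split=> //; exact: esym (e2 x Dx).
Qed.

Let D_norm x : D x -> nr (As x) = nr (A x).
Proof.
move=> Dx; have [Asx AAs e] := D_swap Dx; case: Dx => Ax AsA.
apply/eqP; rewrite -(eqrXn2 (n := 2)) ?nr_ge0 // -!ipxx adjoint_ip // -e.
by rewrite [X in _ == X]ipC adjoint_ip.
Qed.

(** Von Neumann's argument: project [(u, 0)] onto the closed graph of [A]. Orthogonality of the
    remainder [(u - x, - A x)] says exactly that [As (A x)] exists and equals [u - x]. *)
Let D_onto u : exists2 x, D x & x + As (A x) = u.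
Proof.
have [_ AL] := lA.
have [|a x y x' y' [Ax ->] [Ax' ->]|x y xy|x [y [[Ax ->] xy]]] :=
    @projection_graph (fun x y => op_dom A x /\ y = A x) u 0.
- by have [] := linear_opP lA; case: lA.
- by have [? ->] := AL a _ _ Ax Ax'.
- suff [? ->] : op_dom A x /\ A x = y by [].
  by apply: cA => e /xy[x' [y' [[? ->] ? ?]]]; exists x'.
have [AsA AsE] : op_dom As (A x) /\ As (A x) = u - x.
  apply/(adjointP lA dA) => z Az; have := xy z (A z) (conj Az erefl).
  rewrite sub0r ipNl => /eqP; rewrite subr_eq0 => /eqP.
  by rewrite ipC => ->; rewrite ipC.
by exists x; rewrite // AsE addrC subrK.
Qed.

Let D_lin a x y : D x -> D y -> D (a *: x + y).
Proof.
move=> [Ax AAx] [Ay AAy]; have [_ AL] := lA; have [_ AsL] := adjoint_linear.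
have [d1 e1] := AL a _ _ Ax Ay; split=> //.
by rewrite e1; case: (AsL a _ _ AAx AAy).
Qed.

Let D0 : D 0.
Proof.
by have [_ _ _ A00] := linear_opP lA; split; rewrite ?A00; [case: lA | case: adjoint_linear].
Qed.

(** If [(z, A z)] is orthogonal to the graph over [D], then [z] is orthogonal to every
    [v + As (A v)] with [v] in [D], that is, to everything. For the adjoint the same works because
    [A As = As A] on [D]. *)
Let D_core x : op_dom A x -> graph_core D A x (A x).
Proof.
move=> Ax; have [_ AL] := lA; have [_ _ AB A00] := linear_opP lA.
apply: (@graph_core_full D A (fun x y => op_dom A x /\ y = A x)) => //.
- by move=> a z w Dz Dw; split; [exact: D_lin | case: Dz Dw => dz _ [dw _]; case: (AL a z w)].
- move=> z w zw; suff [? ->] : op_dom A z /\ A z = w by [].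
  by apply: cA => e /zw[x' [[? ?] ? ?]]; exists x'.
- by move=> z w z' w' [dz ->] [dz' ->]; have [? ->] := AB _ _ dz dz'.
move=> z w [dz ->] orth; suff z0 : z = 0 by rewrite z0.
apply: ip_all0 => u; have [v Dv <-] := D_onto u.
by have := orth v Dv; case: Dv => dv AsAv; rewrite ipDr adjoint_ip.
Qed.

Let D_core_adjoint x : op_dom As x -> graph_core D As x (As x).
Proof.
move=> Ax; have [_ AL] := adjoint_linear; have [_ _ AB A00] := linear_opP adjoint_linear.
apply: (@graph_core_full D As (fun x y => op_dom As x /\ y = As x)) => //.
- move=> a z w Dz Dw; split; first exact: D_lin.
  by have [dz _ _] := D_swap Dz; have [dw _ _] := D_swap Dw; case: (AL a z w).
- move=> z w zw; suff [? ->] : op_dom As z /\ As z = w by [].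
  by apply: adjoint_closed => e /zw[x' [/D_swap[? _ _] ? ?]]; exists x'.
- by move=> z w z' w' [dz ->] [dz' ->]; have [? ->] := AB _ _ dz dz'.
move=> z w [dz ->] orth; suff z0 : z = 0 by rewrite z0.
apply: ip_all0 => u; have [v Dv <-] := D_onto u.
have := orth v Dv; have [dv AAv e] := D_swap Dv.
by rewrite ipDr -e [ip z (A _)]ipC adjoint_ip // [ip (As v) _]ipC.
Qed.

Let D_sub (B : partial_op H) z w : linear_op B -> (forall x, D x -> op_dom B x) ->
  D z -> D w -> nr (B z - B w) = nr (B (z - w)).
Proof.
move=> /linear_opP[_ _ BB _] DB Dz Dw.
by have [_ ->] := BB _ _ (DB _ Dz) (DB _ Dw).
Qed.

Let D_dist z w : D z -> D w -> nr (As z - As w) = nr (A z - A w).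
Proof.
move=> Dz Dw; have Dzw : D (z - w) by rewrite addrC -scaleN1r; exact: D_lin.
rewrite (D_sub adjoint_linear) //; last by move=> x /D_swap[].
by rewrite (D_sub lA) ?D_norm // => x [].
Qed.

(** [A] and [As] have equal norms on the core [D], so a sequence of [D] converging to [x] in the
    graph of [A] also converges in the graph of [As]. *)
Lemma normal_adjoint_norm x : op_dom A x -> op_dom As x /\ nr (As x) = nr (A x).
Proof.
move=> Ax; have [w <- xw] := graph_core_limit D_dist D_norm (D_core Ax).
suff [? ->] : op_dom As x /\ As x = w by [].
by apply: adjoint_closed => e /xw[x' [/D_swap[? _ _] ? ?]]; exists x'.
Qed.

Lemma normal_adjoint_dom x : op_dom As x -> op_dom A x.
Proof.
move=> Ax; have [w _ xw] := graph_core_limit (fun z w Dz Dw => esym (D_dist Dz Dw))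
  (fun z Dz => esym (D_norm Dz)) (D_core_adjoint Ax).
suff [] : op_dom A x /\ A x = w by [].
by apply: cA => e /xw[x' [[? _] ? ?]]; exists x'.
Qed.

Lemma normal_shift_norm (l : R[i]) x : op_dom A x -> nr (As x - l^* *: x) = nr (A x - l *: x).
Proof.
move=> Ax; have [Asx nAs] := normal_adjoint_norm Ax; have [AZ _ _ _] := linear_opP lA.
apply/eqP; rewrite -(eqrXn2 (n := 2)) ?nr_ge0 // !nrB2 nAs !nrZ.
have -> : nr l^* = nr l by rewrite /nr norm_conjC.
have [dz ez] := AZ l^* x Ax.
by rewrite ipC -adjoint_ip // ez ipZ conjCK.
Qed.

Lemma eigen_adjoint (l : R[i]) x : op_dom A x -> A x = l *: x ->
  op_dom As x /\ As x = l^* *: x.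
Proof.
move=> Ax e; split; first by case: (normal_adjoint_norm Ax).
apply/eqP; rewrite -subr_eq0 -nr_eq0 normal_shift_norm //.
by rewrite e subrr nr0.
Qed.

Lemma eigen_orthogonal (l m : R[i]) x y : op_dom A x -> A x = l *: x ->
  op_dom A y -> A y = m *: y -> l != m -> ip x y = 0.
Proof.
move=> Ax ex Ay ey lm; have [AZ _ _ _] := linear_opP lA.
have [Asy esy] := eigen_adjoint Ay ey.
(* [ip] is only real bilinear, so the complex factor [l - m] is divided out of [x] beforehand. *)
have [] := AZ (l - m)^-1 _ Ax; set z := _ *: x => Az ez.
have h : ip (A z) y = ip (m *: z) y by rewrite adjoint_ip // esy -ipZ.
have lmz : (l - m) *: z = x by rewrite /z scalerA divff ?scale1r // subr_eq0.
rewrite -lmz scalerBl ipDl ipNl -h ez ex scalerA mulrC -scalerA -/z.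
by rewrite subrr.
Qed.

(** The lower bound and closedness of [A] make the range of [A - l] closed. A vector [z] orthogonal
    to it satisfies [As z = l^* z], hence [A z = l z] by normality, hence [z = 0]. *)
Lemma resolvent_bounded_below (l : R[i]) (c : R) : 0 < c ->
  (forall x, op_dom A x -> c * nr x <= nr (A x - l *: x)) -> resolvent_set A l.
Proof.
move=> c0 hc; have [AZ AD AB A00] := linear_opP lA.
have inj x y : op_dom A x -> op_dom A y -> nr (x - y) <= nr ((A x - l *: x) - (A y - l *: y)) / c.
  move=> Ax Ay; have [dxy exy] := AB _ _ Ax Ay.
  rewrite ler_pdivlMr // mulrC (le_trans (hc _ dxy)) // exy scalerBr.
  by rewrite subrACA.
pose Rg y := exists x, op_dom A x /\ A x - l *: x = y.
have Rgc : closed_subspace Rg.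
  split.
  - by exists 0; rewrite A00 scaler0 subrr; case: lA.
  - move=> a _ _ [x [Ax <-]] [y [Ay <-]]; exists (a *: x + y); have [_ AL] := lA.
    have [? ->] := AL a _ _ Ax Ay; split=> //.
    by rewrite scalerDr opprD addrACA scalerBr !scalerA [l * a]mulrC.
  move=> y hy.
  have ex n : exists x, op_dom A x /\ nr (A x - l *: x - y) < n.+1%:R^-1.
    have [|_ [x [Ax <-]] xy] := hy n.+1%:R^-1; first by rewrite invr_gt0 ltr0n.
    by exists x.
  have [u hu] := choice ex.
  have [e e0|x hx] := @complete_nr u.
    have [n0 hn0] := invS_small (divr_gt0 (mulr_gt0 e0 c0) (ltr0n R 2)).
    exists n0 => n m /hn0 n0n /hn0 n0m; have [An yn] := hu n; have [Am ym] := hu m.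
    rewrite (le_lt_trans (inj _ _ An Am)) // ltr_pdivrMr //.
    rewrite (le_lt_trans (nr_dist y _ _)) // (nrBC y) [_ * _]splitr.
    by rewrite ltrD ?(lt_trans yn) ?(lt_trans ym).
  exists x; suff [Ax ->] : op_dom A x /\ A x = y + l *: x by rewrite addrK.
  apply: cA => e e0; have K0 : 0 < e / (2 * (nr l + 1)).
    by rewrite divr_gt0 // mulr_gt0 // ltr_wpDl ?nr_ge0.
  have [n0 hn0] := invS_small (divr_gt0 e0 (ltr0n R 2)); have [n1 hn1] := hx _ K0.
  have [n2 hn2] := hx _ e0; pose n := (n0 + n1 + n2)%N; exists (u n).
  have [An yn] := hu n; split=> //; first by apply: hn2; rewrite /n leq_addl.
  have -> : A (u n) - (y + l *: x) = (A (u n) - l *: u n - y) + l *: (u n - x).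
    by rewrite scalerBr [_ - _ - y]addrAC subrKA opprD addrA.
  rewrite (le_lt_trans (nrD _ _)) // [e]splitr nrZ ltr_leD //.
    by rewrite (lt_trans yn) // hn0 // /n -addnA leq_addr.
  have := hn1 n ltac:(by rewrite /n addnAC leq_addl) => /ltW h.
  move: h; rewrite ler_pdivlMr ?mulr_gt0 ?ltr_wpDl ?nr_ge0 // => h.
  by have := nr_ge0 (u n - x); lra.
have Rgfull : forall y, Rg y.
  apply: closed_subspace_full => // z hz.
  have [Asz esz] : op_dom As z /\ As z = l^* *: z.
    apply/(adjointP lA dA) => x Ax; have := hz (A x - l *: x) ltac:(by exists x).
    by rewrite ipC ipDl ipNl ipZ => /eqP; rewrite subr_eq0 => /eqP.
  have Az := normal_adjoint_dom Asz.
  have := hc _ Az; rewrite -normal_shift_norm // esz subrr nr0 pmulr_rle0 // => nz.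
  by apply/eqP; rewrite -nr_eq0 eq_le nz nr_ge0.
have [S hS] := choice Rgfull.
have Suniq x : op_dom A x -> S (A x - l *: x) = x.
  move=> Ax; apply/eqP; rewrite -subr_eq0 -nr_eq0 eq_le nr_ge0 andbT.
  have [dS eS] := hS (A x - l *: x).
  by rewrite (le_trans (inj _ _ dS Ax)) // eS subrr nr0 mul0r.
have lS : linear S.
  move=> a x y; have [dx ex] := hS x; have [dy ey] := hS y.
  have [_ AL] := lA; have [d e] := AL a _ _ dx dy.
  rewrite -[RHS]Suniq // e; congr (S _).
  rewrite -[in LHS]ex -[in LHS]ey scalerBr scalerDr opprD [RHS]addrACA !scalerA.
  by rewrite [l * a]mulrC.
pose SL := GRing.isLinear.Build _ _ _ _ S lS.
pose SS : {linear H -> H} := HB.pack S SL.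
exists SS; split=> [|y|//]; last exact: hS.
apply/(lin_nrP lS); exists c^-1; rewrite ?invr_gt0 // => y; have [d {2}<-] := hS y.
by rewrite mulrC ler_pdivlMr // mulrC hc.
Qed.

Definition eigen_perp x := forall e (l : R[i]), op_dom A e -> A e = l *: e -> ip x e = 0.

Lemma eigen_perp_closed : closed_subspace eigen_perp.
Proof.
have [AZ _ _ _] := linear_opP lA.
split=> [e l _ _|a x y hx hy e l Ae ee|x hx e l Ae ee]; first by rewrite ip0l.
  have [Ae' ee'] := AZ a^* e Ae.
  by rewrite ipDl (hy e l) // ipZ (hx _ l) ?addr0 // ee' ee !scalerA mulrC.
apply: (@eq0_small _ (nr e)) => d /hx[y /(_ e l Ae ee) hy yx].
have -> : ip x e = - ip (y - x) e by rewrite ipDl ipNl hy sub0r opprK.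
by rewrite normrN (le_trans (ip_norm _ _)) // ler_wpM2r ?nr_ge0 // ltW.
Qed.

(** [eigen_perp] reduces the resolvent [C] because eigenvectors of [A] are eigenvectors of [C] and
    of its adjoint. *)
Lemma resolvent_operator (m : R[i]) : resolvent_set A m -> exists C Cs : H -> H, exists M : R,
  [/\ linear C, 0 < M, forall x, nr (C x) <= M * nr x & adjoint_pair C Cs] /\
  [/\ forall y, op_dom A (C y) /\ A (C y) - m *: C y = y,
      forall x, op_dom A x -> C (A x - m *: x) = x,
      forall x, C (Cs x) = Cs (C x),
      forall x, eigen_perp x -> eigen_perp (C x) &
      forall x, eigen_perp x -> eigen_perp (Cs x)].
Proof.
move=> [S [Sc SR SL]].
have lC : linear S by move=> a x y; rewrite linearP.
have [M M0 SM] := (lin_nrP lC).1 Sc.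
have [Cs adj] := adjoint_pair_ex lC M0 SM.
have lCs := adjoint_pair_linear adj lC.
have [AZ AD AB A00] := linear_opP lA; have [AsZ _ AsB _] := linear_opP adjoint_linear.
have [_ CsZ _ _] := lin_facts lCs; have [C00 CZ _ CB] := lin_facts lC.
have CE x : op_dom A x -> S (A x) = x + m *: S x.
  by move=> Ax; rewrite -{2}(SL x Ax) CB CZ subrK.
exists S, Cs, M; split=> //; split=> // [u|x hx e l Ae ee|x hx e l Ae ee].
- have [Asv esv] : op_dom As (Cs u) /\ As (Cs u) = u + m^* *: Cs u.
    apply/(adjointP lA dA) => x Ax; rewrite ipDr ipZC -!adj CZ conjCK.
    by rewrite -ipDl CE.
  set v := Cs u in Asv esv *; set w := S v.
  have [dw ew] : op_dom A w /\ A w = v + m *: w.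
    by have [? e] := SR v; split=> //; rewrite -[X in X + _]e subrK.
  have dv := normal_adjoint_dom Asv.
  have [Asw _] := normal_adjoint_norm dw.
  have [_ AsD _ _] := linear_opP adjoint_linear.
  have [dmw emw] := AsZ m _ Asw; have [AsAw eAsAw] := AsD _ _ Asv dmw.
  have Dw : D w by split=> //; rewrite ew.
  have [_ AAsw eAAsw] := D_swap Dw.
  have [d1 e1] := AZ m^* _ dw; have [d2 e2] := AB _ _ AAsw d1.
  have Su : S u = As w - m^* *: w.
    rewrite -[RHS]SL // e2 e1 eAAsw ew eAsAw emw esv; congr (S _).
    rewrite scalerBr [_ *: (v + _)]scalerDr !scalerA [m^* * m]mulrC.
    by rewrite [u + _ + _]addrAC opprD addrA addrK opprB subrKA addrK.
  rewrite Su; apply: ip_ext => z; rewrite -/w [ip w _]ipC [RHS]ipC -adj.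
  have [dz ez] := SR z.
  by rewrite ipDr ipNr -adjoint_ip // ipZC conjCK -ipNl -ipDl ez.
- have [e0|e0] := eqVneq e 0; first by rewrite e0 ip0r.
  have [Ase ese] := eigen_adjoint Ae ee.
  have lm : l - m != 0.
    by apply: contra_neq e0 => lm; rewrite -(SL e Ae) ee -scalerBl lm scale0r C00.
  have Cse : (l - m)^* *: Cs e = e.
    apply: ip_ext => z; rewrite [LHS]ipC [RHS]ipC ipZC conjCK -adj CZ ipZ rmorphB /=.
    rewrite scalerBl ipDr ipNr -ese; have [dz ez] := SR z.
    by rewrite -adjoint_ip // ipZC conjCK -ipNl -ipDl ez.
  have [d1 e1] := AZ ((l - m)^*)^-1 e Ae.
  have <- : ip x (((l - m)^*)^-1 *: e) = 0 by apply: (hx _ l d1); rewrite e1 ee !scalerA mulrC.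
  rewrite adj -{2}Cse scalerA mulVf ?scale1r // conjC_eq0 //.
have [e0|e0] := eqVneq e 0; first by rewrite e0 ip0r.
have lm : l - m != 0.
  by apply: contra_neq e0 => lm; rewrite -(SL e Ae) ee -scalerBl lm scale0r C00.
have [d1 e1] := AZ (l - m)^-1 e Ae.
have <- : ip x ((l - m)^-1 *: e) = 0 by apply: (hx _ l d1); rewrite e1 ee !scalerA mulrC.
rewrite [LHS]ipC -adj ipC -{2}(SL e Ae) ee -scalerBl CZ scalerA mulVf // scale1r.
by [].
Qed.

(** * Approximate eigenvalues of unbounded operators *)

Definition op_approx_eigenvalue (N : H -> Prop) (l : R[i]) := forall e : R, 0 < e ->
  exists x, [/\ N x, op_dom A x, x != 0 & nr (A x - l *: x) <= e * nr x].

Lemma approx_eigenvalue_resolvent N (C : H -> H) (m c : R[i]) :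
  (forall y, op_dom A (C y) /\ A (C y) - m *: C y = y) ->
  (forall x, N x -> N (C x)) -> c != 0 ->
  approx_eigenvalue N C c -> op_approx_eigenvalue N (m + c^-1).
Proof.
move=> CR NC c0 aC e e0; have nc : 0 < nr c by rewrite nr_gt0.
(* The first bound keeps [|C y| >= |c| |y| / 2]; with it the second bounds [|C y - c y| / |c|] by
   [e |C y|]. *)
have d0 : 0 < Num.min (nr c / 2) (e * nr c ^+ 2 / 2).
  by rewrite lt_min !divr_gt0 // mulr_gt0 // exprn_gt0.
have [y [Ny y0 hy]] := aC _ d0.
have ny : 0 < nr y by rewrite nr_gt0.
have h1 : nr (C y - c *: y) <= nr c / 2 * nr y.
  by rewrite (le_trans hy) // ler_pM2r // ge_min lexx.
have h2 : nr (C y - c *: y) <= e * nr c ^+ 2 / 2 * nr y.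
  by rewrite (le_trans hy) // ler_pM2r // ge_min lexx orbT.
have low : nr c * nr y <= 2 * nr (C y).
  have := nr_subr (c *: y) (C y); rewrite nrBC nrZ => h; lra.
have [Ay ey] := CR y; exists (C y); split=> //; first exact: NC.
  by rewrite -nr_gt0 -(pmulr_rgt0 _ (ltr0n R 2)) (lt_le_trans _ low) // mulr_gt0.
have -> : A (C y) - (m + c^-1) *: C y = - c^-1 *: (C y - c *: y).
  by rewrite scalerDl opprD addrA ey scalerBr !scaleNr opprK scalerA mulVf // scale1r addrC.
rewrite nrZ nrN nrV mulrC ler_pdivrMr //.
have := ler_wpM2l (ltW (mulr_gt0 e0 nc)) low; rewrite expr2 in h2; lra.
Qed.

Lemma op_approx_spectrum N (l : R[i]) : op_approx_eigenvalue N l -> spectrum A l.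
Proof.
move=> aA [S [Sc _ SL]].
have lS : linear S by move=> a x y; rewrite linearP.
have [M M0 SM] := (lin_nrP lS).1 Sc.
have [x [_ Ax x0 hx]] := aA (M^-1 / 2) ltac:(by rewrite divr_gt0 // invr_gt0).
have nx : 0 < nr x by rewrite nr_gt0.
have := SM (A x - l *: x); rewrite SL // leNgt => /negP; apply.
rewrite (le_lt_trans (ler_wpM2l (ltW M0) hx)) //.
have -> : M * (M^-1 / 2 * nr x) = nr x / 2 by field; rewrite gt_eqF.
by lra.
Qed.

Lemma eigen_perp_eq0 x (l : R[i]) : eigen_perp x -> op_dom A x -> A x = l *: x -> x = 0.
Proof.
move=> Nx Ax ex; have := Nx _ _ Ax ex.
by rewrite ipxx => /eqP; rewrite sqrf_eq0 nr_eq0 => /eqP.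
Qed.

Lemma eigen_perp_resolvent (m : R[i]) x0 : resolvent_set A m -> eigen_perp x0 -> x0 != 0 ->
  exists C Cs M c, [/\ normal_on eigen_perp C Cs M,
    forall y, op_dom A (C y) /\ A (C y) - m *: C y = y,
    c != 0 & approx_eigenvalue eigen_perp C c].
Proof.
move=> rm Nx0 xn; have [C [Cs [M [[lC M0 CM adj] [CR CL CC NC NCs]]]]] := resolvent_operator rm.
have nC : normal_on eigen_perp C Cs M by split=> // x Nx; split; [exact: NC | exact: NCs].
have [|c c0 ac] := approx_eigenvalue_ex eigen_perp_closed nC.
  exists x0 => //; apply: contra_neq xn => Cx.
  have [_ _ _ A00] := linear_opP lA.
  by have [_ <-] := CR x0; rewrite Cx A00 scaler0 subrr.
by exists C, Cs, M, c.
Qed.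

(** Otherwise the resolvent at [m] has a nonzero approximate eigenvalue [c] on the complement. As
    [m + d^-1] is in the spectrum for every nonzero approximate eigenvalue [d], discreteness
    isolates [c], which thus has an eigenvector; this is an eigenvector of [A] orthogonal to
    itself. *)
Lemma eigen_perp_discrete (m : R[i]) : resolvent_set A m ->
  (forall l, spectrum A l -> exists2 r : R, 0 < r &
     forall l', spectrum A l' -> nr (l' - l) < r -> l' = l) ->
  forall x, eigen_perp x -> x = 0.
Proof.
move=> rm disc x0 Nx0; apply/eqP/negP => /negP xn.
have [C [Cs [M [c [nC CR c0 ac]]]]] := eigen_perp_resolvent rm Nx0 xn.
have [lC adj [M0 CM] CC NC] := nC; have NCx x : eigen_perp x -> eigen_perp (C x) by case/NC.
have [_ CZ _ _] := lin_facts lC.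
have lCs := adjoint_pair_linear adj lC; have [_ CsZ _ _] := lin_facts lCs.
have nc : 0 < nr c by rewrite nr_gt0.
have sp d : d != 0 -> approx_eigenvalue eigen_perp C d -> spectrum A (m + d^-1).
  by move=> d0 ad; apply: (op_approx_spectrum (N := eigen_perp)); exact: approx_eigenvalue_resolvent ad.
have [rho rho0 hrho] := disc _ (sp _ c0 ac).
(* The first bound gives [|c + l| > |c| / 2], and then the second makes the distance
   [|l| / (|c| |c + l|)] of the two points of the spectrum smaller than [rho]. *)
pose r := Num.min (nr c / 2) (rho * nr c ^+ 2 / 2).
have r0 : 0 < r by rewrite lt_min !divr_gt0 // mulr_gt0 // exprn_gt0.
have nB : normal_on eigen_perp (fun x => C x - c *: x) (fun x => Cs x - c^* *: x) (M + nr c).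
  split.
  - exact: linear_sub_scale.
  - by move=> x y; rewrite ipDl ipNl ipDr ipNr adj ipZ.
  - split=> [|x]; first by rewrite addr_gt0.
    by rewrite (le_trans (nrB _ _)) // nrZ mulrDl lerD2r.
  - move=> x; have [_ _ _ CB] := lin_facts lC; have [_ _ _ CsB] := lin_facts lCs.
    rewrite CB CsB CZ CsZ !scalerBr !scalerA CC subrACA [c * _]mulrC.
    by rewrite -!addrA; congr (_ + _); rewrite addrCA.
  move=> x Nx; have [? ?] := NC _ Nx; have Nc := eigen_perp_closed.
  by split; apply: (closed_subspaceB Nc) => //; exact: (closed_subspaceZ _ Nc).
have [||x [Nx xn' Bx]] := isolated_approx_eigenvalue eigen_perp_closed nB r0.
- by move=> e /ac[y [? ? hy]]; exists y; split=> //; rewrite scale0r subr0.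
- move=> l al lr.
  have [lr1 lr2] : nr l < nr c / 2 /\ nr l < rho * nr c ^+ 2 / 2.
    by move: lr; rewrite lt_min => /andP[].
  have ncl : nr c / 2 < nr (c + l).
    have := nr_subr c (- l); rewrite opprK nrN => h; lra.
  have cl0 : c + l != 0 by rewrite -nr_gt0; lra.
  have acl : approx_eigenvalue eigen_perp C (c + l).
    move=> e /al[y [? ? hy]]; exists y; split=> //.
    by rewrite scalerDl opprD addrA.
  have := hrho _ (sp _ cl0 acl).
  have -> : m + (c + l)^-1 - (m + c^-1) = - l / (c * (c + l)) by field; rewrite cl0.
  rewrite nrM nrN nrV nrM ltr_pdivrMr ?mulr_gt0 //; last by lra.
  have h : nr l < rho * (nr c * nr (c + l)).
    apply: lt_trans lr2 _; have := mulr_gt0 rho0 nc => rc.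
    by have := ltr_pM2l rc (nr c / 2) (nr (c + l)); rewrite ncl expr2 => h; lra.
  move=> /(_ h) /addrI /invr_inj /eqP.
  by rewrite -subr_eq0 addrAC subrr add0r => /eqP.
have Cx : C x = c *: x by apply/eqP; rewrite -subr_eq0 Bx.
have [AC eC] := CR x; rewrite Cx in AC eC.
have [AZ _ _ _] := linear_opP lA.
have [dx ex] := AZ c^-1 _ AC; rewrite scalerA mulVf // scale1r in dx ex.
case/eqP: xn'; apply: (@eigen_perp_eq0 x (m + c^-1)) => //.
rewrite ex -[A _](subrK (m *: (c *: x))) eC scalerDr !scalerA mulrCA.
by rewrite mulVf // mulr1 -scalerDl addrC.
Qed.

End NormalOperator.

(** * Orthonormal families *)

Definition orthonormal_family n (v : 'I_n -> H) := forall i j, dot (v i) (v j) = (i == j)%:R.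

Lemma dot_suml n (c : 'I_n -> R[i]) (v : 'I_n -> H) y :
  dot (\sum_i c i *: v i) y = \sum_i c i * dot (v i) y.
Proof.
rewrite (big_morph (fun x => dot x y) (fun a b => linearDl _ _ _ _) (linear0l _ y)).
by apply: eq_bigr => i _; rewrite linearZl_LR.
Qed.

Lemma orthonormal_coef n (c : 'I_n -> R[i]) (v : 'I_n -> H) j : orthonormal_family v ->
  dot (\sum_i c i *: v i) (v j) = c j.
Proof.
move=> ov; rewrite dot_suml (bigD1 j) //= ov eqxx mulr1 big1 ?addr0 // => i ij.
by rewrite ov (negbTE ij) mulr0.
Qed.

Definition subspace (S : H -> Prop) := S 0 /\ forall a x y, S x -> S y -> S (a *: x + y).

Lemma subspace_sum S n (c : 'I_n -> R[i]) (v : 'I_n -> H) : subspace S ->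
  (forall i, S (v i)) -> S (\sum_i c i *: v i).
Proof.
move=> [S0 SL] Sv; elim/big_rec: _ => // i x _ Sx; exact: SL.
Qed.

Lemma orthonormal_extend n (e : 'I_n -> H) r : orthonormal_family e -> r != 0 ->
  (forall i, dot r (e i) = 0) ->
  orthonormal_family (fun i : 'I_n.+1 => if unlift ord_max i is Some j then e j else (nr r)^-1%:C *: r).
Proof.
move=> oe r0 re i j; have nr0 : 0 < nr r by rewrite nr_gt0.
have er k : dot (e k) r = 0 by rewrite dotC re conjC0.
case: (unliftP ord_max i) => [i'|] ->; case: (unliftP ord_max j) => [j'|] ->;
    rewrite ?liftK ?unlift_none.
- by rewrite oe (inj_eq lift_inj).
- by rewrite linearZr_LR /= er mulr0 eq_sym (negbTE (neq_lift _ _)).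
- by rewrite linearZl_LR /= re mulr0 (negbTE (neq_lift _ _)).
rewrite eqxx linearZr_LR linearZl_LR /= dot_norm nrE.
have -> : ((nr r)^-1%:C)^* = (nr r)^-1%:C by exact: conjc_real.
by rewrite -rmorphXn -!rmorphM /= mulrA -invfM -expr2 mulVf // expf_neq0 ?gt_eqF.
Qed.

(** A family of maximal length spans: a nonzero remainder of a Fourier sum, once normalized, would
    extend it. *)
Lemma orthonormal_basis_ex (S : H -> Prop) (B : nat) : subspace S ->
  (forall n (e : 'I_n -> H), orthonormal_family e -> (forall i, S (e i)) -> (n <= B)%N) ->
  exists n (e : 'I_n -> H), [/\ orthonormal_family e, forall i, S (e i) &
    forall x, S x -> x = \sum_i dot x (e i) *: e i].
Proof.
move=> sS hB; have [S0 SL] := sS.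
pose P n := `[< exists e : 'I_n -> H, orthonormal_family e /\ forall i, S (e i) >].
have P0 : exists n, P n by exists 0%N; apply/asboolP; exists (fun=> 0); split=> -[].
have PB n : P n -> (n <= B)%N by move=> /asboolP[e [oe Se]]; exact: hB oe Se.
case: (ex_maxnP P0 PB) => n /asboolP[e [oe Se]] nmax; exists n, e; split=> // x Sx.
apply: contrapT => /eqP; rewrite -subr_eq0; set r := x - _ => rn.
have Sr : S r.
  rewrite /r addrC -scaleN1r; apply: SL => //; exact: subspace_sum.
have re i : dot r (e i) = 0 by rewrite /r linearBl /= orthonormal_coef // subrr.
have : P n.+1.
  apply/asboolP; exists (fun i : 'I_n.+1 => if unlift ord_max i is Some j then e j else (nr r)^-1%:C *: r).
  split=> [|i]; first exact: orthonormal_extend.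
  case: (unliftP ord_max i) => [j|] _ //.
  by rewrite -[_ *: _]addr0; exact: SL.
by move/nmax; rewrite ltnn.
Qed.

(** If [n < m], the [m] by [n] matrix of coefficients has a nonzero row in its left kernel, which is
    a linear relation between the [e i]. *)
Lemma orthonormal_span_size (S : set H) m (e : 'I_m -> H) n (v : 'I_n -> H) :
  S = [set x | exists c : 'I_n -> R[i], x = \sum_(i < n) c i *: v i] ->
  orthonormal_family e -> (forall i, S (e i)) -> (m <= n)%N.
Proof.
move=> SE oe Se; rewrite leqNgt; apply/negP => nm.
have ex i : exists c : 'I_n -> R[i], e i = \sum_(j < n) c j *: v j by have := Se i; rewrite SE.
have [c hc] := choice ex.
pose M : 'M[R[i]]_(m, n) := \matrix_(i, j) c i j.
have : ~~ row_free M by rewrite /row_free neq_ltn (leq_ltn_trans (rank_leq_col M)).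
rewrite -kermx_eq0 => /rowV0Pn[w /sub_kermxP wM w0].
have : \sum_i w 0 i *: e i = 0.
  under eq_bigr do rewrite hc scaler_sumr.
  rewrite exchange_big big1 // => j _.
  under eq_bigr do rewrite scalerA.
  rewrite -scaler_suml; have /matrixP/(_ 0 j) := wM; rewrite !mxE => wj.
  rewrite (_ : \sum_i _ = 0) ?scale0r // -[RHS]wj.
  by apply: eq_bigr => i _; rewrite mxE.
move=> w_eq0; case/eqP: w0; apply/rowP => k; rewrite mxE.
by rewrite -(orthonormal_coef (fun i => w 0 i) k oe) w_eq0 linear0l.
Qed.

(** * Semigroups *)

Lemma near_norm_ex (f : H -> H) (M : R) : linear f -> (forall x, nr (f x) <= M * nr x) ->
  (exists x, f x != 0) ->
  exists z, nr z = 1 /\ forall y, nr (f y) <= 3 / 2 * nr (f z) * nr y.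
Proof.
move=> lf fM [x0 fx0]; have [f0 fZ fD fB] := lin_facts lf.
have normalize x : x != 0 -> exists2 z, nr z = 1 & nr (f x) = nr (f z) * nr x.
  move=> xn; have nx : 0 < nr x by rewrite nr_gt0.
  exists ((nr x)^-1%:C *: x); first by rewrite nrZ nr_real gtr0_norm ?invr_gt0 // mulVf // gt_eqF.
  by rewrite fZ nrZ nr_real gtr0_norm ?invr_gt0 // mulrAC mulVf ?mul1r // gt_eqF.
have x00 : x0 != 0 by apply: contra_neq fx0 => ->.
pose S := [set r | exists x, nr x = 1 /\ r = nr (f x)].
have [z0 nz0 fz0] := normalize _ x00.
have Sz0 : S (nr (f z0)) by exists z0.
have Sub : has_ubound S by exists M => _ [x [nx ->]]; rewrite -[M]mulr1 -nx.
have Ssup : has_sup S by split=> //; exists (nr (f z0)).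
have Sle x : nr x = 1 -> nr (f x) <= sup S by move=> nx; apply: ub_le_sup => //; exists x.
have s0 : 0 < sup S.
  apply: lt_le_trans (Sle _ nz0); rewrite nr_gt0; apply: contra_neq fx0 => fz.
  by apply/eqP; rewrite -nr_eq0 fz0 fz nr0 mul0r.
(* [|f z|] exceeds two thirds of the supremum, hence the factor [3 / 2]. *)
have [|_ [z [nz ->]] hz] := @sup_adherent _ S (sup S / 3) _ Ssup; first by rewrite divr_gt0.
exists z; split=> // y; have [->|yn] := eqVneq y 0; first by rewrite f0 !nr0 mulr0.
have [w nw ->] := normalize _ yn; rewrite ler_wpM2r ?nr_ge0 //.
by have := Sle _ nw; lra.
Qed.

(* Gliding hump, after Sokal: a step of length [3^-n] in a direction nearly maximizing
   [T (i n)], with the sign making the image longer, cannot be undone by the later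
   steps. *)
Lemma uniform_boundedness (I : Type) (D : set I) (T : I -> H -> H) :
  (forall i, D i -> linear (T i) /\ exists M, forall x, nr (T i x) <= M * nr x) ->
  (forall x, exists B, forall i, D i -> nr (T i x) <= B) ->
  exists2 M : R, 0 < M & forall i, D i -> forall x, nr (T i x) <= M * nr x.
Proof.
move=> TL Tp; apply: contrapT => nM.
have ex n : exists p : I * H, [/\ D p.1, nr p.2 = 1, 2 / 3 * 4 ^+ n <= nr (T p.1 p.2) &
    forall y, nr (T p.1 y) <= 3 / 2 * nr (T p.1 p.2) * nr y].
  have [i [Di [x hx]]] : exists i, D i /\ exists x, 4 ^+ n * nr x < nr (T i x).
    apply: contrapT => h; apply: nM; exists (4 ^+ n); first by rewrite exprn_gt0.
    move=> i Di x; rewrite leNgt; apply/negP => hx; apply: h; exists i; split=> //.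
    by exists x.
  have [lT [M TM]] := TL _ Di; have [T0 _ _ _] := lin_facts lT.
  have Tx : T i x != 0 by rewrite -nr_gt0 (le_lt_trans _ hx) // mulr_ge0 ?nr_ge0 ?exprn_ge0.
  have nx : 0 < nr x.
    by rewrite nr_gt0; apply: contra_neq Tx => ->.
  have [z [nz hz]] := near_norm_ex lT TM (ex_intro _ x Tx).
  exists (i, z); split=> //=; have := lt_le_trans hx (hz x).
  by rewrite ltr_pM2r // => h; lra.
have [p hp] := choice ex.
pose step n x := let z := (3 ^- n)%:C *: (p n).2 in
  if nr (T (p n).1 z) <= nr (T (p n).1 (x + z)) then x + z else x - z.
pose x := fix x n := if n is n'.+1 then step n' (x n') else 0.
have e3 n : 0 < 3 ^- n :> R by rewrite invr_gt0 exprn_gt0.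
have xS n : nr (x n.+1 - x n) = 3 ^- n.
  have [_ nz _ _] := hp n.
  rewrite /= /step; case: ifP => _; rewrite [_ - x n]addrAC subrr add0r ?nrN nrZ nr_real gtr0_norm //;
  by rewrite nz mulr1.
have xT n : 3 ^- n * nr (T (p n).1 (p n).2) <= nr (T (p n).1 (x n.+1)).
  have [Di nz _ _] := hp n; have [lT _] := TL _ Di; have [T0 TZ TD TB] := lin_facts lT.
  have -> : 3 ^- n * nr (T (p n).1 (p n).2) = nr (T (p n).1 ((3 ^- n)%:C *: (p n).2)).
    by rewrite TZ nrZ nr_real gtr0_norm.
  rewrite /= /step; case: ifPn => //; rewrite -ltNge => h.
  move: h; set z := _ *: _; rewrite TD TB => h.
  rewrite -(ler_pXn2r (n := 2)) ?nnegrE ?nr_ge0 //.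
  have := parallelogram (T (p n).1 (x n)) (T (p n).1 z).
  have : nr (T (p n).1 (x n) + T (p n).1 z) ^+ 2 <= nr (T (p n).1 z) ^+ 2.
    by rewrite ler_pXn2r ?nnegrE ?nr_ge0 // ltW.
  by have := sqr_ge0 (nr (T (p n).1 (x n))); lra.
have xdist n k : nr (x (n + k)%N - x n) <= 3 / 2 * (3 ^- n - 3 ^- (n + k)).
  elim: k => [|k IH]; first by rewrite addn0 !subrr nr0 mulr0.
  rewrite addnS (le_trans (nr_dist (x (n + k)%N) _ _)) // xS.
  have -> : 3 ^- (n + k).+1 = 3 ^- (n + k) / 3 :> R by rewrite exprSr invfM.
  by lra.
have [e e0|l hl] := @complete_nr x.
  have [k hk] := @expr_unbounded 3 (3 / e) ltac:(lra).
  have ke : 3 * 3 ^- k < e by rewrite ltr_pdivrMr ?exprn_gt0 // mulrC -ltr_pdivrMr.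
  have xk n : (k <= n)%N -> nr (x n - x k) <= 3 / 2 * 3 ^- k.
    move=> kn; rewrite -(subnKC kn) (le_trans (xdist _ _)) // ler_wpM2l ?divr_ge0 //.
    by rewrite lerBlDr lerDl ltW.
  exists k => n m kn km; rewrite (le_lt_trans (nr_dist (x k) _ _)) // (nrBC (x k)).
  by have := xk _ kn; have := xk _ km; lra.
have lx n : nr (l - x n) <= 3 / 2 * 3 ^- n.
  apply/ler_addgt0Pl => e /hl[n0 hn0]; have := hn0 _ (leq_addl n n0); have := xdist n n0.
  move=> h1 h2; have := nr_dist (x (n + n0)%N) l (x n); rewrite (nrBC l (x (n + n0)%N)).
  by have := e3 (n + n0)%N; lra.
have [B hB] := Tp l.
(* The later steps have total length at most [3 / 2 * 3^-(n+1) = 3^-n / 2]. They move the image by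
   at most three quarters of [3^-n |T z|], so one quarter survives at the limit [l]. *)
have low n : 3 ^- n * nr (T (p n).1 (p n).2) / 4 <= B.
  have [Di nz _ hy] := hp n; have [lT _] := TL _ Di; have [T0 TZ TD TB] := lin_facts lT.
  have := hB _ Di; have := hy (l - x n.+1); rewrite TB.
  have := nr_subr (T (p n).1 (x n.+1)) (T (p n).1 l); rewrite (nrBC _ (T _ l)).
  have := xT n; have := lx n.+1.
  have -> : 3 ^- n.+1 = 3 ^- n / 3 :> R by rewrite exprSr invfM.
  have a0 := nr_ge0 (T (p n).1 (p n).2).
  move=> h1; have := ler_wpM2l (mulr_ge0 (ltac:(lra) : 0 <= 3 / 2 :> R) a0) h1.
  by lra.
(* With the growth [2 / 3 * 4^k] built into the choice of [p], [low] gives [(4 / 3)^k / 6 <= B] for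
   every [k]. *)
have [k hk] := @expr_unbounded (4 / 3) (6 * B) ltac:(lra).
have [_ _ h4 _] := hp k; have := low k.
have := ler_wpM2l (ltW (e3 k)) h4.
have -> : 3 ^- k * (2 / 3 * 4 ^+ k) = 2 / 3 * (4 / 3) ^+ k :> R.
  by rewrite expr_div_n mulrCA [_ / 3 ^+ k]mulrC.
by lra.
Qed.

Lemma semigroup_continuousP (T : R -> H -> H) x :
  {within `[0, +oo[, continuous (fun t => T t x)} <->
  forall t, 0 <= t -> forall e : R, 0 < e -> exists2 d : R, 0 < d &
    forall s, 0 <= s -> `|s - t| < d -> nr (T s x - T t x) < e.
Proof.
split=> [/subspace_continuousP h t t0 e e0|h].
  have := h t; rewrite /= in_itv /= andbT => /(_ t0) /cvg_nrP /(_ e e0).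
  rewrite /= near_withinE => /nbhs_ballP[d /= d0 hd]; exists d => // s s0 st.
  by apply: hd; rewrite /= ?in_itv /= ?s0 // /ball /= distrC.
apply/subspace_continuousP => t; rewrite /= in_itv /= andbT => t0; apply/cvg_nrP => e e0.
have [d d0 hd] := h t t0 e e0; rewrite /= near_withinE; apply/nbhs_ballP; exists d => //.
by move=> s; rewrite /ball /= distrC => st; rewrite in_itv /= andbT => s0; exact: hd.
Qed.

Lemma generatorP (T : R -> H -> H) x y :
  (op_dom (generator T) x /\ generator T x = y) <->
  forall e : R, 0 < e -> exists2 d : R, 0 < d &
    forall h, 0 < h -> h < d -> nr ((h^-1)%:C *: (T h x - x) - y) < e.
Proof.
have cvgP z : (h^-1)%:C *: (T h x - x) @[h --> 0^'+] --> z <->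
    forall e : R, 0 < e -> exists2 d : R, 0 < d &
    forall h, 0 < h -> h < d -> nr ((h^-1)%:C *: (T h x - x) - z) < e.
  split=> [/cvg_nrP hz e /hz|hz].
    rewrite near_withinE => /nbhs_ballP[d /= d0 hd]; exists d => // h h0 hd'.
    by apply: hd; rewrite //= /ball /= sub0r normrN gtr0_norm.
  apply/cvg_nrP => e /hz[d d0 hd]; rewrite near_withinE; apply/nbhs_ballP; exists d => //.
  by move=> h; rewrite /ball /= sub0r normrN => hd' h0; apply: hd; rewrite // -(gtr0_norm h0).
split=> [[c <-]|/cvgP hc]; first exact/cvgP.
split; first by apply/cvg_ex; exists y.
exact: (cvg_lim (@norm_hausdorff _ _) hc).
Qed.

(** The orbit of each [x] over [[0, t]] is compact by strong continuity, hence bounded, and uniform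
    boundedness applies. *)
Lemma semigroup_bounded (T : R -> H -> H) (t : R) : C0_semigroup T ->
  exists2 M : R, 0 < M & forall s, 0 <= s <= t -> forall x, nr (T s x) <= M * nr x.
Proof.
move=> [TL T0 TD Tc].
apply: (@uniform_boundedness R [set s | 0 <= s <= t] T) => [s /andP[s0 _]|x].
  have [lT cT] := TL _ s0; split=> //.
  by have [M _ hM] := (lin_nrP lT).1 cT; exists M.
apply: contrapT => nB.
have ex n : exists s, (0 <= s <= t) /\ n%:R < nr (T s x).
  apply: contrapT => h; apply: nB; exists n%:R => s st.
  by rewrite leNgt; apply/negP => hs; apply: h; exists s.
have [s hs] := choice ex.
have cK : compact ((fun t => T t x) @` `[0, t]).
  apply: continuous_compact; last exact: segment_compact.
  apply: continuous_subspaceW (Tc x) => u /=; rewrite !in_itv /=.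
  by move=> /andP[-> _].
have [n|l _ hl] := compact_cluster_seq cK (u := fun n => T (s n) x).
  by exists (s n) => //=; rewrite in_itv /=; case: (hs n).
have [n n0 hn] := hl 1 ltr01 (Num.truncn (nr l + 1)).+1.
have [_ h1] := hs n.
have h2 : nr l + 1 < n%:R by rewrite (lt_le_trans (truncnS_gt _)) // ler_nat.
by have := nr_subr (T (s n) x) l; lra.
Qed.

(** The estimate suggested by writing [U t x - x] as the integral of [U s y], obtained without an
    integral: for [h = t / (n + 1)] the difference is the sum of the terms [U (k h) (U h x - x)],
    each at most [M h (|y| + e)]. *)
Lemma telescoping (U : R -> H -> H) (t M : R) x y : 0 <= t -> 0 <= M ->
  (forall s, 0 <= s -> linear (U s)) -> (forall x, U 0 x = x) ->
  (forall s r x, 0 <= s -> 0 <= r -> U (s + r) x = U s (U r x)) ->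
  (forall s, 0 <= s <= t -> forall z, nr (U s z) <= M * nr z) ->
  (forall e : R, 0 < e -> exists2 d : R, 0 < d &
    forall h, 0 < h -> h < d -> nr ((h^-1)%:C *: (U h x - x) - y) < e) ->
  nr (U t x - x) <= t * M * nr y.
Proof.
move=> t0 M0 UL U0 UD UM Uq.
have [->|tn] := eqVneq t 0; first by rewrite U0 subrr nr0 !mul0r.
have {tn}t0' : 0 < t by rewrite lt0r tn.
suff h e : 0 < e -> nr (U t x - x) <= t * M * (nr y + e).
  apply/ler_addgt0Pr => e e0; have K0 : 0 < t * M + 1 by rewrite ltr_wpDl ?mulr_ge0.
  have := h _ (divr_gt0 e0 K0).
  have : t * M * (e / (t * M + 1)) <= e.
    rewrite mulrCA -[leRHS]mulr1 ler_wpM2l ?(ltW e0) // ler_pdivrMr // mul1r.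
    by rewrite lerDl.
  by rewrite mulrDr; lra.
move=> e0; have [d d0 hd] := Uq _ e0.
have [n hn] : exists n, t / n.+1%:R < d.
  have [n0 h] := invS_small (divr_gt0 d0 t0'); exists n0.
  by rewrite mulrC -ltr_pdivlMr // h.
pose h := t / n.+1%:R; have h0 : 0 < h by rewrite divr_gt0 // ltr0n.
have q := hd h h0 hn.
have nq : nr (U h x - x) <= h * (nr y + e).
  have -> : nr (U h x - x) = h * nr (h^-1%:C *: (U h x - x)).
    by rewrite nrZ nr_real gtr0_norm ?invr_gt0 // mulrA divff ?mul1r // gt_eqF.
  rewrite ler_pM2l //; have := nr_subr (h^-1%:C *: (U h x - x)) y; lra.
have step k : (k <= n.+1)%N -> nr (U (k%:R * h) x - x) <= k%:R * (M * nr (U h x - x)).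
  elim: k => [|k IH] kn; first by rewrite !mul0r U0 subrr nr0.
  have kh : 0 <= k%:R * h by rewrite mulr_ge0 // ltW.
  have -> : k.+1%:R * h = k%:R * h + h by rewrite -natr1 mulrDl mul1r.
  rewrite UD ?(ltW h0) // (le_trans (nr_dist (U (k%:R * h) x) _ _)) //.
  have [_ _ _ UB] := lin_facts (UL _ kh); rewrite -UB.
  rewrite -natr1 mulrDl mul1r addrC lerD ?IH 1?ltnW // UM // kh /=.
  rewrite /h mulrCA ler_piMr ?(ltW t0') // ler_pdivrMr ?ltr0n // mul1r ler_nat.
  exact: ltnW.
have := step n.+1 (leqnn _); rewrite /h mulrC divfK ?pnatr_eq0 // -/h => h1.
rewrite (le_trans h1) // mulrA (le_trans (ler_wpM2l _ nq)) ?mulr_ge0 //.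
have -> : n.+1%:R * M * (h * (nr y + e)) = t * M * (nr y + e).
  have : n.+1%:R != 0 :> R by rewrite pnatr_eq0.
  by rewrite /h; move: (n.+1%:R) => N N0; field.
by [].
Qed.

(** * The complex exponential *)

Definition cexp (z : R[i]) : R[i] :=
  (expR (complex.Re z) * cos (complex.Im z)) +i* (expR (complex.Re z) * sin (complex.Im z)).

Lemma cexp0 : cexp 0 = 1.
Proof. by rewrite /cexp /= expR0 cos0 sin0 mulr1 mulr0. Qed.

Lemma cexpD z w : cexp (z + w) = cexp z * cexp w.
Proof.
case: z w => a b [c d]; rewrite /cexp /= expRD cosD sinD; apply/eqP; rewrite eq_complex /=.
by apply/andP; split; apply/eqP; ring.
Qed.

Lemma nr_cexp z : nr (cexp z) = expR (complex.Re z).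
Proof.
rewrite /nr normc_def /= !exprMn -mulrDr cos2Dsin2 mulr1 sqrtr_sqr ger0_norm // expR_ge0.
Qed.

Lemma lipschitz1 (f df : R -> R) (x : R) : (forall x : R, is_derive x 1 f (df x)) ->
  (forall x, `|df x| <= 1) -> continuous f -> `|f x - f 0| <= `|x|.
Proof.
move=> fd df1 fc; have [x0|x0] := leP 0 x.
  have [c _ ->] := MVT_segment x0 (fun y _ => fd y) (continuous_subspaceT fc).
  by rewrite normrM subr0 ler_piMl.
have [c _ h] := MVT_segment (ltW x0) (fun y _ => fd y) (continuous_subspaceT fc).
by rewrite distrC h normrM sub0r normrN ler_piMl.
Qed.

(** The factor 3 counts the differences [expR a - 1], [cos b - 1] and [sin b]; the maximum with 0
    covers both signs of the real part. *)
Lemma cexp_sub1_le z : nr (cexp z - 1) <= 3 * nr z * expR (Num.max 0 (complex.Re z)).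
Proof.
case: z => a b; set m := Num.max 0 _; rewrite /= in m *.
have m1 : 1 <= expR m by rewrite -expR0 ler_expR /m le_max lexx.
have am : expR a <= expR m by rewrite ler_expR /m le_max lexx orbT.
have ea : `|expR a - 1| <= `|a| * expR m.
  have [a0|a0] := leP 0 a.
    rewrite ger0_norm ?subr_ge0 -?expR0 ?ler_expR // expR0 (ger0_norm a0).
    have h1 := expR_ge1Dx (- a); have e0 := expR_ge0 a.
    have : expR a * (1 + - a) <= 1.
      by rewrite (le_trans (ler_wpM2l e0 h1)) // expRN divff // gt_eqF ?expR_gt0.
    by have := ler_wpM2l a0 am; lra.
  rewrite ler0_norm ?subr_le0 -?expR0 ?ler_expR ?(ltW a0) // expR0 (ltr0_norm a0).
  by have := expR_ge1Dx a; have := ler_wpM2l (ltW (_ : 0 < - a)) m1; rewrite oppr_gt0 => /(_ a0); lra.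
have sb : `|sin b| <= `|b|.
  have := lipschitz1 b (@is_derive_sin R) (@cos_max R) (@continuous_sin R).
  by rewrite sin0 subr0.
have cb : `|cos b - 1| <= `|b|.
  rewrite -cos0; apply: (lipschitz1 b (@is_derive_cos R)); last exact: continuous_cos.
  by move=> x; rewrite normrN; exact: sin_max.
have -> : cexp (a +i* b) - 1 =
   (expR a * cos b - 1) +i* (expR a * sin b).
  by rewrite /cexp /=; apply/eqP; rewrite eq_complex /= subr0 !eqxx.
rewrite (le_trans (nr_complex_le _ _)) //.
have -> : expR a * cos b - 1 = (expR a - 1) + expR a * (cos b - 1) by ring.
have h1 : `|expR a * (cos b - 1)| <= expR m * `|b|.
  by rewrite normrM (ger0_norm (expR_ge0 _)) ler_pM ?expR_ge0.
have h2 : `|expR a * sin b| <= expR m * `|b|.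
  by rewrite normrM (ger0_norm (expR_ge0 _)) ler_pM ?expR_ge0.
have := ler_normD (expR a - 1) (expR a * (cos b - 1)).
have em := expR_ge0 m.
have := ler_wpM2r em (Re_le_nr (a +i* b)); have := ler_wpM2r em (Im_le_nr (a +i* b)).
by rewrite /=; lra.
Qed.

Lemma cexp_quotient (z : R[i]) (e : R) : 0 < e -> exists2 d : R, 0 < d &
  forall h, 0 < h -> h < d -> nr (h^-1%:C * (cexp (h%:C * z) - 1) - z) < e.
Proof.
case: z => a b e0.
have dq (f : R -> R) df : is_derive (0 : R) 1 f df -> exists2 d : R, 0 < d &
    forall h, 0 < h -> h < d -> `|h^-1 * (f h - f 0) - df| < e / 2.
  move=> [dfc dfv]; rewrite /derivable in dfc.
  move: dfv; rewrite /derive => dfv.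
  have /cvgrPdist_lt/(_ (e / 2)) := dfc; rewrite dfv divr_gt0 // => /(_ isT).
  rewrite /dnbhs near_withinE => /nbhs_ballP[d /= d0 hd]; exists d => // h h0 hd'.
  have := hd h; rewrite /ball /= sub0r normrN gtr0_norm // => /(_ hd').
  by rewrite gt_eqF // => /(_ isT); rewrite distrC /= addr0 scaler1.
have d1 : is_derive (0 : R) 1 (fun t => expR (t * a) * cos (t * b)) a.
  apply: is_derive_eq; rewrite !mul0r expR0 cos0 sin0 oppr0 !mul0r !scaler0 !add0r.
  by rewrite /GRing.scale /= !mulr1 !mul1r.
have d2 : is_derive (0 : R) 1 (fun t => expR (t * a) * sin (t * b)) b.
  apply: is_derive_eq; rewrite !mul0r expR0 cos0 sin0 !scaler0 !add0r.
  by rewrite /GRing.scale /= !mul0r !mulr1 !mul1r addr0.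
have [g1 g10 h1] := dq _ _ d1; have [g2 g20 h2] := dq _ _ d2.
exists (Num.min g1 g2); first by rewrite lt_min g10.
move=> h h0; rewrite lt_min => /andP[hg1 hg2].
have {h1} := h1 h h0 hg1; have {h2} := h2 h h0 hg2.
rewrite !mul0r expR0 cos0 sin0 mulr1 mulr0 subr0 => h2 h1.
have -> : h^-1%:C * (cexp (h%:C * (a +i* b)%C) - 1) - (a +i* b)%C =
    ((h^-1 * (expR (h * a) * cos (h * b) - 1) - a) +i*
     (h^-1 * (expR (h * a) * sin (h * b)) - b))%C.
  apply/eqP; rewrite eq_complex /= !mul0r !subr0 !addr0; apply/andP; split; apply/eqP; ring.
by rewrite (le_lt_trans (nr_complex_le _ _)) // [e]splitr ltrD.
Qed.

Lemma compact_op_compact (f : H -> H) : compact_op f ->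
  exists2 K : set H, compact K & forall x, nr x <= 1 -> K (f x).
Proof.
move=> [_ /(_ [set x | nr x <= 1])] [].
  exists 1; split; first exact: real1.
  by move=> M M1 x /= x1; rewrite (le_trans _ (ltW M1)) // nrE lecR.
by move=> K fK [cK _]; exists K => // x x1; apply: fK; exists x.
Qed.

(** Pigeonhole over a finite cover by balls of radius [r / 2]. *)
Lemma compact_totally_bounded (K : set H) (r : R) : compact K -> 0 < r ->
  exists B : nat, forall n (u : 'I_n -> H), (forall i, K (u i)) ->
    (forall i j, i != j -> r <= nr (u i - u j)) -> (n <= B)%N.
Proof.
rewrite compact_cover => cK r0.
have [p _|x Kx|D _ KD] := cK H K (fun p => [set y | nr (y - p) < r / 2]).
- rewrite openE => y /= yp; apply/nbhs_nrP; exists (r / 2 - nr (y - p)); first by rewrite subr_gt0.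
  by move=> z /= zy; rewrite (le_lt_trans (nr_dist y _ _)) // -ltrBrDr.
- by exists x => //=; rewrite subrr nr0 divr_gt0.
have /finite_seqP[s Ds] := finite_fset D; exists (size s) => n u uK ur.
have ex i : exists k : 'I_(size s), nr (u i - nth 0 s k) < r / 2.
  have [p] := KD _ (uK i); rewrite Ds => /= ps up.
  have ks : (index p s < size s)%N by rewrite index_mem.
  by exists (Ordinal ks); rewrite /= nth_index.
have [d hd] := choice ex.
rewrite -[n]card_ord -[size s]card_ord; apply: (@leq_card _ _ d) => i j dij.
apply/eqP/negP => /negP /ur.
rewrite leNgt => /negP; apply; rewrite (le_lt_trans (nr_dist (nth 0 s (d i)) _ _)) //.
by rewrite [r]splitr ltrD ?hd // dij nrBC hd.
Qed.

Lemma finite_set_separated (F : set R[i]) (l : R[i]) : finite_set F ->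
  exists2 r : R, 0 < r & forall z, F z -> nr (z - l) < r -> z = l.
Proof.
move=> /finite_seqP[s ->]; elim: s => [|a s [r r0 IH]]; first by exists 1.
have [->|al] := eqVneq a l.
  exists r => // z; rewrite /= inE => /orP[/eqP->//|zs]; exact: IH.
exists (Num.min r (nr (a - l))); first by rewrite lt_min r0 nr_gt0 subr_eq0.
move=> z; rewrite /= inE lt_min => /orP[/eqP-> /andP[_]|zs /andP[zr _]]; first by rewrite ltxx.
exact: IH.
Qed.

Lemma normal_total (f g : H -> H) (M : R) : linear f -> 0 < M ->
  (forall x, nr (f x) <= M * nr x) -> adjoint_pair f g -> (forall x, f (g x) = g (f x)) ->
  normal_op dot (total_op f).
Proof.
move=> lf M0 fM fg comm; have [f0 fZ fD fB] := lin_facts lf.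
have lA : linear_op (total_op f) by split=> // a x y _ _; split=> //=; exact: lf.
have adjE y : op_dom (adjoint_op dot (total_op f)) y /\ adjoint_op dot (total_op f) y = g y.
  by apply/(adjointP lA dense_setT) => x _; exact: fg.
split=> //; first exact: dense_setT.
  apply/closed_graph_nrP => x y xy; split=> //=; apply/eqP; rewrite -subr_eq0 -nr_eq0.
  apply/eqP/(@eq0_small _ (M + 1)) => e /xy[z [_ /= zx zy]].
  rewrite ger0_norm ?nr_ge0 // (le_trans (nr_dist (f z) _ _)) // mulrDr mulr1 lerD // ?(ltW zy) //.
  by rewrite -fB (le_trans (fM _)) // mulrC nrBC ler_wpM2r // ltW.
split=> [|x _].
  by apply/seteqP; split=> x [? ?]; split=> //; case: (adjE (f x)); case: (adjE x).
have -> : op_comp (adjoint_op dot (total_op f)) (total_op f) x = g (f x) by case: (adjE (f x)).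
by rewrite -comm -(proj2 (adjE x)).
Qed.

Lemma op_eigenvalue_spectrum (A : partial_op H) (l : R[i]) x : linear_op A ->
  x != 0 -> op_dom A x -> A x = l *: x -> spectrum A l.
Proof.
move=> lA x0 Ax ex [S [_ _ SA]]; case/eqP: x0.
by rewrite -(SA x Ax) ex subrr (linear0 S).
Qed.

(** * Immediately compact semigroups with normal generator *)

Section CompactSemigroup.
Variable A : partial_op H.
Hypothesis A_normal : normal_op dot A.
Variable T : R -> H -> H.
Hypotheses (T_C0 : C0_semigroup T) (T_compact : immediately_compact T).
Hypothesis A_gen : op_eq A (generator T).

Let lA : linear_op A. Proof. by case: A_normal. Qed.

Let genP x : op_dom A x -> forall e : R, 0 < e -> exists2 d : R, 0 < d &
  forall h, 0 < h -> h < d -> nr ((h^-1)%:C *: (T h x - x) - A x) < e.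
Proof.
move=> Ax; case: A_gen => dE vE; apply/generatorP.
by rewrite -vE // -dE.
Qed.

(** [U s = exp (- s l) T s] is a semigroup whose generator acts on [x] as [A - l], so telescoping
    applies to it. Approximate eigenvectors of [A] thereby become approximate eigenvectors of [T t],
    and exact ones stay exact. *)
Lemma semigroup_shift_bound (t : R) (l : R[i]) : 0 <= t -> exists2 K : R, 0 < K &
  forall x, op_dom A x -> nr (cexp (- (t%:C * l)) *: T t x - x) <= K * nr (A x - l *: x).
Proof.
move=> t0; have [TL T0 TD _] := T_C0.
have [M M0 hM] := semigroup_bounded t T_C0.
(* Bounds [|exp (- s l)|] for [0 <= s <= t], whatever the sign of the real part of [l]. *)
pose m := expR (Num.max 0 (t * - complex.Re l)).
have m0 : 0 < m by exact: expR_gt0.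
exists (t * (m * M) + 1); first by rewrite ltr_wpDl // !mulr_ge0 // ltW.
move=> x Ax.
pose U s y := cexp (- (s%:C * l)) *: T s y.
apply: (@le_trans _ _ (t * (m * M) * nr (A x - l *: x))); last first.
  by rewrite ler_wpM2r ?nr_ge0 // lerDl.
apply: (@telescoping U) => //; first by rewrite mulr_ge0 // ltW.
- move=> s s0 a y z; have [lT _] := TL s s0.
  by rewrite /U lT scalerDr !scalerA mulrC.
- by move=> y; rewrite /U T0 mul0r oppr0 cexp0 scale1r.
- move=> s r y s0 r0; have [lT _] := TL s s0; have [_ TZ _ _] := lin_facts lT.
  by rewrite /U TZ TD // scalerA rmorphD /= mulrDl opprD cexpD.
- move=> s /andP[s0 st] y; rewrite /U nrZ nr_cexp -mulrA ler_pM ?expR_ge0 ?nr_ge0 ?hM ?s0 //.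
  rewrite ler_expR; have -> : complex.Re (- (s%:C * l)) = s * - complex.Re l.
    by case: (l) => a b /=; rewrite mul0r subr0 mulrN.
  have [lp|ln] := leP 0 (- complex.Re l); rewrite le_max; apply/orP; [right|left].
    exact: ler_wpM2r.
  by rewrite mulr_ge0_le0 // ltW.
move=> e e0.
pose a := 1 + nr (A x); have a0 : 0 < a by rewrite ltr_wpDr ?nr_ge0.
have e8 : 0 < Num.min 1 (e / 8) by rewrite lt_min ltr01 divr_gt0.
have [d1 d10 h1] := genP Ax e8.
have [d2 d20 h2] := @cexp_quotient (- l) (Num.min 1 (e / (8 * (nr x + 1))))
  ltac:(by rewrite lt_min ltr01 divr_gt0 // mulr_gt0 // ltr_wpDl ?nr_ge0).
pose c := nr l + 1; have c0 : 0 < c by rewrite ltr_wpDl ?nr_ge0.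
have [d3 d30 d3E] : exists2 d3, 0 < d3 & d3 = e / (8 * c * a).
  by exists (e / (8 * c * a)); rewrite // divr_gt0 ?mulr_gt0.
exists (Num.min d3 (Num.min d1 d2)); first by rewrite !lt_min d30 d10 d20.
move=> h h0; rewrite !lt_min => /andP[hc /andP[hd1 hd2]].
have {h1} := h1 h h0 hd1; rewrite lt_min => /andP[h1 h4]; have {h2} := h2 h h0 hd2; rewrite lt_min => /andP[h2 h3].
rewrite /U mulrN in h2 h3 *.
set w := cexp _ in h2 h3 *.
set q := h^-1%:C *: (T h x - x) in h1 h4.
have hh : h^-1%:C * h%:C = 1 :> R[i] by rewrite -rmorphM /= mulVf ?gt_eqF.
(* The product rule for difference quotients; each of the three terms on the right has norm at most
   [e / 8]. *)
have -> : h^-1%:C *: (w *: T h x - x) - (A x - l *: x) =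
    (w - 1) *: q + (q - A x) + (h^-1%:C * (w - 1) - - l) *: x.
  rewrite addrA scalerBl scale1r subrK scalerBl scaleNr opprK scalerBr.
  rewrite [w *: q]scalerA mulrC -scalerA /q scalerBr mulrBr mulr1 scalerBl.
  rewrite scalerBr !scalerA opprD opprK addrA [_ - _ - A x]addrAC.
  by rewrite [_ - _ *: x - A x]addrAC [RHS]addrA subrKA.
have nw : nr (w - 1) <= h * c.
  have -> : nr (w - 1) = h * nr (h^-1%:C * (w - 1)).
    by rewrite nrM nr_real gtr0_norm ?invr_gt0 // mulrA divff ?mul1r // gt_eqF.
  rewrite ler_pM2l //; have := nr_subr (h^-1%:C * (w - 1)) (- l); rewrite nrN /c; lra.
have nq : nr q <= a by have := nr_subr q (A x); rewrite /a; lra.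
have h5 : nr (w - 1) * nr q <= e / 8.
  apply: (@le_trans _ _ (h * c * a)); first by rewrite ler_pM ?nr_ge0.
  by move: hc; rewrite d3E ltr_pdivlMr ?mulr_gt0 // => hc; rewrite ler_pdivlMr //; lra.
have h6 : nr (h^-1%:C * (w - 1) - - l) * nr x <= e / 8.
  have K0 : 0 < nr x + 1 by rewrite ltr_wpDl ?nr_ge0.
  rewrite (le_trans (ler_wpM2r (nr_ge0 x) (ltW h3))) //.
  rewrite mulrAC ler_pdivrMr ?mulr_gt0 //.
  lra.
have := nrD ((w - 1) *: q + (q - A x)) ((h^-1%:C * (w - 1) - - l) *: x).
by have := nrD ((w - 1) *: q) (q - A x); rewrite (nrZ _ q) (nrZ _ x); lra.
Qed.

Lemma cexpNK z : cexp z * cexp (- z) = 1.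
Proof. by rewrite -cexpD subrr cexp0. Qed.

Lemma semigroup_eigen (t : R) (l : R[i]) x : 0 <= t -> op_dom A x -> A x = l *: x ->
  T t x = cexp (t%:C * l) *: x.
Proof.
move=> t0 Ax ex; have [K _ hK] := semigroup_shift_bound l t0.
have := hK x Ax; rewrite ex subrr nr0 mulr0 => h.
have /eqP : nr (cexp (- (t%:C * l)) *: T t x - x) = 0 by apply/eqP; rewrite eq_le h nr_ge0.
rewrite nr_eq0 subr_eq0 => /eqP {2}<-.
by rewrite scalerA cexpNK scale1r.
Qed.

Let T1_compact : exists2 K : set H, compact K & forall x, nr x <= 1 -> K (T 1 x).
Proof. exact/compact_op_compact/T_compact. Qed.

Lemma semigroup_approx_eigenvalue N (l : R[i]) : closed_subspace N ->
  op_approx_eigenvalue A N l -> exists x, [/\ N x, x != 0, op_dom A x & A x = l *: x].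
Proof.
move=> Nc aA; have [N0 NL Ncl] := Nc; have [AZ _ _ _] := linear_opP lA.
have ex n : exists x, [/\ N x, op_dom A x, nr x = 1 & nr (A x - l *: x) <= n.+1%:R^-1].
  have [x [Nx Ax xn hx]] := aA n.+1%:R^-1 ltac:(by rewrite invr_gt0 ltr0n).
  have nx : 0 < nr x by rewrite nr_gt0.
  have [d e] := AZ (nr x)^-1%:C _ Ax; exists ((nr x)^-1%:C *: x).
  have nn : nr (nr x)^-1%:C = (nr x)^-1 by rewrite nr_real gtr0_norm ?invr_gt0.
  split=> //; first exact: closed_subspaceZ.
    by rewrite nrZ nn mulVf ?gt_eqF.
  by rewrite e scalerA mulrC -scalerA -scalerBr nrZ nn mulrC ler_pdivrMr.
have [u hu] := choice ex.
have [K cK hK] := T1_compact.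
have [M M0 hM] := semigroup_shift_bound l ler01.
have [n|p _ hp] := compact_cluster_seq cK (u := fun n => T 1 (u n)).
  by apply: hK; have [_ _ -> _] := hu n.
(* [u n] is close to [w *: T 1 (u n)], so a cluster point [p] of the images gives the cluster point
   [w *: p] of the [u n]. *)
pose w := cexp (- (1%:C * l)); pose q := w *: p.
have near_q e : 0 < e -> exists n, nr (u n - q) < e /\ nr (A (u n) - l *: u n) < e.
  move=> e0.
  have M2 : 0 < Num.min e (e / (2 * M)) by rewrite lt_min e0 divr_gt0 ?mulr_gt0.
  have [n0 hn0] := invS_small M2.
  have w0 : 0 < nr w + 1 by rewrite ltr_wpDl ?nr_ge0.
  have [n n0n hn] := hp (e / (2 * (nr w + 1))) ltac:(by rewrite divr_gt0 ?mulr_gt0) n0.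
  have [Nu Au nu hAu] := hu n; exists n.
  have := le_lt_trans hAu (hn0 _ n0n); rewrite lt_min => /andP[-> hA]; split=> //.
  rewrite (le_lt_trans (nr_dist (w *: T 1 (u n)) _ _)) // (nrBC (u n)) [e]splitr ltr_leD //.
    rewrite (le_lt_trans (hM _ Au)) // mulrC -ltr_pdivlMr //.
    by rewrite -mulrA -invfM.
  rewrite /q -scalerBr nrZ (le_trans (ler_wpM2l (nr_ge0 w) (ltW hn))) //.
  by rewrite mulrA ler_pdivrMr ?mulr_gt0 //; lra.
have q1 : nr q = 1.
  apply/eqP; rewrite -subr_eq0; apply/eqP/(@eq0_small _ 1) => e /near_q[n [hn _]]; rewrite mulr1.
  have [_ _ nu _] := hu n; rewrite -nu.
  have := nr_subr q (u n); have := nr_subr (u n) q; rewrite (nrBC q) => h1 h2.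
  by rewrite ler_norml; apply/andP; split; lra.
have Nq : N q.
  by apply: Ncl => e /near_q[n [hn _]]; exists (u n) => //; case: (hu n).
have cA : closed (op_graph A) by case: A_normal.
have [Aq eq] : op_dom A q /\ A q = l *: q.
  move/closed_graph_nrP: cA => cA; apply: cA => e e0.
  have K0 : 0 < nr l + 1 by rewrite ltr_wpDl ?nr_ge0.
  have e1 : e / (nr l + 1) <= e by rewrite ler_pdivrMr // ler_peMr ?(ltW e0) // lerDr nr_ge0.
  have [n [hn hA]] := near_q _ (divr_gt0 e0 K0); exists (u n); split.
  - by case: (hu n).
  - exact: lt_le_trans hn e1.
  rewrite (le_lt_trans (nr_dist (l *: u n) _ _)) // -scalerBr nrZ.
  have -> : e = e / (nr l + 1) + nr l * (e / (nr l + 1)) by field; rewrite gt_eqF.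
  by rewrite ltr_leD // ler_wpM2l ?nr_ge0 // ltW.
by exists q; split=> //; rewrite -nr_gt0 q1.
Qed.

Lemma semigroup_spectrum_eigen (l : R[i]) : spectrum A l ->
  exists x, [/\ x != 0, op_dom A x & A x = l *: x].
Proof.
move=> sl; have Nc : closed_subspace (fun=> True) by split.
suff aA : op_approx_eigenvalue A (fun=> True) l.
  by have [x [_ ? ? ?]] := semigroup_approx_eigenvalue Nc aA; exists x.
move=> e e0; apply: contrapT => nex; apply: sl.
apply: (resolvent_bounded_below A_normal e0) => x Ax.
have [->|xn] := eqVneq x 0; first by rewrite nr0 mulr0 nr_ge0.
by rewrite leNgt; apply/negP => /ltW h; apply: nex; exists x.
Qed.

Definition eigen_family (k : R) n (e : 'I_n -> H) := orthonormal_family e /\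
  forall i, exists l : R[i], [/\ op_dom A (e i), A (e i) = l *: e i & k <= complex.Re l].

(** [T 1] sends such a family to orthogonal vectors of norm at least [exp k]; a fixed compact set
    has room for boundedly many vectors at mutual distances at least [exp k]. *)
Lemma eigen_family_bounded (k : R) : exists B : nat, forall n (e : 'I_n -> H),
  eigen_family k e -> (n <= B)%N.
Proof.
have [K cK hK] := T1_compact.
have [B hB] := compact_totally_bounded cK (expR_gt0 k).
exists B => n e [oe ee]; apply: (hB n (fun i => T 1 (e i))) => [i|i j ij].
  by apply: hK; rewrite -(ler_pXn2r (n := 2)) ?nnegrE ?nr_ge0 // -ipxx /ip oe eqxx expr1n.
have [l [Ai ei kl]] := ee i; have [m [Aj ej km]] := ee j.
rewrite (semigroup_eigen ler01 Ai ei) (semigroup_eigen ler01 Aj ej).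
have n1 i' : nr (e i') = 1.
  have := nr_ge0 (e i'); have := ipxx (e i'); rewrite /ip oe eqxx /= => /esym/eqP.
  by rewrite sqrf_eq1 => /orP[/eqP->//|/eqP->]; rewrite oppr_ge0 ler10.
rewrite -(ler_pXn2r (n := 2)) ?nnegrE ?nr_ge0 ?expR_ge0 // nrB2 !nrZ !n1 !mulr1.
have -> : ip (cexp (1%:C * l) *: e i) (cexp (1%:C * m) *: e j) = 0.
  by rewrite /ip linearZl_LR linearZr_LR /= oe (negbTE ij) !mulr0.
rewrite !nr_cexp mulr0 subr0.
have ek : expR k ^+ 2 <= expR (complex.Re (1%:C * l)) ^+ 2.
  by rewrite ler_pXn2r ?nnegrE ?expR_ge0 // ler_expR; case: (l) kl => a b /=; rewrite mul1r mul0r subr0.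
by rewrite (le_trans ek) // lerDl sqr_ge0.
Qed.

Lemma semigroup_eigenspace_finite (l : R[i]) : finite_dimensional (op_eigenspace A l).
Proof.
have [AZ AD AB A00] := linear_opP lA.
have [B hB] := eigen_family_bounded (complex.Re l).
pose S x := op_dom A x /\ A x = l *: x.
have sS : subspace S.
  split=> [|a x y [Ax ex] [Ay ey]]; first by split; rewrite ?A00 ?scaler0 //; case: lA.
  have [_ AL] := lA; have [? e] := AL a x y Ax Ay; split=> //.
  by rewrite e ex ey scalerDr !scalerA mulrC.
have [|n [e [oe Se xe]]] := orthonormal_basis_ex (B := B) sS.
  move=> n e oe Se; apply: (hB n e); split=> // i; exists l.
  by have [? ?] := Se i; split.
exists n, e; apply/seteqP; split=> [x [Ax /eqP]|x [c ->]].
  rewrite subr_eq0 => /eqP ex; exists (fun i => dot x (e i)).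
  exact: xe.
have [? e'] := subspace_sum c sS Se; split=> //.
by rewrite e' subrr.
Qed.

Lemma eigenvector_unit (l : R[i]) x : x != 0 -> op_dom A x -> A x = l *: x ->
  exists y, [/\ nr y = 1, op_dom A y & A y = l *: y].
Proof.
move=> xn Ax ex; have [AZ _ _ _] := linear_opP lA; have nx : 0 < nr x by rewrite nr_gt0.
have [d e] := AZ (nr x)^-1%:C _ Ax; exists ((nr x)^-1%:C *: x); split=> //.
  by rewrite nrZ nr_real gtr0_norm ?invr_gt0 // mulVf ?gt_eqF.
by rewrite e ex !scalerA mulrC.
Qed.

Lemma eigen_dot (l m : R[i]) x y : op_dom A x -> A x = l *: x ->
  op_dom A y -> A y = m *: y -> l != m -> dot x y = 0.
Proof.
move=> Ax ex Ay ey lm; have [AZ _ _ _] := linear_opP lA.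
apply/dot_ip; split; first exact: (eigen_orthogonal A_normal Ax ex Ay ey).
have [d e] := AZ 'i%C _ Ax; apply: (eigen_orthogonal A_normal (l := l) d _ Ay ey lm).
by rewrite e ex !scalerA mulrC.
Qed.

Lemma spectrum_half_plane_finite (k : R) :
  finite_set [set l | spectrum A l /\ k <= complex.Re l].
Proof.
have [B hB] := eigen_family_bounded k.
apply: contrapT => /(infinite_set_fset B.+1)[F].
move: (finmap.fset_uniq F) => /=; set s := finmap.enum_fset F => us FS hs.
have {}FS l : l \in s -> spectrum A l /\ k <= complex.Re l by move=> ls; exact: FS.
have ex l : l \in s -> exists y, [/\ nr y = 1, op_dom A y & A y = l *: y].
  move=> ls; have [sl _] := FS _ ls.
  by have [x [xn Ax ex]] := semigroup_spectrum_eigen sl; exact: eigenvector_unit ex.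
pose L (i : 'I_(size s)) := nth 0 s i.
have LF i : L i \in s by apply: mem_nth.
have [e he] := choice (fun i => ex _ (LF i)).
have : (size s <= B)%N.
  apply: (hB _ e); split=> [i j|i]; last first.
    by exists (L i); have [_ ? ?] := he i; have [_ ?] := FS _ (LF i).
  have [ni Ai ei] := he i; have [nj Aj ej] := he j.
  have [->|ij] := eqVneq i j; first by rewrite dot_norm nrE nj expr1n.
  apply: (eigen_dot Ai ei Aj ej); apply: contra_neq ij => Lij.
  by apply/val_inj/eqP; rewrite -(nth_uniq 0 (ltn_ord i) (ltn_ord j) us); apply/eqP.
by move=> h; have := leq_trans hs h; rewrite ltnn.
Qed.

(** The natural numbers all lie in the right half plane, where the spectrum is finite. *)
Lemma semigroup_resolvent_nonempty : exists m, resolvent_set A m.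
Proof.
apply: contrapT => nm; have all_sp l : spectrum A l by move=> rl; apply: nm; exists l.
have fin := spectrum_half_plane_finite 0.
have := @finite_preimage _ _ _ (fun n : nat => n%:R%:C : R[i]) _ fin.
have -> : (fun n : nat => n%:R%:C : R[i]) @^-1` [set l | spectrum A l /\ 0 <= complex.Re l] = setT.
  apply/seteqP; split=> [//|n _]; split; first exact: all_sp.
  by rewrite /= ler0n.
move=> h; apply: infinite_nat; apply: h => m n _ _ /complexI /eqP.
by rewrite eqr_nat => /eqP.
Qed.

Lemma semigroup_eigen_perp x : eigen_perp A x -> x = 0.
Proof.
move=> Nx; apply: contrapT => /eqP xn.
have [m rm] := semigroup_resolvent_nonempty.
have [C [Cs [M [c [nC CR c0 ac]]]]] := eigen_perp_resolvent A_normal rm Nx xn.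
have [_ _ _ _ NC] := nC.
have aA := approx_eigenvalue_resolvent CR (fun y Ny => proj1 (NC y Ny)) c0 ac.
have [y [Ny yn Ay ey]] := semigroup_approx_eigenvalue (eigen_perp_closed A_normal) aA.
by case/eqP: yn; apply: (eigen_perp_eq0 Ny Ay ey).
Qed.

(** A finite spectrum lies in some half plane, so there is a longest orthonormal family of
    eigenvectors. It spans every eigenvector, and by totality all of [H]. *)
Lemma semigroup_spectrum_infinite : ~ finite_dimensional [set: H] -> ~ finite_set (spectrum A).
Proof.
move=> infH fin; apply: infH.
have [k hk] : exists k : R, forall l, spectrum A l -> k <= complex.Re l.
  move/finite_seqP: fin => [s ->]; elim: s => [|a s [k hk]]; first by exists 0.
  exists (Num.min k (complex.Re a)) => l; rewrite /= inE ge_min => /orP[/eqP->|ls].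
    by rewrite lexx orbT.
  by rewrite hk.
have [B hB] := eigen_family_bounded k.
pose P n := `[< exists e : 'I_n -> H, eigen_family k e >].
have P0 : exists n, P n by exists 0%N; apply/asboolP; exists (fun=> 0); split=> -[].
have PB n : P n -> (n <= B)%N by move=> /asboolP[e]; exact: hB.
case: (ex_maxnP P0 PB) => n /asboolP[e [oe ee]] nmax.
have [AZ AD AB A00] := linear_opP lA.
have span l x : op_dom A x -> A x = l *: x -> x = \sum_i dot x (e i) *: e i.
  move=> Ax ex; apply: contrapT => /eqP; rewrite -subr_eq0; set r := x - _ => rn.
  have re i : dot r (e i) = 0 by rewrite /r linearBl /= orthonormal_coef // subrr.
  have Sl : subspace (fun y => op_dom A y /\ A y = l *: y).
    split=> [|a y z [Ay ey] [Az ez]]; first by split; rewrite ?A00 ?scaler0 //; case: lA.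
    have [_ AL] := lA; have [? e'] := AL a y z Ay Az; split=> //.
    by rewrite e' ey ez scalerDr !scalerA mulrC.
  (* Terms of the Fourier sum that belong to eigenvalues other than [l] vanish, so the remainder
     stays in the eigenspace of [l]. *)
  have [Ar er] : op_dom A r /\ A r = l *: r.
    rewrite /r addrC -scaleN1r; apply: Sl.2 => //.
    have [S0 SL] := Sl; elim/big_rec: _ => // i y _ Sy.
    have [m [Ai ei _]] := ee i.
    have [lm|lm] := eqVneq l m; first by apply: SL; rewrite // lm.
    by rewrite (eigen_dot Ax ex Ai ei lm) scale0r add0r.
  have : P n.+1.
    apply/asboolP; exists (fun i : 'I_n.+1 =>
      if unlift ord_max i is Some j then e j else (nr r)^-1%:C *: r).
    split=> [|i]; first exact: orthonormal_extend.
    case: (unliftP ord_max i) => [j|] _; first exact: ee.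
    exists l; have [d e'] := AZ (nr r)^-1%:C _ Ar; split=> //.
      by rewrite e' er !scalerA mulrC.
    exact/hk/(op_eigenvalue_spectrum (x := r) lA).
  by move/nmax; rewrite ltnn.
exists n, e; apply/seteqP; split=> // y _; exists (fun i => dot y (e i)).
apply/eqP; rewrite -subr_eq0; apply/eqP/semigroup_eigen_perp => x l Ax ex.
set r := y - _; have re i : dot r (e i) = 0 by rewrite /r linearBl /= orthonormal_coef // subrr.
rewrite ipC (span l x Ax ex) /ip dot_suml big1 // => i _.
by rewrite (dotC r (e i)) re conjC0 mulr0.
Qed.

Lemma semigroup_spectrum_countable : countable (spectrum A).
Proof.
have -> : spectrum A = \bigcup_(k in [set: nat]) [set l | spectrum A l /\ - k%:R <= complex.Re l].
  apply/seteqP; split=> [l sl|l [k _ []//]]; exists (Num.truncn `|complex.Re l|).+1 => //.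
  split=> //; rewrite lerNl (le_trans (ler_norm _)) // normrN ltW //.
  exact: truncnS_gt.
apply: bigcup_countable => [|k _]; first exact: countableP.
exact/finite_set_countable/spectrum_half_plane_finite.
Qed.

Lemma semigroup_spectrum_limit_point : limit_point (spectrum A : set R[i]^o) = set0.
Proof.
apply/seteqP; split=> // l lim.
(* Points within 1 of [l] have real part at least [Re l - 1], and the spectrum is finite in that
   half plane. *)
have [r r0 hr] := finite_set_separated l (spectrum_half_plane_finite (complex.Re l - 1)).
have nl : nbhs (l : R[i]^o) [set z | nr (z - l) < Num.min 1 r].
  by apply/(@nbhs_nrP R[i]^o); exists (Num.min 1 r); rewrite // lt_min ltr01.
have [z [zl sz]] := lim _ nl; rewrite /= lt_min => /andP[z1 zr].
case/eqP: zl; apply: hr => //; split=> //.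
have := Re_le_nr (l - z); rewrite ReD ReN ler_norml nrBC => /andP[_].
by move=> h; have := le_lt_trans h z1; lra.
Qed.

Lemma semigroup_spectrum_Re (lambda : nat -> R[i]) :
  set_bij [set n | (0 < n)%N] (spectrum A) lambda ->
  complex.Re (lambda n) @[n --> \oo] --> -oo.
Proof.
move=> [lsub linj _]; apply/cvgrNyPle => M.
(* The arrangement starts at 1 and nothing is known of [lambda 0]; the shift restores injectivity on
   all naturals. *)
have inj : {in (fun n => lambda n.+1) @^-1` [set l | spectrum A l /\ M <= complex.Re l] &,
    injective (fun n => lambda n.+1)}.
  by move=> m n _ _ /linj; rewrite !inE /= => /(_ isT isT) [].
have /finite_seqP[s hs] := finite_preimage inj (spectrum_half_plane_finite M).
(* One successor undoes the shift, the other makes the inequality strict. *)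
exists (\max_(i <- s) i).+2 => //= n nmax; rewrite leNgt; apply/negP => /ltW Mn.
have n0 : (0 < n)%N by exact: leq_ltn_trans nmax.
have : [set` s] n.-1.
  by rewrite -hs /= (prednK n0); split=> //; exact: lsub.
move=> /= ns; have := @leq_bigmax_seq _ s xpredT (fun i => i) _ ns isT.
by rewrite leqNgt -ltnS (prednK n0) nmax.
Qed.

(** Both sides have the same inner product with every eigenvector of [A], and these are total. *)
Lemma semigroup_eigen_adjoint (t : R) (g : H -> H) (l : R[i]) e : 0 <= t ->
  adjoint_pair (T t) g -> op_dom A e -> A e = l *: e ->
  g e = (cexp (t%:C * l))^* *: e.
Proof.
move=> t0 tg Ae ee; apply/eqP; rewrite -subr_eq0; apply/eqP/semigroup_eigen_perp => x m Ax ex.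
rewrite ipC ipDr ipNr -tg (semigroup_eigen t0 Ax ex) ipZC conjCK.
have [->|ml] := eqVneq m l; first by rewrite subrr.
have [AZ _ _ _] := linear_opP lA.
have eig0 (c : R[i]) : ip (c *: x) e = 0.
  have [d e'] := AZ c _ Ax; apply: (eigen_orthogonal A_normal d _ Ae ee ml).
  by rewrite e' ex !scalerA mulrC.
by rewrite !eig0 subrr.
Qed.

Lemma semigroup_normal (t : R) : 0 <= t -> normal_op dot (total_op (T t)).
Proof.
move=> t0; have [TL _ _ _] := T_C0; have [lT cT] := TL t t0.
have [M M0 TM] := (lin_nrP lT).1 cT.
have [g tg] := adjoint_pair_ex lT M0 TM.
have lg := adjoint_pair_linear tg lT.
apply: (normal_total lT M0 TM tg) => x.
apply/eqP; rewrite -subr_eq0; apply/eqP/semigroup_eigen_perp => e l Ae ee.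
have [_ TZ _ _] := lin_facts lT; have [_ gZ _ _] := lin_facts lg.
have ge := semigroup_eigen_adjoint t0 tg Ae ee; have Te := semigroup_eigen t0 Ae ee.
have gt := adjoint_pair_sym tg.
rewrite ipDl ipNl tg gt gt tg ge TZ Te gZ ge !scalerA mulrC.
by rewrite subrr.
Qed.

End CompactSemigroup.

(** * Criteria for compactness *)

Lemma dot_norm_le x y : nr (dot x y) <= nr x * nr y.
Proof.
have [->|c0] := eqVneq (dot x y) 0; first by rewrite nr0 mulr_ge0 ?nr_ge0.
have nc : 0 < nr (dot x y) by rewrite nr_gt0.
rewrite -(ler_pM2l nc) -expr2.
(* Multiplying [x] by the conjugate of [dot x y] makes the product real, and Cauchy-Schwarz for [ip]
   applies. *)
have -> : nr (dot x y) ^+ 2 = ip ((dot x y)^* *: x) y.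
  rewrite /ip linearZl_LR /= mulrC -normCK nrE -rmorphXn /=; exact: erefl.
rewrite (le_trans (ip_le _ _)) // nrZ.
have -> : nr (dot x y)^* = nr (dot x y) by rewrite /nr norm_conjC.
by rewrite mulrA.
Qed.

(** Asks for a compact superset of the image of each ball, because sums and rank one maps then
    reduce to continuous images of compact sets. *)
Definition maps_to_compact (f : H -> H) := forall M : R,
  exists2 K : set H, compact K & forall x, nr x <= M -> K (f x).

Lemma maps_to_compactD (f g : H -> H) : maps_to_compact f -> maps_to_compact g ->
  maps_to_compact (fun x => f x + g x).
Proof.
move=> hf hg M; have [K cK fK] := hf M; have [L cL gL] := hg M.
exists ((fun p : H * H => p.1 + p.2) @` (K `*` L)).
  apply: continuous_compact; last exact: compact_setX.
  by apply: continuous_subspaceT; exact: add_continuous.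
by move=> x xM; exists (f x, g x) => //; split; [exact: fK | exact: gL].
Qed.

Lemma maps_to_compact_sum (I : Type) (s : seq I) (f : I -> H -> H) :
  (forall i, maps_to_compact (f i)) -> maps_to_compact (fun x => \sum_(i <- s) f i x).
Proof.
move=> hf; elim: s => [|i s IH] M.
  exists [set 0]; first exact: compact_set1.
  by move=> x _; rewrite big_nil.
have [K cK hK] := maps_to_compactD (hf i) IH M.
by exists K => // x xM; rewrite big_cons; exact: hK.
Qed.

Lemma maps_to_compact_rank1 (u v : H) : maps_to_compact (fun x => dot x u *: v).
Proof.
move=> M; exists ((fun p : R * R => (p.1 +i* p.2) *: v) @` (`[- (M * nr u), M * nr u] `*` `[- (M * nr u), M * nr u])).
  exact: compact_disc.
move=> x xM; exists (complex.Re (dot x u), complex.Im (dot x u)); last by case: (dot x u).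
have h : nr (dot x u) <= M * nr u.
  by rewrite (le_trans (dot_norm_le _ _)) // ler_wpM2r ?nr_ge0.
by split=> /=; rewrite in_itv /= -ler_norml (le_trans _ h) ?Re_le_nr ?Im_le_nr.
Qed.

(** Finitely many balls of radius [e] cover the closure of [S]: the points at hand are within
    [3 e / 4] of a center, a quarter each for the closure, for [K] and for the cover of [K]. An
    ultrafilter on the closure contains one of these balls, so it is Cauchy. *)
Lemma precompact_approx (S : set H) :
  (forall e : R, 0 < e -> exists2 K : set H, compact K &
    forall y, S y -> exists2 k, K k & nr (y - k) < e) ->
  precompact S.
Proof.
move=> hS; rewrite precompactE compact_ultra => F UF FS.
have /cauchy_cvgP/cvg_ex[p Fp] : cauchy F.
  apply: cauchy_exP => _ /gt0_real[e -> e0].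
  have e4 : 0 < e / 4 by rewrite divr_gt0.
  have [K cK hK] := hS _ e4.
  move: cK; rewrite compact_cover => cK.
  have [q _|x Kx|D _ KD] := cK H K (fun p => [set y | nr (y - p) < e / 4]).
  - rewrite openE => y /= yp; apply/nbhs_nrP; exists (e / 4 - nr (y - q)); first by rewrite subr_gt0.
    by move=> z /= zy; rewrite (le_lt_trans (nr_dist y _ _)) // -ltrBrDr.
  - by exists x => //=; rewrite subrr nr0.
  have /finite_seqP[s Ds] := finite_fset D.
  have Fs : F (fun y => exists2 q, q \in s & nr (y - q) < e).
    apply: filterS FS => y /= yS.
    have [z [Sz zy]] := yS [set z | nr (z - y) < e / 4] ltac:(by apply/nbhs_nrP; exists (e / 4)).
    have [k Kk zk] := hK _ Sz; have [q] := KD _ Kk; rewrite Ds /= => qs kq.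
    exists q => //; have := nr_dist z y q; have := nr_dist k z q; rewrite (nrBC y z) /= in zy *.
    by lra.
  have {Fs} : exists q, F [set y | nr (y - q) < e].
    elim: s {Ds} Fs => [|a s IH] Fs; first by have [y [q]] := filter_ex Fs.
    have [h|h] := in_ultra_setVsetC [set y | nr (y - a) < e] UF; first by exists a.
    apply: IH; apply: filterS (filterI Fs h) => y [[q]].
    rewrite inE => /orP[/eqP->//|qs yq _]; by exists q.
  move=> [q Fq]; exists q; apply: filterS Fq => y /= yq.
  by rewrite -ball_normE /= distrC nrE ltcR.
exists p; split=> //; apply: (closed_cvg _ _ _ _ Fp); first exact: closed_closure.
exact: FS.
Qed.

(** * Diagonal semigroups *)

Section DiagonalSemigroup.
Variable A : partial_op H.
Hypothesis A_normal : normal_op dot A.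
Variables (lam : nat -> R[i]) (dimE : nat -> nat) (e : forall k, 'I_(dimE k) -> H).
Hypothesis e_orthonormal : forall k, orthonormal_family (e (k := k)).
Hypothesis e_eigen : forall k (i : 'I_(dimE k)), op_dom A (e i) /\ A (e i) = lam k *: e i.
Hypothesis lam_inj : injective lam.
Hypothesis e_total : forall x, (forall k (i : 'I_(dimE k)), dot x (e i) = 0) -> x = 0.
Hypothesis lam_Re : forall M : R, exists n0, forall n, (n0 <= n)%N -> complex.Re (lam n) <= M.

Let lA : linear_op A. Proof. by case: A_normal. Qed.

Let P k x : H := \sum_(i < dimE k) dot x (e i) *: e i.

Let P_eigen k x : op_dom A (P k x) /\ A (P k x) = lam k *: P k x.
Proof.
have [_ _ _ A00] := linear_opP lA; have [A0 AL] := lA.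
rewrite /P; elim/big_rec: _ => [|i y _ [Ay ey]]; first by rewrite A00 scaler0.
have [Ai ei] := e_eigen i; have [? ->] := AL (dot x (e i)) _ _ Ai Ay.
by split=> //; rewrite ei ey scalerDr !scalerA mulrC.
Qed.

Let P_linear k : linear (P k).
Proof.
move=> a x y; rewrite /P scaler_sumr -big_split /=; apply: eq_bigr => i _.
by rewrite linearPl /= scalerDl scalerA.
Qed.

Let dot_P k x y : dot (P k x) y = dot x (P k y).
Proof.
rewrite /P dot_suml [RHS]dotC dot_suml rmorph_sum /=; apply: eq_bigr => i _.
by rewrite rmorphM /= -!dotC mulrC.
Qed.

Let P_sym k : adjoint_pair (P k) (P k).
Proof. by move=> x y; rewrite /ip dot_P. Qed.

Let PP k x : P k (P k x) = P k x.
Proof. by rewrite {1}/P; apply: eq_bigr => i _; rewrite orthonormal_coef. Qed.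

Let P_orth j k x y : j != k -> ip (P j x) (P k y) = 0.
Proof.
move=> jk; have [Ax ex] := P_eigen j x; have [Ay ey] := P_eigen k y.
by apply: (eigen_orthogonal A_normal Ax ex Ay ey); rewrite (inj_eq lam_inj).
Qed.

Let PPn j k x : j != k -> P j (P k x) = 0.
Proof. by move=> jk; apply: ip_all0 => y; rewrite P_sym P_orth // eq_sym. Qed.

Let P_total x : (forall k, P k x = 0) -> x = 0.
Proof.
move=> Px; apply: e_total => k i.
by rewrite -(orthonormal_coef (fun i => dot x (e i)) i (e_orthonormal (k := k))) -/(P k x) Px linear0l.
Qed.

Let P_uniq x y : (forall k, P k x = P k y) -> x = y.
Proof.
move=> h; apply/eqP; rewrite -subr_eq0; apply/eqP/P_total => k.
by have [_ _ _ ->] := lin_facts (P_linear k); rewrite h subrr.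
Qed.

(** Pythagoras; the hypothesis places [v k] in the [k]-th eigenspace. *)
Let sum_norm m n (v : nat -> H) : (forall k, P k (v k) = v k) ->
  nr (\sum_(m <= k < n) v k) ^+ 2 = \sum_(m <= k < n) nr (v k) ^+ 2.
Proof.
move=> Pv; have [nm|mn] := leqP n m; first by rewrite !big_geq // nr0 expr0n.
rewrite -(subnKC (ltnW mn)); elim: (n - m)%N => [|d IH].
  by rewrite addn0 !big_geq // nr0 expr0n.
rewrite addnS !big_nat_recr ?leq_addr //= nrD2 IH.
have -> : ip (\sum_(m <= i < m + d) v i) (v (m + d)%N) = 0; last by rewrite mulr0 addr0.
rewrite big_nat; elim/big_rec: _ => [|i y /andP[_ id] yE]; first by rewrite ip0l.
by rewrite ipDl yE addr0 -Pv -(Pv (m + d)%N) P_orth // neq_ltn id.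
Qed.

Let PZ k (a : R[i]) x : P k (a *: P k x) = a *: P k x.
Proof. by have [_ -> _ _] := lin_facts (P_linear k); rewrite PP. Qed.

Let mult_le (a : nat -> R[i]) (M : R) m n x : 0 <= M -> (forall k, (m <= k)%N -> nr (a k) <= M) ->
  nr (\sum_(m <= k < n) a k *: P k x) <= M * nr (\sum_(m <= k < n) P k x).
Proof.
move=> M0 aM; rewrite -(ler_pXn2r (n := 2)) ?nnegrE ?mulr_ge0 ?nr_ge0 // exprMn.
rewrite (sum_norm _ _ (fun k => PZ k (a k) x)) (sum_norm _ _ (fun k => PP k x)) mulr_sumr.
rewrite big_nat [leRHS]big_nat ler_sum // => k /andP[mk _].
by rewrite nrZ exprMn ler_wpM2r ?sqr_ge0 // ler_pXn2r ?nnegrE ?nr_ge0 // aM.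
Qed.

Let P_ip k x : ip x (P k x) = nr (P k x) ^+ 2.
Proof. by rewrite -ipxx P_sym PP. Qed.

Let sum_ip m n x : ip x (\sum_(m <= k < n) P k x) = nr (\sum_(m <= k < n) P k x) ^+ 2.
Proof.
rewrite (sum_norm _ _ (fun k => PP k x)).
rewrite (big_morph (ip x) (fun u v => ipDr u v x) (ip0r x)).
by apply: eq_bigr => k _; rewrite P_ip.
Qed.

Let sum_le m n x : nr (\sum_(m <= k < n) P k x) <= nr x.
Proof.
have := sum_ip m n x; set q := \sum_(_ <= _ < _) _ => h.
have [->|q0] := eqVneq q 0; first by rewrite nr0 nr_ge0.
have nq : 0 < nr q by rewrite nr_gt0.
by rewrite -(ler_pM2r nq) -expr2 -h ip_le.
Qed.

Let P_le k x : nr (P k x) <= nr x.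
Proof. by have := sum_le k k.+1 x; rewrite big_nat1. Qed.

Let PB k x y : P k (x - y) = P k x - P k y.
Proof. by have [_ _ _ ->] := lin_facts (P_linear k). Qed.

(** Reduces statements stable under sums and limits to single eigenspaces. *)
Lemma diagonal_subspace_full (W : H -> Prop) : closed_subspace W ->
  (forall k x, W (P k x)) -> forall x, W x.
Proof.
move=> Wc WP; apply: closed_subspace_full => // x hx; apply: P_total => k.
by apply/eqP; rewrite -nr_eq0 -sqrf_eq0 -P_ip hx.
Qed.

(** The vectors with this property form a closed subspace, because partial sums do not increase
    norms, and on an eigenspace the sums are eventually constant. *)
Let sum_cvg x (d : R) : 0 < d -> exists n0, forall n, (n0 <= n)%N ->
  nr (\sum_(0 <= k < n) P k x - x) < d.
Proof.
pose W x := forall d : R, 0 < d -> exists n0, forall n, (n0 <= n)%N ->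
  nr (\sum_(0 <= k < n) P k x - x) < d.
have QL n a u v : \sum_(0 <= k < n) P k (a *: u + v) =
    a *: \sum_(0 <= k < n) P k u + \sum_(0 <= k < n) P k v.
  by rewrite scaler_sumr -big_split /=; apply: eq_bigr => k _; rewrite P_linear.
suff : W x by exact.
apply: (diagonal_subspace_full (W := W)) => {x d} [|k x d d0]; last first.
  exists k.+1 => n kn; rewrite (bigD1_seq k) ?mem_index_iota ?iota_uniq //=.
  by rewrite PP big1 ?addr0 ?subrr ?nr0 // => j jk; rewrite PPn.
split.
- move=> d d0; exists 0%N => n _; rewrite big1 ?subrr ?nr0 // => k _.
  by have [] := lin_facts (P_linear k).
- move=> a u v Wu Wv d d0; have K0 : 0 < nr a + 1 by rewrite ltr_wpDl ?nr_ge0.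
  have [n1 h1] := Wu _ (divr_gt0 d0 K0); have [n2 h2] := Wv _ (divr_gt0 d0 K0).
  exists (maxn n1 n2) => n; rewrite geq_max => /andP[/h1 {}h1 /h2 {}h2].
  rewrite QL opprD addrACA -scalerBr (le_lt_trans (nrD _ _)) // nrZ.
  have -> : d = nr a * (d / (nr a + 1)) + d / (nr a + 1) by field; rewrite gt_eqF.
  by rewrite ler_ltD // ler_wpM2l ?nr_ge0 // ltW.
move=> x hx d d0; have d3 : 0 < d / 3 by rewrite divr_gt0.
have [y Wy yx] := hx _ d3; have [n0 h0] := Wy _ d3; exists n0 => n /h0 h.
have -> : \sum_(0 <= k < n) P k x - x =
    \sum_(0 <= k < n) P k (x - y) + (\sum_(0 <= k < n) P k y - y) + (y - x).
  have -> : \sum_(0 <= k < n) P k (x - y) = \sum_(0 <= k < n) P k x - \sum_(0 <= k < n) P k y.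
    by rewrite -sumrB; apply: eq_bigr => k _; rewrite PB.
  by rewrite subrKA addrA subrK.
have := nrD (\sum_(0 <= k < n) P k (x - y) + (\sum_(0 <= k < n) P k y - y)) (y - x).
have := nrD (\sum_(0 <= k < n) P k (x - y)) (\sum_(0 <= k < n) P k y - y).
by have := sum_le 0 n (x - y); rewrite (nrBC x y); lra.
Qed.

(** The functional calculus of a bounded sequence of multipliers: by [mult_le] the partial sums are
    Cauchy along with those of [P k x]. *)
Let mult_ex (a : nat -> R[i]) (M : R) x : 0 <= M -> (forall k, nr (a k) <= M) ->
  exists y, [/\ forall k, P k y = a k *: P k x, nr y <= M * nr x &
    forall d : R, 0 < d -> exists n0, forall n, (n0 <= n)%N ->
      nr (\sum_(0 <= k < n) a k *: P k x - y) < d].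
Proof.
move=> M0 aM.
have aM' m k : (m <= k)%N -> nr (a k) <= M by [].
have [d d0|y hy] := @complete_nr (fun n => \sum_(0 <= k < n) a k *: P k x).
  have K0 : 0 < 2 * (M + 1) by rewrite mulr_gt0 // ltr_wpDl.
  have [n0 h0] := sum_cvg x (divr_gt0 d0 K0); exists n0.
  have main n m : (n0 <= m)%N -> (m <= n)%N ->
      nr (\sum_(0 <= k < n) a k *: P k x - \sum_(0 <= k < m) a k *: P k x) < d.
    move=> n0m mn; have sub (v : nat -> H) : \sum_(0 <= k < n) v k - \sum_(0 <= k < m) v k = \sum_(m <= k < n) v k.
      by rewrite (big_cat_nat (n := m)) //= addrAC subrr add0r.
    rewrite sub (le_lt_trans (mult_le n x M0 (aM' m))) //.
    have := h0 m n0m; have := h0 n (leq_trans n0m mn).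
    rewrite !ltr_pdivlMr // -sub => h1 h2.
    have := nr_dist x (\sum_(0 <= k < n) P k x) (\sum_(0 <= k < m) P k x); rewrite (nrBC x) => h3.
    have := ler_wpM2l M0 h3.
    by have := nr_ge0 (\sum_(0 <= k < n) P k x - x); have := nr_ge0 (\sum_(0 <= k < m) P k x - x); lra.
  move=> n m n0n n0m; case: (leqP m n) => mn; first exact: main.
  by rewrite nrBC main // ltnW.
exists y; split=> //.
- move=> k; apply/eqP; rewrite -subr_eq0 -nr_eq0; apply/eqP/(@eq0_small _ 1) => d /hy[n0 h0].
  rewrite ger0_norm ?nr_ge0 // mulr1.
  have := h0 _ (leq_maxl n0 k.+1); set n := maxn n0 k.+1 => h.
  have kn : (k < n)%N by exact: leq_maxr.
  have <- : P k (\sum_(0 <= j < n) a j *: P j x) = a k *: P k x.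
    have [P0 PZ' PD _] := lin_facts (P_linear k).
    rewrite (big_morph (P k) PD P0) (bigD1_seq k) ?mem_index_iota ?iota_uniq //=.
    by rewrite PZ big1 ?addr0 // => j jk; rewrite PZ' PPn ?scaler0 // eq_sym.
  by rewrite -PB (le_trans (P_le _ _)) // nrBC ltW.
apply/ler_addgt0Pr => d /hy[n0 h0]; have := h0 n0 (leqnn _).
have := le_trans (mult_le n0 x M0 (aM' 0%N)) (ler_wpM2l M0 (sum_le 0 n0 x)).
have := nr_subr y (\sum_(0 <= k < n0) a k *: P k x); rewrite (nrBC y).
by lra.
Qed.

(** The bound is taken nonnegative so that [expR (t * w)] increases with [t]. *)
Let w_ex : exists2 w : R, 0 <= w & forall k, complex.Re (lam k) <= w.
Proof.
have [n0 h0] := lam_Re 0.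
have [w [w0 hw]] : exists w : R, 0 <= w /\ forall k, (k < n0)%N -> complex.Re (lam k) <= w.
  elim: (n0) => [|n [w [w0 hw]]]; first by exists 0.
  exists (Num.max w (complex.Re (lam n))); split=> [|k]; first by rewrite le_max w0.
  rewrite ltnS leq_eqVlt => /orP[/eqP->|/hw h]; rewrite le_max ?h ?lexx ?orbT //.
exists w => // k; case: (ltnP k n0) => [/hw//|/h0 h].
exact: le_trans h w0.
Qed.

Let w := sval (cid2 w_ex).
Let w0 : 0 <= w. Proof. by rewrite /w; case: cid2. Qed.
Let lam_w k : complex.Re (lam k) <= w. Proof. by rewrite /w; case: cid2. Qed.

Let ReZ (t : R) (z : R[i]) : complex.Re (t%:C * z) = t * complex.Re z.
Proof. by case: z => a b /=; rewrite mul0r subr0. Qed.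

Let cexp_le (t : R) k : 0 <= t -> nr (cexp (t%:C * lam k)) <= expR (t * w).
Proof. by move=> t0; rewrite nr_cexp ler_expR ReZ ler_wpM2l. Qed.

Let T_ex (t : R) x : exists y, 0 <= t -> [/\ forall k, P k y = cexp (t%:C * lam k) *: P k x,
  nr y <= expR (t * w) * nr x & forall d : R, 0 < d -> exists n0, forall n, (n0 <= n)%N ->
    nr (\sum_(0 <= k < n) cexp (t%:C * lam k) *: P k x - y) < d].
Proof.
(* Negative times receive the default value 0. *)
have [t0|t0] := leP 0 t; last by exists 0.
by have [y hy] := mult_ex x (expR_ge0 (t * w)) (fun k => cexp_le k t0); exists y.
Qed.

Let T t x := sval (cid (T_ex t x)).
Let TP t x : 0 <= t -> [/\ forall k, P k (T t x) = cexp (t%:C * lam k) *: P k x,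
  nr (T t x) <= expR (t * w) * nr x & forall d : R, 0 < d -> exists n0, forall n, (n0 <= n)%N ->
    nr (\sum_(0 <= k < n) cexp (t%:C * lam k) *: P k x - T t x) < d].
Proof. by rewrite /T; case: cid. Qed.

Let T_coord t x k : 0 <= t -> P k (T t x) = cexp (t%:C * lam k) *: P k x.
Proof. by move=> /TP - /(_ x)[]. Qed.

Let T_le t x : 0 <= t -> nr (T t x) <= expR (t * w) * nr x.
Proof. by move=> /TP - /(_ x)[]. Qed.

Let T_linear t : 0 <= t -> linear (T t).
Proof.
move=> t0 a x y; apply: P_uniq => k.
by rewrite T_coord // !P_linear !T_coord // scalerDr !scalerA mulrC.
Qed.

Let T_P t k x : 0 <= t -> T t (P k x) = cexp (t%:C * lam k) *: P k x.
Proof.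
move=> t0; apply: P_uniq => j; rewrite T_coord //.
have [_ -> _ _] := lin_facts (P_linear j).
by have [->//|jk] := eqVneq j k; rewrite PPn // !scaler0.
Qed.

(** The operators at times within 1 of [t] share the bound [M], so continuity passes to limits of
    vectors; on an eigenspace it is continuity of the exponential. *)
Let T_continuous_at t x (d : R) : 0 <= t -> 0 < d -> exists2 r : R, 0 < r &
  forall s, 0 <= s -> `|s - t| < r -> nr (T s x - T t x) < d.
Proof.
move=> t0 d0.
pose W x := forall d : R, 0 < d -> exists2 r : R, 0 < r &
  forall s, 0 <= s -> `|s - t| < r -> nr (T s x - T t x) < d.
suff : W x by exact.
pose M := expR ((t + 1) * w).
have M0 : 0 < M by exact: expR_gt0.
have TM s y : 0 <= s -> `|s - t| < 1 -> nr (T s y) <= M * nr y.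
  move=> s0 /ltW; rewrite ler_norml => /andP[_ st].
  rewrite (le_trans (T_le _ s0)) // ler_wpM2r ?nr_ge0 // ler_expR ler_wpM2r //.
  by lra.
apply: (diagonal_subspace_full (W := W)) => {x d d0} [|k x d d0].
  split.
  - move=> d d0; exists 1 => // s s0 _.
    have [-> _ _ _] := lin_facts (T_linear s0); have [-> _ _ _] := lin_facts (T_linear t0).
    by rewrite subrr nr0.
  - move=> a u v Wu Wv d d0; have K0 : 0 < nr a + 1 by rewrite ltr_wpDl ?nr_ge0.
    have [r1 r10 h1] := Wu _ (divr_gt0 d0 K0); have [r2 r20 h2] := Wv _ (divr_gt0 d0 K0).
    exists (Num.min r1 r2) => [|s s0]; first by rewrite lt_min r10.
    rewrite lt_min => /andP[/(h1 s s0) {}h1 /(h2 s s0) {}h2].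
    rewrite !T_linear // opprD addrACA -scalerBr (le_lt_trans (nrD _ _)) // nrZ.
    have -> : d = nr a * (d / (nr a + 1)) + d / (nr a + 1) by field; rewrite gt_eqF.
    by rewrite ler_ltD // ler_wpM2l ?nr_ge0 // ltW.
  move=> x hx d d0; have K0 : 0 < d / (3 * M) by rewrite divr_gt0 // mulr_gt0.
  have [y Wy yx] := hx _ K0; have [r r0 hr] := Wy _ (divr_gt0 d0 (ltr0n R 3)).
  exists (Num.min r 1) => [|s s0]; first by rewrite lt_min r0 ltr01.
  rewrite lt_min => /andP[sr s1].
  have [_ _ _ TsB] := lin_facts (T_linear s0); have [_ _ _ TtB] := lin_facts (T_linear t0).
  have -> : T s x - T t x = T s (x - y) + (T s y - T t y) + T t (y - x).
    by rewrite TsB TtB subrKA addrA subrK.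
  have := nrD (T s (x - y) + (T s y - T t y)) (T t (y - x)).
  have := nrD (T s (x - y)) (T s y - T t y).
  have := TM s (x - y) s0 s1; have := TM t (y - x) t0; rewrite subrr normr0 ltr01 => /(_ isT).
  have h : M * nr (y - x) < d / 3 by rewrite mulrC -ltr_pdivlMr // -mulrA -invfM.
  by rewrite (nrBC x y); have := hr s s0 sr; lra.
pose c := 3 * nr (lam k) * M * M * nr x.
have c0 : 0 <= c by rewrite !mulr_ge0 ?nr_ge0 // ltW.
have c1 : 0 < c + 1 by rewrite ltr_wpDl.
exists (Num.min 1 (d / (c + 1))) => [|s s0]; first by rewrite lt_min ltr01 divr_gt0.
rewrite lt_min => /andP[s1]; rewrite ltr_pdivlMr // => sd.
rewrite !T_P // -scalerBl nrZ.
(* Factoring out the exponential at the earlier time serves both [s <= t] and [t < s]. One [M]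
   bounds this factor, the other comes from [cexp_sub1_le]. *)
have key a b : 0 <= a -> a <= b -> a <= t + 1 -> b - a <= 1 ->
    nr (cexp (b%:C * lam k) - cexp (a%:C * lam k)) <= 3 * nr (lam k) * M * M * (b - a).
  move=> a0 ab at1 ba; have ba0 : 0 <= b - a by rewrite subr_ge0.
  have -> : cexp (b%:C * lam k) - cexp (a%:C * lam k) =
      cexp (a%:C * lam k) * (cexp ((b - a)%:C * lam k) - 1).
    by rewrite mulrBr mulr1 -cexpD -mulrDl -rmorphD /= (addrC a) subrK.
  rewrite nrM (_ : 3 * _ * M * M * _ = M * (3 * (nr (b - a)%:C * nr (lam k)) * M)); last first.
    by rewrite nr_real ger0_norm //; ring.
  rewrite ler_pM ?nr_ge0 //.
    by rewrite (le_trans (cexp_le k a0)) // ler_expR ler_wpM2r.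
  rewrite (le_trans (cexp_sub1_le _)) // nrM ler_wpM2l ?mulr_ge0 ?nr_ge0 // ler_expR ReZ.
  have tw : 0 <= (t + 1) * w by rewrite mulr_ge0 // addr_ge0.
  rewrite ge_max tw /= (le_trans (ler_wpM2l ba0 (lam_w k))) // ler_wpM2r //.
  by rewrite (le_trans ba) // lerDr.
have h : nr (cexp (s%:C * lam k) - cexp (t%:C * lam k)) <= 3 * nr (lam k) * M * M * `|s - t|.
  have [st|ts] := leP s t.
    rewrite nrBC distrC ger0_norm ?subr_ge0 // key //; first by lra.
    by move: s1; rewrite distrC ger0_norm ?subr_ge0 // => /ltW.
  rewrite ger0_norm ?subr_ge0 ?(ltW ts) // key ?(ltW ts) //; first by lra.
  by move: s1; rewrite ger0_norm ?subr_ge0 ?(ltW ts) // => /ltW.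
have h1 := ler_wpM2r (nr_ge0 (P k x)) h.
have h2 := ler_wpM2l (_ : 0 <= 3 * nr (lam k) * M * M * `|s - t|) (P_le k x).
have {}h2 := h2 ltac:(by rewrite !mulr_ge0 ?nr_ge0 // ltW).
by move: sd (normr_ge0 (s - t)); rewrite /c; lra.
Qed.

Let T_bounded t : 0 <= t -> continuous (T t).
Proof.
move=> t0; apply/(lin_nrP (T_linear t0)); exists (expR (t * w)); first exact: expR_gt0.
by move=> x; exact: T_le.
Qed.

Let T_C0 : C0_semigroup T.
Proof.
split.
- by move=> t t0; split; [exact: T_linear | exact: T_bounded].
- by move=> x; apply: P_uniq => k; rewrite T_coord // mul0r cexp0 scale1r.
- move=> s t x s0 t0; apply: P_uniq => k; rewrite !T_coord ?addr_ge0 //.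
  by rewrite scalerA -cexpD -mulrDl -rmorphD.
by move=> x; apply/semigroup_continuousP => t t0 d d0; exact: T_continuous_at.
Qed.

Let T_compact : immediately_compact T.
Proof.
move=> t t0; split; first by apply: T_linear; exact: ltW.
move=> B [M0 [M0r hM0]].
pose M := `|complex.Re M0| + 1.
have BM x : B x -> nr x <= M.
  move=> Bx; have : M0 < M%:C.
    by rewrite -(RRe_real M0r) ltcR /M (le_lt_trans (ler_norm _)) // ltrDl.
  by move=> /hM0/(_ x Bx); rewrite /= nrE lecR.
have M1 : 0 < M by rewrite ltr_wpDl.
apply: precompact_approx => d d0.
(* Once the real parts are at most [L], the multipliers are below [d / (2 M)], so on the ball of
   radius [M] the tail is at most [d / 2]. The remaining finite sum has finite rank. *)
have [L hL] : exists L, expR (t * L) < d / (2 * M).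
  have c0 : 0 < d / (2 * M) by rewrite divr_gt0 // mulr_gt0.
  exists ((ln (d / (2 * M)) - 1) / t).
  rewrite mulrC divfK ?gt_eqF // -ltr_ln ?posrE ?expR_gt0 // expRK.
  by lra.
have [n0 hn0] := lam_Re L.
pose S x := \sum_(0 <= k < n0) cexp (t%:C * lam k) *: P k x.
have SC : maps_to_compact S.
  apply: maps_to_compact_sum => k.
  have -> : (fun x => cexp (t%:C * lam k) *: P k x) =
      (fun x => \sum_(i <- enum 'I_(dimE k)) dot x (e i) *: (cexp (t%:C * lam k) *: e i)).
    apply/funext => x; rewrite /P scaler_sumr big_enum /=.
    by apply: eq_bigr => i _; rewrite !scalerA mulrC.
  by apply: maps_to_compact_sum => i; exact: maps_to_compact_rank1.
have [K cK hK] := SC M; exists K => // _ [x Bx <-]; exists (S x); first exact/hK/BM.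
have [_ _ hT] := TP x (ltW t0).
have [n1 hn1] := hT _ (divr_gt0 d0 (ltr0n R 2)); pose n := maxn n0 n1.
have {hn1} h1 := hn1 n (leq_maxr _ _).
have h2 : nr (\sum_(0 <= k < n) cexp (t%:C * lam k) *: P k x - S x) <= d / (2 * M) * M.
  rewrite /S (big_cat_nat (n := n0)) ?leq_maxl //= addrAC subrr add0r.
  apply: le_trans (mult_le n x (ltW (expR_gt0 (t * L))) _) _.
    by move=> k n0k; rewrite nr_cexp ler_expR ReZ ler_wpM2l ?(ltW t0) // hn0.
  rewrite ler_pM ?expR_ge0 ?nr_ge0 ?(ltW hL) //.
  by rewrite (le_trans (sum_le _ _ _)) // BM.
have := nr_dist (\sum_(0 <= k < n) cexp (t%:C * lam k) *: P k x) (T t x) (S x).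
rewrite (nrBC (T t x) (\sum_(0 <= k < n) _)).
have dM : d / (2 * M) * M = d / 2 by field; rewrite gt_eqF.
by rewrite dM in h2; move: h2 h1; lra.
Qed.

Let gen_pair x y := forall d : R, 0 < d -> exists2 r : R, 0 < r &
  forall h, 0 < h -> h < r -> nr ((h^-1)%:C *: (T h x - x) - y) < d.

Let gen_pairD x y x' y' : gen_pair x y -> gen_pair x' y' -> gen_pair (x + x') (y + y').
Proof.
move=> xy xy' d d0; have d2 : 0 < d / 2 by rewrite divr_gt0.
have [r r0 hr] := xy _ d2; have [s s0 hs] := xy' _ d2.
exists (Num.min r s) => [|h h0]; first by rewrite lt_min r0.
rewrite lt_min => /andP[/(hr h h0) {}hr /(hs h h0) {}hs].
have [_ _ TD _] := lin_facts (T_linear (ltW h0)).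
rewrite TD (opprD x x') addrACA scalerDr (opprD y y') addrACA.
by rewrite (le_lt_trans (nrD _ _)) // [d]splitr ltrD.
Qed.

Let gen_pair_P k x : gen_pair (P k x) (lam k *: P k x).
Proof.
move=> d d0; have K0 : 0 < nr (P k x) + 1 by rewrite ltr_wpDl ?nr_ge0.
have [r r0 hr] := cexp_quotient (lam k) (divr_gt0 d0 K0); exists r => // h h0 /(hr h h0).
rewrite T_P ?(ltW h0) // -{3}[P k x]scale1r -scalerBl scalerA -scalerBl nrZ.
rewrite ltr_pdivlMr // => hlt; apply: le_lt_trans hlt.
by rewrite ler_wpM2l ?nr_ge0 // lerDl.
Qed.

(** [P k] is symmetric and its range consists of eigenvectors of the adjoint. *)
Let P_adj k x : op_dom A x -> P k (A x) = lam k *: P k x.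
Proof.
move=> Ax; apply: ip_ext => z; rewrite P_sym ipZ P_sym.
have [AP eP] := P_eigen k z; have [d ee] := eigen_adjoint A_normal AP eP.
by have [_ -> _ _] := lin_facts (P_linear k); rewrite (adjoint_ip A_normal Ax d) ee.
Qed.

Let Q_dom n x : op_dom A (\sum_(0 <= k < n) P k x) /\
  A (\sum_(0 <= k < n) P k x) = \sum_(0 <= k < n) lam k *: P k x.
Proof.
have [_ AD _ A00] := linear_opP lA.
elim: n => [|n [d ee]]; first by rewrite !big_geq // A00; split=> //; case: lA.
have [dP eP] := P_eigen n x; have [? ?] := AD _ _ d dP.
by rewrite !big_nat_recr //= -ee -eP; split.
Qed.

Let norm_cmp (c : R) y z : 0 <= c -> (forall k, nr (P k y) <= c * nr (P k z)) -> nr y <= c * nr z.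
Proof.
move=> c0 h; apply/ler_addgt0Pr => d d0; have [n0 /(_ n0 (leqnn _)) hn] := sum_cvg y d0.
have le1 : nr (\sum_(0 <= k < n0) P k y) <= c * nr (\sum_(0 <= k < n0) P k z).
  rewrite -(ler_pXn2r (n := 2)) ?nnegrE ?mulr_ge0 ?nr_ge0 // exprMn.
  rewrite (sum_norm _ _ (fun k => PP k y)) (sum_norm _ _ (fun k => PP k z)) mulr_sumr.
  apply: ler_sum => k _; rewrite -exprMn ler_pXn2r ?nnegrE ?mulr_ge0 ?nr_ge0 //.
have le2 := ler_wpM2l c0 (sum_le 0 n0 z).
have := nr_subr y (\sum_(0 <= k < n0) P k y); rewrite (nrBC y).
by lra.
Qed.

Let quotient_coord h x k : 0 < h ->
  P k ((h^-1)%:C *: (T h x - x)) = ((h^-1)%:C * (cexp (h%:C * lam k) - 1)) *: P k x.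
Proof.
move=> /ltW h0; have [_ -> _ _] := lin_facts (P_linear k).
by rewrite PB T_coord // -{2}[P k x]scale1r -scalerBl scalerA.
Qed.

(** Uniform in [h]: each multiplier is at most [3 exp w |lam k|], and the [lam k *: P k x] are the
    coordinates of [A x]. *)
Let quotient_le h x : 0 < h -> h <= 1 -> op_dom A x ->
  nr ((h^-1)%:C *: (T h x - x)) <= 3 * expR w * nr (A x).
Proof.
move=> h0 h1 Ax; apply: norm_cmp => [|k]; first by rewrite mulr_ge0 ?expR_ge0.
rewrite quotient_coord // P_adj // !nrZ !nrM nr_real ger0_norm ?invr_ge0 ?(ltW h0) //.
rewrite mulrA ler_wpM2r ?nr_ge0 // mulrC ler_pdivrMr //.
apply: le_trans (cexp_sub1_le _) _.
rewrite nrM nr_real ger0_norm ?(ltW h0) // ReZ.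
rewrite (_ : 3 * expR w * nr (lam k) * h = 3 * (h * nr (lam k)) * expR w); last by ring.
rewrite ler_wpM2l ?mulr_ge0 ?nr_ge0 ?(ltW h0) // ler_expR ge_max w0 /=.
by rewrite (le_trans (ler_wpM2l (ltW h0) (lam_w k))) // ler_piMl.
Qed.

(** The finite sums [Q] approximate [x] in the graph norm of [A]. The quotients converge on [Q], and
    on [x - Q] they are small uniformly in [h] by [quotient_le]. *)
Let A_gen x : op_dom A x -> gen_pair x (A x).
Proof.
move=> Ax d d0; pose M := 3 * expR w.
have M0 : 0 <= M by rewrite mulr_ge0 ?expR_ge0.
have K0 : 0 < 3 * (M + 1) by rewrite mulr_gt0 // ltr_wpDl.
have [n /(_ n (leqnn _)) hn] := sum_cvg (A x) (divr_gt0 d0 K0).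
have [Qx eQ] := Q_dom n x; set Q := \sum_(0 <= k < n) P k x in Qx eQ.
have eQA : \sum_(0 <= k < n) P k (A x) = A Q.
  by rewrite eQ; apply: eq_bigr => k _; exact: P_adj.
have gQ : gen_pair Q (A Q).
  rewrite eQ /Q; elim: (n) => [|m IH].
    rewrite !big_geq // => r r0; exists 1 => // h h0 _.
    have [-> _ _ _] := lin_facts (T_linear (ltW h0)).
    by rewrite !subrr scaler0 subrr nr0.
  by rewrite !big_nat_recr //=; apply: gen_pairD => //; exact: gen_pair_P.
have [r r0 hr] := gQ _ (divr_gt0 d0 (ltr0n R 3)).
have [_ _ AB _] := linear_opP lA; have [xQ exQ] := AB _ _ Ax Qx.
exists (Num.min r 1) => [|h h0]; first by rewrite lt_min r0 ltr01.
rewrite lt_min => /andP[/(hr h h0) {}hr /ltW h1].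
have := quotient_le h0 h1 xQ; rewrite exQ -/M => h2.
move: hn; rewrite eQA nrBC ltr_pdivlMr // => hn.
have [_ _ _ TB] := lin_facts (T_linear (ltW h0)).
have -> : (h^-1)%:C *: (T h x - x) - A x = (h^-1)%:C *: (T h (x - Q) - (x - Q)) +
    ((h^-1)%:C *: (T h Q - Q) - A Q) + (A Q - A x).
  by rewrite (addrA _ _ (- A Q)) subrKA -scalerDr TB opprD (addrACA (T h x)) -opprD subrK.
have := nrD ((h^-1)%:C *: (T h (x - Q) - (x - Q)) + ((h^-1)%:C *: (T h Q - Q) - A Q)) (A Q - A x).
have := nrD ((h^-1)%:C *: (T h (x - Q) - (x - Q))) ((h^-1)%:C *: (T h Q - Q) - A Q).
have := nr_ge0 (A x - A Q); rewrite (nrBC (A Q)).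
by move: h2 hn hr; lra.
Qed.

(** In coordinates [P k y = lam k *: P k x], so [A] maps the partial sums of [x] to those of [y],
    and [A] is closed. *)
Let gen_A x y : gen_pair x y -> op_dom A x /\ A x = y.
Proof.
move=> xy; have Py k : P k y = lam k *: P k x.
  apply/eqP; rewrite -subr_eq0 -nr_eq0; apply/eqP/(@eq0_small _ 2) => d d0.
  rewrite ger0_norm ?nr_ge0 //.
  have [r r0 hr] := xy _ d0; have [s s0 hs] := @gen_pair_P k x _ d0.
  pose h := Num.min r s / 2.
  have m0 : 0 < Num.min r s by rewrite lt_min r0.
  have h0 : 0 < h by rewrite divr_gt0.
  have : h < Num.min r s by rewrite /h; lra.
  rewrite lt_min => /andP[/(hr h h0) h1 /(hs h h0) h2].
  have [_ PZ' _ PB'] := lin_facts (P_linear k).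
  have h3 : nr ((h^-1)%:C *: (T h (P k x) - P k x) - P k y) < d.
    have <- : P k ((h^-1)%:C *: (T h x - x) - y) = (h^-1)%:C *: (T h (P k x) - P k x) - P k y.
      by rewrite PB PZ' PB T_P ?T_coord // ltW.
    exact: le_lt_trans (P_le _ _) h1.
  have := nr_dist ((h^-1)%:C *: (T h (P k x) - P k x)) (P k y) (lam k *: P k x).
  by rewrite (nrBC (P k y) (h^-1%:C *: _)); lra.
have [_ _ /closed_graph_nrP cA _] := A_normal.
apply: cA => d d0; have [n1 h1] := sum_cvg x d0; have [n2 h2] := sum_cvg y d0.
have [Qx eQ] := Q_dom (maxn n1 n2) x; eexists; split; first exact: Qx.
  by apply: h1; rewrite leq_maxl.
rewrite eQ -(eq_bigr _ (fun k _ => Py k)).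
by apply: h2; rewrite leq_maxr.
Qed.

Lemma diagonal_semigroup : exists T : R -> H -> H,
  [/\ C0_semigroup T, immediately_compact T & op_eq A (generator T)].
Proof.
exists T; split=> //; split=> [|x Ax]; last by have [_ ->] := (generatorP T x (A x)).2 (A_gen Ax).
apply/seteqP; split=> x; first by move=> /A_gen/generatorP[].
by move=> Tx; have /generatorP/gen_A[] : op_dom (generator T) x /\ generator T x = generator T x by [].
Qed.

End DiagonalSemigroup.

(** * Enumeration of a discrete spectrum *)

Lemma op_eigenspace_basis (A : partial_op H) (l : R[i]) : linear_op A ->
  finite_dimensional (op_eigenspace A l) ->
  exists n (e : 'I_n -> H), [/\ orthonormal_family e,
    forall i, op_dom A (e i) /\ A (e i) = l *: e i &
    forall x, op_dom A x -> A x = l *: x -> x = \sum_i dot x (e i) *: e i].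
Proof.
move=> lA [n [v SE]]; have [_ _ _ A00] := linear_opP lA; have [A0 AL] := lA.
have sS : subspace (op_eigenspace A l).
  split=> [|a x y [Ax /subr0_eq ex] [Ay /subr0_eq ey]]; first by rewrite /op_eigenspace /= A00 scaler0 subrr.
  have [d ee] := AL a _ _ Ax Ay; split=> //.
  by rewrite ee ex ey scalerDr !scalerA (mulrC l) subrr.
have [m [e [oe Se eS]]] := orthonormal_basis_ex sS (fun m e => @orthonormal_span_size _ m e n v SE).
exists m, e; split=> // [i|x Ax ex]; first by have [? /subr0_eq] := Se i.
by apply: eS; split=> //; rewrite ex subrr.
Qed.

Lemma discrete_spectrum_semigroup (A : partial_op H) :
  normal_op dot A ->
  (spectrum A #= [set: nat])%card ->
  (forall l : R[i], spectrum A l -> finite_dimensional (op_eigenspace A l)) ->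
  limit_point (spectrum A : set R[i]^o) = set0 ->
  (forall lambda : nat -> R[i], set_bij [set n | (0 < n)%N] (spectrum A) lambda ->
     complex.Re (lambda n) @[n --> \oo] --> -oo) ->
  exists T : R -> H -> H, [/\ C0_semigroup T, immediately_compact T & op_eq A (generator T)].
Proof.
move=> nA cA fA dA reA; have lA : linear_op A by case: nA.
have iso (l : R[i]) : exists2 r : R, 0 < r &
    forall l', spectrum A l' -> nr (l' - l) < r -> l' = l.
  have : ~ limit_point (spectrum A : set R[i]^o) l by rewrite dA.
  rewrite not_limit_pointE => -[X /(@nbhs_nrP R[i]^o)[r r0 rX] XA].
  by exists r => // l' Al' l'l; apply: XA; split=> //; exact: rX.
have [m rm] : exists m, resolvent_set A m.
  (* [iso] holds at every complex number. Near 0 only 0 itself can be in the spectrum, so [r / 2] is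
     outside it. *)
  have [r r0 hr] := iso 0; exists (r / 2)%:C; apply: contrapT => sp.
  have /complexI h : (r / 2)%:C = 0%:C :> R[i].
    by apply: hr => //; rewrite subr0 nr_real ger0_norm ?divr_ge0 ?(ltW r0) // ltr_pdivrMr // ltr_pMr // ltr1n.
  by have := divr_gt0 r0 (ltr0n R 2); rewrite h ltxx.
have /(@card_set_bijP _ (R[i]^o)) [f [fS fI fJ]] : ([set: nat] #= (spectrum A : set R[i]^o))%card.
  by rewrite card_eq_sym.
have basis k := op_eigenspace_basis lA (fA _ (fS k I)).
have [dimE hE] := choice basis.
pose e k := sval (cid (hE k)).
have eP k : [/\ orthonormal_family (e k),
    forall i, op_dom A (e k i) /\ A (e k i) = f k *: e k i &
    forall x, op_dom A x -> A x = f k *: x -> x = \sum_i dot x (e k i) *: e k i].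
  by rewrite /e; case: cid.
apply: (@diagonal_semigroup A nA f dimE e).
- by move=> k; case: (eP k).
- by move=> k i; case: (eP k).
- by move=> j k; apply: fI; rewrite inE.
- move=> x xe; apply: (eigen_perp_discrete nA rm (fun l _ => iso l)) => y l Ay ey.
  have [->|y0] := eqVneq y 0; first by rewrite ip0r.
  have [k _ fk] := fJ _ (op_eigenvalue_spectrum lA y0 Ay ey).
  have [_ _ /(_ y Ay)] := eP k; rewrite fk => /(_ ey) ->.
  rewrite ipC /ip dot_suml big1 // => i _.
  by rewrite [dot _ x]dotC xe conjC0 mulr0.
(* Arrangements start at 1 and the enumeration [f] at 0, hence the predecessor. *)
move=> M; have : set_bij [set n | (0 < n)%N] (spectrum A) (fun n => f n.-1).
  split=> [n _|i j|l /fJ[k _ <-]]; first exact: fS.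
    rewrite !inE /= => i0 j0 /fI; rewrite !inE => /(_ I I) ij.
    by rewrite -(prednK i0) -(prednK j0) ij.
  by exists k.+1.
move=> bij; have re := reA _ bij; have [N _ hN] := (cvgrNyPle _).1 re M; exists N => n Nn.
by have := hN n.+1 (leqW Nn).
Qed.

End HilbertSpace.

Theorem corollary6p9 (R : realType) (H : completeNormedModType R[i])
    (dot : {dot H for Num.conj})
    (dot_norm : forall x : H, dot x x = `|x| ^+ 2)
    (H_infinite_dimensional : ~ finite_dimensional [set: H])
    (A : partial_op H)
    (A_normal : normal_op dot A)
    (A_neq0 : ~ op_eq A (total_op (fun _ : H => 0))) :
  ((exists T : R -> H -> H,
      [/\ C0_semigroup T, immediately_compact T & op_eq A (generator T)])
   <->
   [/\ (spectrum A #= [set: nat])%card,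
       (forall l : R[i], spectrum A l ->
          op_eigenvalue A l /\ finite_dimensional (op_eigenspace A l)),
       limit_point (spectrum A : set R[i]^o) = set0 &
       forall lambda : nat -> R[i],
         set_bij [set n | (0 < n)%N] (spectrum A) lambda ->
         complex.Re (lambda n) @[n --> \oo] --> -oo])
  /\
  (forall T : R -> H -> H,
     C0_semigroup T -> immediately_compact T -> op_eq A (generator T) ->
     forall t : R, 0 <= t -> normal_op dot (total_op (T t))).
Proof.
split; last by move=> T T_C0 T_compact A_gen; exact: (semigroup_normal dot_norm A_normal).
split=> [[T [T_C0 T_compact A_gen]]|[cardA eigA limA reA]]; last first.
  by apply: (discrete_spectrum_semigroup dot_norm A_normal) => // l /eigA[].
split.
- apply: eq_card_nat.
    exact: (semigroup_spectrum_countable dot_norm A_normal T_C0 T_compact A_gen).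
  exact: (semigroup_spectrum_infinite dot_norm A_normal T_C0 T_compact A_gen).
- move=> l sl; split; last exact: (semigroup_eigenspace_finite dot_norm A_normal T_C0 T_compact A_gen).
  have [x [x0 Ax ex]] := semigroup_spectrum_eigen dot_norm A_normal T_C0 T_compact A_gen sl.
  by exists x; split.
- exact: (semigroup_spectrum_limit_point dot_norm A_normal T_C0 T_compact A_gen).
exact: (semigroup_spectrum_Re dot_norm A_normal T_C0 T_compact A_gen).
Qed.
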